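(* Let $(X,d,\mathfrak m)$ be an essentially non-branching (geodesic) metric measure space, and $G$ a compact Lie group acting by isometries, such that $X^\ast=X/G$ is isometric to $[-1,1]$. Consider an associated tuple $(G,H,K_+,K_-)$ and assume that $K_\pm/H$ are connected. Then the fundamental group of $X$ is isomorphic to $$\big((\pi_1(G/H)/N_+)\ast(\pi_1(G/H)/N_-)\big)\big/N_0,$$ where $N_\pm=\ker\big((\rho_\pm)_\ast\colon\pi_1(G/H)\to\pi_1(G/K_\pm)\big)$ for the orbit projection maps $\rho_\pm\colon G/H\to G/K_\pm$, $\rho_\pm(gH)=gK_\pm$, and $N_0$ is the normal subgroup generated by $\{(\rho_+)_\ast(\omega)\,(\rho_-)_\ast(\omega)^{-1}\mid\omega\in\pi_1(G/H)\}$, with $(\rho_\pm)_\ast(\omega)$ regarded as the class of $\omega$ in $\pi_1(G/H)/N_\pm$.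
   Context: A metric measure space is a complete separable metric space with a non-negative Borel measure finite on balls; $\mathrm{Geo}(X)$ is the space of curves $\gamma:[0,1]\to X$ with $d(\gamma_t,\gamma_s)=|t-s|d(\gamma_0,\gamma_1)$, and $X$ is geodesic if any two points are joined by such a curve. Essentially non-branching: for all $\mu_0,\mu_1\in\mathbb P_2(X)$ (Borel probability measures with finite second moment) absolutely continuous with respect to $\mathfrak m$, every probability measure $\eta$ on $\mathrm{Geo}(X)$ such that $(e_0,e_1)_\#\eta$ is an optimal coupling of $\mu_0,\mu_1$ for the cost $d^2$ ($e_t(\gamma)=\gamma_t$) is concentrated on a set $\Gamma$ of non-branching geodesics, i.e. two elements of $\Gamma$ coinciding on $[0,t]$ for some $t\in(0,1)$ are equal. $X^\ast$ carries the metric $d^\ast(x^\ast,y^\ast)=d(G(x),G(y))$. Associated tuple: fix a geodesic of $X$ realizing the distance between the orbits over $-1$ and $+1$; its interior points all have the same isotropy group $H$, and the isotropy groups $K_-,K_+$ of its endpoints over $-1,+1$ contain $H$. Fundamental groups of $G/H$ and $G/K_\pm$ are based at the cosets $H$ and $K_\pm$; $\ast$ between groups denotes the free product. *)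

(* Defs.v *)
From HB Require Import structures.
From mathcomp Require Import all_boot all_order all_algebra generic_quotient.
From mathcomp Require Import all_classical all_reals all_analysis.
From mathcomp Require Import homotopy lra.

Set Implicit Arguments.
Unset Strict Implicit.
Unset Printing Implicit Defensive.

Import Order.TTheory GRing.Theory Num.Theory.
Import numFieldNormedType.Exports.

Local Open Scope classical_set_scope.
Local Open Scope quotient_scope.

Section Subgroups.
Local Open Scope group_scope.

Record subgroup (G : groupType) := Subgroup {
  subgroup_set :> set G;
  subgroup1 : subgroup_set 1;
  subgroupM : forall x y, subgroup_set x -> subgroup_set y ->
    subgroup_set (x * y);
  subgroupV : forall x, subgroup_set x -> subgroup_set x^-1 }.

Record normal_subgroup (G : groupType) := NormalSubgroup {
  normal_subgroup_group :> subgroup G;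
  normal_subgroupJ : forall x g, subgroup_set normal_subgroup_group x ->
    subgroup_set normal_subgroup_group (x ^ g) }.

Section Lcosets.
Context {G : groupType} (K : subgroup G).

Definition lcoset_rel (x y : G) : bool := `[< subgroup_set K (x^-1 * y) >].

Let lcoset_refl : reflexive lcoset_rel.
Proof. by move=> x; apply/asboolP; rewrite mulVg; exact: subgroup1. Qed.

Let lcoset_sym : symmetric lcoset_rel.
Proof.
suff H x y : lcoset_rel x y -> lcoset_rel y x.
  by move=> x y; apply/idP/idP; exact: H.
by move=> /asboolP /subgroupV; rewrite invgM invgK => Kyx; exact/asboolP.
Qed.

Let lcoset_trans : transitive lcoset_rel.
Proof.
move=> y x z /asboolP Kxy /asboolP Kyz; apply/asboolP.
by have := subgroupM Kxy Kyz; rewrite mulgA mulgK.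
Qed.

Canonical lcoset_equiv :=
  EquivRel lcoset_rel lcoset_refl lcoset_sym lcoset_trans.

Definition lcosets := {eq_quot lcoset_equiv}.
HB.instance Definition _ := Choice.on lcosets.
HB.instance Definition _ : EqQuotient _ lcoset_equiv lcosets :=
  EqQuotient.on lcosets.

Lemma lcosetsP (x y : G) : \pi_lcosets x = \pi_lcosets y <-> subgroup_set K (x^-1 * y).
Proof. by split=> [/eqmodP/asboolP|h]; [|apply/eqmodP/asboolP]. Qed.

End Lcosets.

Section QuotientGroup.
Context {G : groupType} (N : normal_subgroup G).

Definition quotient_group := lcosets N.
HB.instance Definition _ := EqQuotient.on quotient_group.
HB.instance Definition _ := Choice.on quotient_group.

Definition quotient_class (x : G) : quotient_group := \pi_quotient_group x.

Definition quotient_mul (p q : quotient_group) : quotient_group :=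
  quotient_class (repr p * repr q).
Definition quotient_inv (p : quotient_group) : quotient_group :=
  quotient_class (repr p)^-1.

Lemma quotient_classP (x y : G) :
  quotient_class x = quotient_class y <-> subgroup_set N (x^-1 * y).
Proof. exact: lcosetsP. Qed.

Lemma quotient_classM x y :
  quotient_mul (quotient_class x) (quotient_class y) = quotient_class (x * y).
Proof.
have rep z : subgroup_set N ((repr (quotient_class z))^-1 * z).
  by apply/quotient_classP; rewrite /quotient_class reprK.
apply/quotient_classP; move: (rep x) (rep y).
set x' := repr _; set y' := repr (quotient_class y) => Nx Ny.
have -> : (x' * y')^-1 * (x * y) = (x'^-1 * x) ^ y' * (y'^-1 * y).
  by rewrite /conjg invgM !mulgA mulgK.
by apply: subgroupM => //; exact: normal_subgroupJ.
Qed.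

Lemma quotient_classV x :
  quotient_inv (quotient_class x) = quotient_class x^-1.
Proof.
have : subgroup_set N ((repr (quotient_class x))^-1 * x).
  by apply/quotient_classP; rewrite /quotient_class reprK.
set x' := repr _ => Nx; apply/quotient_classP; rewrite invgK.
have -> : x' * x^-1 = ((x'^-1 * x) ^ x'^-1)^-1.
  by rewrite /conjg invgK !mulgA mulgV mul1g invgM invgK.
by apply: subgroupV; exact: normal_subgroupJ.
Qed.

Let quotient_mulA : associative quotient_mul.
Proof.
elim/quotW=> x; elim/quotW=> y; elim/quotW=> z.
by rewrite -!/(quotient_class _) !quotient_classM mulgA.
Qed.
Let quotient_mul1 : left_id (quotient_class 1) quotient_mul.
Proof.
by elim/quotW=> x; rewrite -!/(quotient_class _) !quotient_classM mul1g.
Qed.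
Let quotient_mul1r : right_id (quotient_class 1) quotient_mul.
Proof.
by elim/quotW=> x; rewrite -!/(quotient_class _) !quotient_classM mulg1.
Qed.
Let quotient_mulV : left_inverse (quotient_class 1) quotient_inv quotient_mul.
Proof.
elim/quotW=> x.
by rewrite -!/(quotient_class _) quotient_classV !quotient_classM mulVg.
Qed.
Let quotient_mulrV : right_inverse (quotient_class 1) quotient_inv quotient_mul.
Proof.
elim/quotW=> x.
by rewrite -!/(quotient_class _) quotient_classV !quotient_classM mulgV.
Qed.

HB.instance Definition _ := isGroup.Build quotient_group quotient_mulA
  quotient_mul1 quotient_mul1r quotient_mulV quotient_mulrV.

End QuotientGroup.

Section NormalClosure.
Context {G : groupType} (S : set G).

Definition normal_closure_set : set G :=
  [set x | forall N : normal_subgroup G, S `<=` N -> subgroup_set N x].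

Definition normal_closure_subgroup : subgroup G.
Proof.
exists normal_closure_set => [N _|x y Sx Sy N SN|x Sx N SN].
- exact: subgroup1.
- by apply: subgroupM; [exact: Sx|exact: Sy].
- by apply: subgroupV; exact: Sx.
Defined.

Definition normal_closure : normal_subgroup G.
Proof.
exists normal_closure_subgroup => x g Sx N SN.
by apply: normal_subgroupJ; exact: Sx.
Defined.

End NormalClosure.

Section Kernel.
Context {G H : groupType} (f : {multiplicative G -> H}).

Let f1 : f 1 = 1.
Proof. by apply: (mulgI (f 1)); rewrite -gmulfM !mulg1. Qed.

Let fV x : f x^-1 = (f x)^-1.
Proof. by apply: (mulgI (f x)); rewrite -gmulfM !mulgV f1. Qed.

Definition kernel_subgroup : subgroup G.
Proof.
exists [set x | f x = 1] => /= [//|x y fx fy|x fx].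
- by rewrite gmulfM fx fy mulg1.
- by rewrite fV fx invg1.
Defined.

Definition kernel : normal_subgroup G.
Proof.
exists kernel_subgroup => x g /= fx.
by rewrite /conjg !gmulfM fx mul1g fV mulVg.
Defined.

End Kernel.

Section FreeProduct.
Context {A B : groupType}.

(* The free product is the monoid of words in A + B modulo the congruence    *)
(* generated by the multiplications and units of A and B.                    *)
Inductive free_word_rel : seq (A + B) -> seq (A + B) -> Prop :=
| FreeRefl u : free_word_rel u u
| FreeSym u v : free_word_rel u v -> free_word_rel v u
| FreeTrans u v w :
    free_word_rel u v -> free_word_rel v w -> free_word_rel u w
| FreeCat u u' v v' : free_word_rel u u' -> free_word_rel v v' ->
    free_word_rel (u ++ v) (u' ++ v')
| FreeInl1 : free_word_rel [:: inl 1] [::]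
| FreeInr1 : free_word_rel [:: inr 1] [::]
| FreeInlM x y : free_word_rel [:: inl x; inl y] [:: inl (x * y)]
| FreeInrM x y : free_word_rel [:: inr x; inr y] [:: inr (x * y)].

Definition free_word_eq u v : bool := `[< free_word_rel u v >].

Let free_word_eq_refl : reflexive free_word_eq.
Proof. by move=> u; apply/asboolP; exact: FreeRefl. Qed.
Let free_word_eq_sym : symmetric free_word_eq.
Proof. by move=> u v; apply/asboolP/asboolP; exact: FreeSym. Qed.
Let free_word_eq_trans : transitive free_word_eq.
Proof. by move=> v u w /asboolP uv /asboolP /(FreeTrans uv) ?; apply/asboolP. Qed.

Canonical free_word_equiv :=
  EquivRel free_word_eq free_word_eq_refl free_word_eq_sym free_word_eq_trans.

Definition free_letter_inv (l : A + B) : A + B :=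
  match l with inl x => inl x^-1 | inr y => inr y^-1 end.
Definition free_word_inv (u : seq (A + B)) := rev (map free_letter_inv u).

Lemma free_word_invP u v :
  free_word_rel u v -> free_word_rel (free_word_inv u) (free_word_inv v).
Proof.
elim=> {u v}.
- by move=> u; exact: FreeRefl.
- by move=> u v _; exact: FreeSym.
- by move=> u v w _ uv _; exact: FreeTrans.
- move=> u u' v v' _ uu _ vv; rewrite /free_word_inv !map_cat !rev_cat.
  exact: FreeCat.
- by rewrite /free_word_inv /= invg1; exact: FreeInl1.
- by rewrite /free_word_inv /= invg1; exact: FreeInr1.
- by move=> x y; rewrite /free_word_inv /= invgM; exact: FreeInlM.
- by move=> x y; rewrite /free_word_inv /= invgM; exact: FreeInrM.
Qed.

Lemma free_word_invK u : free_word_inv (free_word_inv u) = u.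
Proof.
rewrite /free_word_inv map_rev revK -map_comp -[RHS]map_id.
by apply: eq_map => -[x|y] /=; rewrite invgK.
Qed.

Lemma free_word_mulV u : free_word_rel (u ++ free_word_inv u) [::].
Proof.
elim: u => [|l u IHu]; first exact: FreeRefl.
have -> : (l :: u) ++ free_word_inv (l :: u) =
    [:: l] ++ ((u ++ free_word_inv u) ++ [:: free_letter_inv l]).
  by rewrite /free_word_inv /= rev_cons -cats1 catA.
apply: (@FreeTrans _ ([:: l] ++ ([::] ++ [:: free_letter_inv l]))).
  by apply: FreeCat; [exact: FreeRefl|apply: FreeCat => //; exact: FreeRefl].
case: l => [x|y] /=.
- apply: FreeTrans; first exact: FreeInlM.
  by rewrite mulgV; exact: FreeInl1.
- apply: FreeTrans; first exact: FreeInrM.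
  by rewrite mulgV; exact: FreeInr1.
Qed.

Lemma free_word_mulVl u : free_word_rel (free_word_inv u ++ u) [::].
Proof. by have := free_word_mulV (free_word_inv u); rewrite free_word_invK. Qed.

End FreeProduct.

Definition free_product (A B : groupType) := {eq_quot @free_word_equiv A B}.

Section FreeProductGroup.
Context {A B : groupType}.
Local Notation F := (free_product A B).

HB.instance Definition _ : EqQuotient _ (@free_word_equiv A B) F :=
  EqQuotient.on F.
HB.instance Definition _ := Choice.on F.

Definition free_class (u : seq (A + B)) : F := \pi_F u.
Definition free_mul (p q : F) : F := free_class (repr p ++ repr q).
Definition free_inv (p : F) : F := free_class (free_word_inv (repr p)).
Definition free_inl (x : A) : F := free_class [:: inl x].
Definition free_inr (y : B) : F := free_class [:: inr y].

Lemma free_classP u v : free_class u = free_class v <-> free_word_rel u v.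
Proof. by split=> [/eqmodP/asboolP|h]; [|apply/eqmodP/asboolP]. Qed.

Let free_class_repr u : free_word_rel (repr (free_class u)) u.
Proof. by apply/free_classP; rewrite /free_class reprK. Qed.

Lemma free_classM u v :
  free_mul (free_class u) (free_class v) = free_class (u ++ v).
Proof. by apply/free_classP; apply: FreeCat; exact: free_class_repr. Qed.

Lemma free_classV u : free_inv (free_class u) = free_class (free_word_inv u).
Proof. by apply/free_classP; exact/free_word_invP/free_class_repr. Qed.

Let free_mulA : associative free_mul.
Proof.
elim/quotW=> u; elim/quotW=> v; elim/quotW=> w.
by rewrite -!/(free_class _) !free_classM catA.
Qed.
Let free_mul1 : left_id (free_class [::]) free_mul.
Proof. by elim/quotW=> u; rewrite -!/(free_class _) !free_classM. Qed.
Let free_mul1r : right_id (free_class [::]) free_mul.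
Proof. by elim/quotW=> u; rewrite -!/(free_class _) !free_classM cats0. Qed.
Let free_mulV : left_inverse (free_class [::]) free_inv free_mul.
Proof.
elim/quotW=> u; rewrite -!/(free_class _) free_classV !free_classM.
by apply/free_classP; exact: free_word_mulVl.
Qed.
Let free_mulrV : right_inverse (free_class [::]) free_inv free_mul.
Proof.
elim/quotW=> u; rewrite -!/(free_class _) free_classV !free_classM.
by apply/free_classP; exact: free_word_mulV.
Qed.

HB.instance Definition _ := isGroup.Build F free_mulA
  free_mul1 free_mul1r free_mulV free_mulrV.

End FreeProductGroup.

Definition group_isomorphic (G H : groupType) : Prop :=
  exists f : {multiplicative G -> H}, bijective f.

End Subgroups.

Section UnitInterval.
Local Open Scope ring_scope.
Variable R : realType.

Definition unit_interval := set_type (`[0%R, 1%R]%classic : set R).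
HB.instance Definition _ := Topological.on unit_interval.

Definition clamp (t : R) : R := Num.max 0 (Num.min t 1).

Lemma clamp_itv t : clamp t \in (`[0%R, 1%R]%classic : set R).
Proof.
rewrite inE /= in_itv /= /clamp le_max lexx /= ge_max ler01 /=.
by rewrite ge_min lexx orbT.
Qed.

Definition to_unit (t : R) : unit_interval := exist _ (clamp t) (clamp_itv t).

Lemma clamp_id t : 0 <= t <= 1 -> clamp t = t.
Proof. by move=> /andP[t0 t1]; rewrite /clamp (min_idPl t1) (max_idPr t0). Qed.

Lemma clamp_le0 t : t <= 0 -> clamp t = 0.
Proof.
by move=> t0; rewrite /clamp; apply/max_idPl; rewrite ge_min t0.
Qed.

Lemma clamp_ge1 t : 1 <= t -> clamp t = 1.
Proof. by move=> t1; rewrite /clamp (min_idPr t1) (max_idPr ler01). Qed.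

Lemma unit_itvP (t : unit_interval) : 0 <= \val t <= 1.
Proof. by case: t => t /=; rewrite inE /= in_itv. Qed.

Lemma to_unitK t : 0 <= t <= 1 -> \val (to_unit t) = t.
Proof. exact: clamp_id. Qed.

Lemma valK_unit (t : unit_interval) : to_unit (\val t) = t.
Proof. by apply: val_inj; rewrite /= clamp_id // unit_itvP. Qed.

Let unit0_neq1 : to_unit 0 != to_unit 1.
Proof.
apply/eqP => /(congr1 val) /=.
by rewrite !clamp_id ?lexx ?ler01 // => /eqP; rewrite eq_sym oner_eq0.
Qed.

HB.instance Definition _ :=
  @isBiPointed.Build unit_interval (to_unit 0) (to_unit 1) unit0_neq1.

Lemma val_unit0 : \val (zero : unit_interval) = 0.
Proof. by rewrite /= clamp_id // lexx ler01. Qed.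

Lemma val_unit1 : \val (one : unit_interval) = 1.
Proof. by rewrite /= clamp_id // lexx ler01. Qed.

Lemma continuous_clamp : continuous clamp.
Proof.
move=> t; rewrite /clamp.
apply: (@continuous_max R R (cst 0) (fun t => Num.min t 1)).
  exact: cvg_cst.
apply: (@continuous_min R R id (cst 1)); [exact: cvg_id|exact: cvg_cst].
Qed.

Lemma continuous_val_unit : continuous (\val : unit_interval -> R).
Proof. exact: initial_continuous. Qed.

Lemma continuous_to_unit : continuous to_unit.
Proof. by apply: continuous_comp_initial; exact: continuous_clamp. Qed.

End UnitInterval.

Lemma continuous_glue (R : realType) (S T : topologicalType)
    (phi : S -> R) (c : R) (a b : S -> T) :
  continuous phi -> continuous a -> continuous b ->
  (forall s, phi s = c -> a s = b s) ->
  continuous (fun s => if (phi s <= c)%R then a s else b s).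
Proof.
move=> cphi ca cb ab; set g := (fun s => _).
have cA : closed [set s | (phi s <= c)%R].
  apply: (@preimage_closed _ _ phi [set x | (x <= c)%R]); last exact: closed_le.
  by move=> s _; exact: cphi.
have cB : closed [set s | (c <= phi s)%R].
  apply: (@preimage_closed _ _ phi [set x | (c <= x)%R]); last exact: closed_ge.
  by move=> s _; exact: cphi.
have gA : {within [set s | (phi s <= c)%R], continuous g}.
  apply: (subspace_eq_continuous (f := a)); last exact: continuous_subspaceT.
  by move=> s; rewrite inE /= => sc; rewrite /from_subspace /g /= sc.
have gB : {within [set s | (c <= phi s)%R], continuous g}.
  apply: (subspace_eq_continuous (f := b)); last exact: continuous_subspaceT.
  move=> s; rewrite inE /= => cs; rewrite /from_subspace /g /=; case: ifP => // sc.
  by rewrite ab //; apply/eqP; rewrite eq_le sc cs.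
have := withinU_continuous cA cB gA gB.
have -> : [set s | (phi s <= c)%R] `|` [set s | (c <= phi s)%R] = [set: S].
  by apply/seteqP; split => // s _ /=; case: (leP (phi s) c) => h;
    [left|right; exact: ltW].
by move=> gT; apply/continuous_subspace_setT.
Qed.

Lemma cts_comp (S T U : topologicalType) (f : S -> T) (g : T -> U) :
  continuous f -> continuous g -> continuous (fun s => g (f s)).
Proof. by move=> cf cg s; apply: continuous_comp; [exact: cf|exact: cg]. Qed.

Lemma cts_pair (S T U : topologicalType) (f : S -> T) (g : S -> U) :
  continuous f -> continuous g -> continuous (fun s => (f s, g s)).
Proof. by move=> cf cg s; apply: cvg_pair; [exact: cf|exact: cg]. Qed.

Lemma cts_fst (S T : topologicalType) : continuous (fst : S * T -> S).
Proof. by move=> s; exact: cvg_fst. Qed.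

Lemma cts_snd (S T : topologicalType) : continuous (snd : S * T -> T).
Proof. by move=> s; exact: cvg_snd. Qed.

Section Paths.
Local Open Scope ring_scope.
Variable R : realType.
Local Notation I := (unit_interval R).
Context {T : topologicalType}.

Let cmulD (a b : R) : continuous (fun s : R => a * s + b).
Proof.
move=> s; apply: cvgD; last exact: cvg_cst.
by apply: cvgM; [exact: cvg_cst|exact: cvg_id].
Qed.

Let c2 : continuous (fun s : R => 2 * s).
Proof. by move=> s; apply: cvgM; [exact: cvg_cst|exact: cvg_id]. Qed.

Let c2B : continuous (fun s : R => 2 * s - 1).
Proof. by move=> s; apply: cvgB; [exact: c2|exact: cvg_cst]. Qed.

Let c1B : continuous (fun s : R => 1 - s).
Proof. by move=> s; apply: cvgB; [exact: cvg_cst|exact: cvg_id]. Qed.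

Let cmin (f g : R -> R) : continuous f -> continuous g ->
  continuous (fun s => Num.min (f s) (g s)).
Proof. by move=> cf cg s; apply: continuous_min; [exact: cf|exact: cg]. Qed.

Let cmax (f g : R -> R) : continuous f -> continuous g ->
  continuous (fun s => Num.max (f s) (g s)).
Proof. by move=> cf cg s; apply: continuous_max; [exact: cf|exact: cg]. Qed.

Let ccst (a : R) : continuous (fun _ : R => a).
Proof. by move=> s; exact: cvg_cst. Qed.

Let cval := @continuous_val_unit R.
Let cto := @continuous_to_unit R.

Let path0 (x y : T) (p : {path I from x to y}) : p zero = x.
Proof. exact: path_zero. Qed.

Let path1 (x y : T) (p : {path I from x to y}) : p one = y.
Proof. exact: path_one. Qed.

Definition path_ext (f : I -> T) (t : R) : T := f (to_unit t).

Lemma path_extE (f : I -> T) (t : I) : path_ext f (\val t) = f t.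
Proof. by rewrite /path_ext valK_unit. Qed.

Lemma path_ext_le0 (x y : T) (p : {path I from x to y}) t :
  t <= 0 -> path_ext p t = x.
Proof.
move=> t0; apply: (etrans _ (path0 p)); apply: (congr1 p).
by apply: val_inj; rewrite /= !clamp_le0.
Qed.

Lemma path_ext_ge1 (x y : T) (p : {path I from x to y}) t :
  1 <= t -> path_ext p t = y.
Proof.
move=> t1; apply: (etrans _ (path1 p)); apply: (congr1 p).
by apply: val_inj; rewrite /= !clamp_ge1.
Qed.

Lemma continuous_path_ext (f : I -> T) : continuous f -> continuous (path_ext f).
Proof.
by move=> cf t; apply: continuous_comp; [exact: continuous_to_unit|exact: cf].
Qed.

Let cext (x y : T) (p : {path I from x to y}) : continuous (path_ext p).
Proof. exact/continuous_path_ext/cts_fun. Qed.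

Section Concat.
Context (x y z : T) (p : {path I from x to y}) (q : {path I from y to z}).

Definition concat_fun (t : I) : T :=
  if \val t <= 2^-1 then path_ext p (2 * \val t)
  else path_ext q (2 * \val t - 1).

Let concat_cts : continuous concat_fun.
Proof.
apply: continuous_glue.
- exact: continuous_val_unit.
- exact: (cts_comp (cts_comp cval c2) (cext (p := p))).
- exact: (cts_comp (cts_comp cval c2B) (cext (p := q))).
- by move=> t th; rewrite path_ext_ge1 ?path_ext_le0 //; lra.
Qed.

Let concat_zero : concat_fun zero = x.
Proof.
by rewrite /concat_fun val_unit0 mulr0 path_ext_le0 // ifT // invr_ge0.
Qed.

Let concat_one : concat_fun one = z.
Proof.
rewrite /concat_fun val_unit1; case: ifPn => h; first by exfalso; lra.
by rewrite path_ext_ge1 //; lra.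
Qed.

Definition concat : {path I from x to z} := mk_path concat_cts concat_zero concat_one.

End Concat.

Section Reverse.
Context (x y : T) (p : {path I from x to y}).

Definition reverse_fun (t : I) : T := path_ext p (1 - \val t).

Let reverse_cts : continuous reverse_fun.
Proof.
exact: (cts_comp (cts_comp cval c1B) (cext (p := p))).
Qed.

Let reverse_zero : reverse_fun zero = y.
Proof. by rewrite /reverse_fun val_unit0 path_ext_ge1 //; lra. Qed.

Let reverse_one : reverse_fun one = x.
Proof. by rewrite /reverse_fun val_unit1 path_ext_le0 //; lra. Qed.

Definition reverse : {path I from y to x} :=
  mk_path reverse_cts reverse_zero reverse_one.

End Reverse.

Definition constant_path (x : T) : {path I from x to x} := cst x.

(* Homotopy relative to the endpoints; the first coordinate of [h] is the    *)
(* path parameter.                                                           *)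
Definition path_homotopic (x y : T) (p q : {path I from x to y}) : Prop :=
  exists h : I * I -> T, [/\ continuous h,
    forall s, h (s, zero) = p s, forall s, h (s, one) = q s
    & forall t, h (zero, t) = x /\ h (one, t) = y].

Section Homotopy.
Context (x y : T).
Implicit Types p q r : {path I from x to y}.

(* Straight-line homotopy between two reparametrizations of [w]. *)
Lemma path_homotopic_reparam p q (w : R -> T) (phi psi : R -> R) :
  continuous w -> continuous phi -> continuous psi ->
  phi 0 = psi 0 -> phi 1 = psi 1 ->
  (forall s : I, p s = w (phi (\val s))) ->
  (forall s : I, q s = w (psi (\val s))) -> path_homotopic p q.
Proof.
move=> cw cphi cpsi e0 e1 pE qE.
exists (fun st : I * I => w ((1 - \val st.2) * phi (\val st.1) +
  \val st.2 * psi (\val st.1))); split.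
- have cF : continuous (fun u : R * R => (1 - u.2) * phi u.1 + u.2 * psi u.1).
    move=> u; apply: cvgD; apply: cvgM.
    + by apply: cvgB; [exact: cvg_cst|exact: cvg_snd].
    + exact: (cts_comp (@cts_fst _ _) cphi).
    + exact: cvg_snd.
    + exact: (cts_comp (@cts_fst _ _) cpsi).
  apply: (cts_comp (cts_comp (cts_pair (cts_comp (@cts_fst _ _) cval)
    (cts_comp (@cts_snd _ _) cval)) cF) cw).
- by move=> s; rewrite pE val_unit0; congr w; rewrite subr0 mul1r mul0r addr0.
- by move=> s; rewrite qE val_unit1; congr w; rewrite subrr mul1r mul0r add0r.
- move=> t; split.
  + apply: (etrans _ (path0 p)); rewrite pE; congr w; rewrite /= -/(to_unit 0).
    rewrite -[clamp 0]/(\val (zero : I)) val_unit0 e0; lra.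
  + apply: (etrans _ (path1 p)); rewrite pE; congr w.
    rewrite /= -[clamp 1]/(\val (one : I)) val_unit1 e1; lra.
Qed.

Lemma path_homotopic_refl p : path_homotopic p p.
Proof.
exists (fun st => p st.1); split => //.
exact: (cts_comp (@cts_fst _ _) (@cts_fun _ _ p)).
Qed.

Lemma path_homotopic_sym p q : path_homotopic p q -> path_homotopic q p.
Proof.
move=> [h [ch h0 h1 hb]]; exists (fun st => h (st.1, to_unit (1 - \val st.2))).
split.
- exact: (cts_comp (cts_pair (@cts_fst _ _)
    (cts_comp (cts_comp (cts_comp (@cts_snd _ _) cval) c1B) cto)) ch).
- move=> s; rewrite -h1; congr (h (_, _)).
  by apply: val_inj; rewrite val_unit0 subr0.
- move=> s; rewrite -h0; congr (h (_, _)).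
  by apply: val_inj; rewrite val_unit1 subrr.
- by move=> t; have [] := hb (to_unit (1 - \val t)).
Qed.

Lemma path_homotopic_trans p q r :
  path_homotopic p q -> path_homotopic q r -> path_homotopic p r.
Proof.
move=> [h [ch h0 h1 hb]] [k [ck k0 k1 kb]].
exists (fun st => if \val st.2 <= 2^-1 then h (st.1, to_unit (2 * \val st.2))
  else k (st.1, to_unit (2 * \val st.2 - 1))).
have cc (f : R -> R) (g : I * I -> T) : continuous f -> continuous g ->
    continuous (fun st : I * I => g (st.1, to_unit (f (\val st.2)))).
  move=> cf; exact: (cts_comp (cts_pair (@cts_fst _ _)
    (cts_comp (cts_comp (cts_comp (@cts_snd _ _) cval) cf) cto))).
split.
- apply: continuous_glue.
  + exact: (cts_comp (@cts_snd _ _) cval).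
  + exact: (cc _ _ c2).
  + exact: (cc _ _ c2B).
  + move=> st sth.
    have -> : to_unit (2 * \val st.2) = one.
      by apply: val_inj; rewrite val_unit1 /= clamp_ge1 // sth; lra.
    have -> : to_unit (2 * \val st.2 - 1) = zero.
      by apply: val_inj; rewrite val_unit0 /= clamp_le0 // sth; lra.
    by rewrite h1 k0.
- move=> s; rewrite ifT.
    rewrite -h0; congr (h (_, _)).
    by apply: val_inj; rewrite val_unit0 mulr0 /= clamp_le0.
  by rewrite val_unit0; lra.
- move=> s; rewrite ifF; last by rewrite val_unit1; apply/negP => ?; lra.
  rewrite -k1; congr (k (_, _)).
  by apply: val_inj; rewrite val_unit1 /= clamp_ge1 //; lra.
- by move=> t; case: ifP => _; [have [] := hb (to_unit (2 * \val t))
    |have [] := kb (to_unit (2 * \val t - 1))].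
Qed.

End Homotopy.

Lemma path_homotopic_concat (x y z : T) (p p' : {path I from x to y})
    (q q' : {path I from y to z}) :
  path_homotopic p p' -> path_homotopic q q' ->
  path_homotopic (concat p q) (concat p' q').
Proof.
move=> [h [ch h0 h1 hb]] [k [ck k0 k1 kb]].
exists (fun st => if \val st.1 <= 2^-1 then h (to_unit (2 * \val st.1), st.2)
  else k (to_unit (2 * \val st.1 - 1), st.2)).
have cc (f : R -> R) (g : I * I -> T) : continuous f -> continuous g ->
    continuous (fun st : I * I => g (to_unit (f (\val st.1)), st.2)).
  move=> cf; exact: (cts_comp (cts_pair
    (cts_comp (cts_comp (cts_comp (@cts_fst _ _) cval) cf) cto) (@cts_snd _ _))).
have E1 t : 1 <= t -> to_unit t = one :> I.
  by move=> t1; apply: val_inj; rewrite val_unit1 /= clamp_ge1.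
have E0 t : t <= 0 -> to_unit t = zero :> I.
  by move=> t1; apply: val_inj; rewrite val_unit0 /= clamp_le0.
split.
- apply: continuous_glue.
  + exact: (cts_comp (@cts_fst _ _) cval).
  + exact: (cc _ _ c2).
  + exact: (cc _ _ c2B).
  + move=> st sth; rewrite E1 ?E0; try by rewrite sth; lra.
    by have [_ ->] := hb st.2; have [-> _] := kb st.2.
- by move=> s; rewrite h0 k0.
- by move=> s; rewrite h1 k1.
- move=> t; split.
  + rewrite ifT; last by rewrite val_unit0; lra.
    by rewrite E0 ?val_unit0 ?mulr0 //; have [] := hb t.
  + rewrite ifF; last by rewrite val_unit1; apply/negP => ?; lra.
    by rewrite E1 ?val_unit1; [have [] := kb t|lra].
Qed.

Lemma path_homotopic_reverse (x y : T) (p p' : {path I from x to y}) :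
  path_homotopic p p' -> path_homotopic (reverse p) (reverse p').
Proof.
move=> [h [ch h0 h1 hb]].
exists (fun st => h (to_unit (1 - \val st.1), st.2)); split.
- exact: (cts_comp (cts_pair (cts_comp (cts_comp (cts_comp (@cts_fst _ _) cval)
    c1B) cto) (@cts_snd _ _)) ch).
- by move=> s; rewrite h0.
- by move=> s; rewrite h1.
- move=> t; have [e0 e1] := hb t.
  have -> : to_unit (1 - \val (zero : I)) = one.
    by apply: val_inj; rewrite val_unit0 subr0.
  have -> : to_unit (1 - \val (one : I)) = zero.
    by apply: val_inj; rewrite val_unit1 subrr.
  by [].
Qed.

Lemma concat_pathE (x y z : T) (p : {path I from x to y})
    (q : {path I from y to z}) (s : R) : 0 <= s <= 1 ->
  path_ext (concat p q) s = if s <= 2^-1 then path_ext p (2 * s)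
    else path_ext q (2 * s - 1).
Proof.
by move=> s01; rewrite [LHS]/path_ext /= /concat /mk_path /concat_fun to_unitK.
Qed.

Lemma reverse_pathE (x y : T) (p : {path I from x to y}) (s : R) :
  0 <= s <= 1 -> path_ext (reverse p) s = path_ext p (1 - s).
Proof.
by move=> s01; rewrite [LHS]/path_ext /= /reverse /mk_path /reverse_fun to_unitK.
Qed.

Lemma concatA (x y z u : T) (p : {path I from x to y})
    (q : {path I from y to z}) (r : {path I from z to u}) :
  path_homotopic (concat p (concat q r)) (concat (concat p q) r).
Proof.
pose w := path_ext (concat p (concat q r)).
pose phi (s : R) := Num.min (2 * s + 0) (Num.min (1 * s + 4^-1) (2^-1 * s + 2^-1)).
have phiE s : [\/ s <= 4^-1 /\ phi s = 2 * s,
    4^-1 <= s /\ s <= 2^-1 /\ phi s = s + 4^-1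
    | 2^-1 <= s /\ phi s = 2^-1 * s + 2^-1].
  rewrite /phi; case: (leP s 4^-1) => h4; first constructor 1.
    by split=> //; rewrite (min_idPl _) ?addr0 // le_min; apply/andP; split; lra.
  case: (leP s 2^-1) => h2; [constructor 2|constructor 3].
    split; [lra|split=> //]; rewrite (min_idPr _); last by rewrite ge_min; apply/orP; left; lra.
    by rewrite (min_idPl _) ?mul1r //; lra.
  split; [lra|]; rewrite (min_idPr _); last by rewrite ge_min; apply/orP; right; lra.
  by rewrite (min_idPr _) //; lra.
apply: (@path_homotopic_reparam _ _ _ _ w id phi).
- exact/continuous_path_ext/cts_fun.
- by move=> s; exact: cvg_id.
- exact: (cmin (@cmulD 2 0) (cmin (@cmulD 1 4^-1) (@cmulD 2^-1 2^-1))).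
- by case: (phiE 0) => [[_ ->]|[? _]|[? _]]; [rewrite mulr0|exfalso; lra..].
- by case: (phiE 1) => [[? _]|[_ [? _]]|[_ ->]]; [exfalso; lra..|lra].
- by move=> s; rewrite /w path_extE.
- move=> t; have /andP[t0 t1] := unit_itvP t.
  rewrite -path_extE concat_pathE ?t0 //; set s := (\val t : R) in t0 t1 *.
  rewrite /w; case: (phiE s) => [[h ->]|[h [h' ->]]|[h ->]].
  + rewrite ifT; last lra.
    rewrite [RHS]concat_pathE; last lra.
    rewrite [in RHS]ifT; last lra.
    rewrite concat_pathE; last lra.
    by rewrite ifT //; lra.
  + rewrite ifT; last lra.
    rewrite concat_pathE; last lra.
    rewrite [RHS]concat_pathE; last lra.
    case: ifPn => a.
      have -> : s = 4^-1 by lra.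
      rewrite ifT; last lra.
      by congr path_ext; lra.
    rewrite [in RHS]ifF; last by apply/negP => ?; lra.
    rewrite concat_pathE; last lra.
    rewrite ifT; last lra.
    by congr path_ext; lra.
  + rewrite [RHS]concat_pathE; last lra.
    rewrite [in RHS]ifF; last by apply/negP => ?; lra.
    rewrite [RHS]concat_pathE; last lra.
    case: ifPn => a.
      have -> : s = 2^-1 by lra.
      rewrite path_ext_ge1; last lra.
      rewrite ifT; last lra.
      by rewrite path_ext_ge1 //; lra.
    rewrite [in RHS]ifF; last by apply/negP => ?; lra.
    by congr path_ext; lra.
Qed.

Lemma concat1p (x y : T) (p : {path I from x to y}) :
  path_homotopic (concat (constant_path x) p) p.
Proof.
apply: (@path_homotopic_reparam _ _ _ _ (path_ext p)
  (fun s => Num.max 0 (2 * s + (-1))) id).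
- exact/continuous_path_ext/cts_fun.
- exact: (cmax (@ccst 0) (@cmulD 2 (-1))).
- by move=> s; exact: cvg_id.
- by rewrite /= (max_idPl _) //; lra.
- by rewrite /= (max_idPr _) //; lra.
- move=> t; rewrite -[LHS]/(if \val t <= 2^-1 then x
    else path_ext p (2 * \val t - 1)).
  move: (\val t) => s; case: (leP s 2^-1) => h.
    by rewrite (max_idPl _) ?path_ext_le0 //; lra.
  by rewrite (max_idPr _) //; lra.
- by move=> t; rewrite path_extE.
Qed.

Lemma concatp1 (x y : T) (p : {path I from x to y}) :
  path_homotopic (concat p (constant_path y)) p.
Proof.
apply: (@path_homotopic_reparam _ _ _ _ (path_ext p)
  (fun s => Num.min 1 (2 * s + 0)) id).
- exact/continuous_path_ext/cts_fun.
- exact: (cmin (@ccst 1) (@cmulD 2 0)).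
- by move=> s; exact: cvg_id.
- by rewrite /= (min_idPr _) //; lra.
- by rewrite /= (min_idPl _) //; lra.
- move=> t; rewrite -[LHS]/(if \val t <= 2^-1 then path_ext p (2 * \val t)
    else y).
  move: (\val t) => s; case: (leP s 2^-1) => h.
    by rewrite (min_idPr _) ?addr0 //; lra.
  by rewrite (min_idPl _) ?path_ext_ge1 //; lra.
- by move=> t; rewrite path_extE.
Qed.

Lemma concatpV (x y : T) (p : {path I from x to y}) :
  path_homotopic (concat p (reverse p)) (constant_path x).
Proof.
apply: (@path_homotopic_reparam _ _ _ _ (path_ext p)
  (fun s => Num.min (2 * s + 0) ((-2) * s + 2)) (cst 0)).
- exact/continuous_path_ext/cts_fun.
- exact: (cmin (@cmulD 2 0) (@cmulD (-2) 2)).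
- exact: ccst.
- by rewrite /= (min_idPl _) //; lra.
- by rewrite /= (min_idPr _) //; lra.
- move=> t; have /andP[t0 t1] := unit_itvP t.
  rewrite -[LHS]/(if \val t <= 2^-1 then path_ext p (2 * \val t)
    else path_ext (reverse p) (2 * \val t - 1)).
  move: (\val t) t0 t1 => s t0 t1; case: (leP s 2^-1) => h.
    by rewrite (min_idPl _) ?addr0 //; lra.
  rewrite (min_idPr _); last lra.
  rewrite reverse_pathE; last lra.
  by congr path_ext; lra.
- by move=> t; rewrite /= path_ext_le0.
Qed.

Lemma concatVp (x y : T) (p : {path I from x to y}) :
  path_homotopic (concat (reverse p) p) (constant_path y).
Proof.
apply: (@path_homotopic_reparam _ _ _ _ (path_ext p)
  (fun s => Num.max ((-2) * s + 1) (2 * s + (-1))) (cst 1)).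
- exact/continuous_path_ext/cts_fun.
- exact: (cmax (@cmulD (-2) 1) (@cmulD 2 (-1))).
- exact: ccst.
- by rewrite /= (max_idPl _) //; lra.
- by rewrite /= (max_idPr _) //; lra.
- move=> t; have /andP[t0 t1] := unit_itvP t.
  rewrite -[LHS]/(if \val t <= 2^-1 then path_ext (reverse p) (2 * \val t)
    else path_ext p (2 * \val t - 1)).
  move: (\val t) t0 t1 => s t0 t1; case: (leP s 2^-1) => h.
    rewrite (max_idPl _); last lra.
    rewrite reverse_pathE; last lra.
    by congr path_ext; lra.
  by rewrite (max_idPr _) //; lra.
- by move=> t; rewrite /= path_ext_ge1.
Qed.

End Paths.

Section FundamentalGroup.
Local Open Scope group_scope.
Variables (R : realType) (T : topologicalType) (x : T).
Local Notation loop := {path (unit_interval R) from x to x}.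

Definition loop_eq (p q : loop) : bool := `[< path_homotopic p q >].

Let loop_eq_refl : reflexive loop_eq.
Proof. by move=> p; apply/asboolP; exact: path_homotopic_refl. Qed.
Let loop_eq_sym : symmetric loop_eq.
Proof. by move=> p q; apply/asboolP/asboolP; exact: path_homotopic_sym. Qed.
Let loop_eq_trans : transitive loop_eq.
Proof.
by move=> q p r /asboolP pq /asboolP qr; apply/asboolP;
  exact: path_homotopic_trans pq qr.
Qed.

Canonical loop_equiv := EquivRel loop_eq loop_eq_refl loop_eq_sym loop_eq_trans.

Definition pi1 := {eq_quot loop_equiv}.
HB.instance Definition _ : EqQuotient _ loop_equiv pi1 := EqQuotient.on pi1.
HB.instance Definition _ := Choice.on pi1.

Definition loop_class (p : loop) : pi1 := \pi_pi1 p.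
Definition pi1_mul (a b : pi1) : pi1 := loop_class (concat (repr a) (repr b)).
Definition pi1_inv (a : pi1) : pi1 := loop_class (reverse (repr a)).
Definition pi1_one : pi1 := loop_class (@constant_path R T x).

Lemma loop_classP (p q : loop) :
  loop_class p = loop_class q <-> path_homotopic p q.
Proof. by split=> [/eqmodP/asboolP|h]; [|apply/eqmodP/asboolP]. Qed.

Lemma loop_class_repr (p : loop) : path_homotopic (repr (loop_class p)) p.
Proof. by apply/loop_classP; rewrite /loop_class reprK. Qed.

Lemma loop_classM p q :
  pi1_mul (loop_class p) (loop_class q) = loop_class (concat p q).
Proof.
by apply/loop_classP; apply: path_homotopic_concat; exact: loop_class_repr.
Qed.

Lemma loop_classV p : pi1_inv (loop_class p) = loop_class (reverse p).
Proof. by apply/loop_classP/path_homotopic_reverse/loop_class_repr. Qed.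

Let pi1_mulA : associative pi1_mul.
Proof.
elim/quotW=> p; elim/quotW=> q; elim/quotW=> r.
rewrite -!/(loop_class _) !loop_classM; apply/loop_classP; exact: concatA.
Qed.
Let pi1_mul1 : left_id pi1_one pi1_mul.
Proof.
elim/quotW=> p; rewrite -!/(loop_class _) !loop_classM.
by apply/loop_classP; exact: concat1p.
Qed.
Let pi1_mul1r : right_id pi1_one pi1_mul.
Proof.
elim/quotW=> p; rewrite -!/(loop_class _) !loop_classM.
by apply/loop_classP; exact: concatp1.
Qed.
Let pi1_mulV : left_inverse pi1_one pi1_inv pi1_mul.
Proof.
elim/quotW=> p; rewrite -!/(loop_class _) loop_classV !loop_classM.
by apply/loop_classP; exact: concatVp.
Qed.
Let pi1_mulrV : right_inverse pi1_one pi1_inv pi1_mul.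
Proof.
elim/quotW=> p; rewrite -!/(loop_class _) loop_classV !loop_classM.
by apply/loop_classP; exact: concatpV.
Qed.

HB.instance Definition _ := isGroup.Build pi1 pi1_mulA pi1_mul1 pi1_mul1r
  pi1_mulV pi1_mulrV.

End FundamentalGroup.

Section InducedMap.
Local Open Scope group_scope.
Variables (R : realType) (T U : topologicalType) (f : continuousType T U).
Variables (x : T) (y : U) (fxy : f x = y).

Section PushLoop.
Variable p : {path (unit_interval R) from x to x}.

Let push_cts : continuous (f \o p).
Proof. exact: (cts_comp (@cts_fun _ _ p) (@cts_fun _ _ f)). Qed.
Let push_zero : (f \o p) zero = y.
Proof. by rewrite -fxy /= (path_zero (s := p)). Qed.
Let push_one : (f \o p) one = y.
Proof. by rewrite -fxy /= (path_one (s := p)). Qed.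

Definition push_loop : {path (unit_interval R) from y to y} :=
  mk_path push_cts push_zero push_one.

End PushLoop.

Lemma path_homotopic_push p q :
  path_homotopic p q -> path_homotopic (push_loop p) (push_loop q).
Proof.
move=> [h [ch h0 h1 hb]]; exists (f \o h); split.
- exact: (cts_comp ch (@cts_fun _ _ f)).
- by move=> s; rewrite /= h0.
- by move=> s; rewrite /= h1.
- by move=> t; have [e0 e1] := hb t; rewrite /= e0 e1.
Qed.

Definition pi1_map (a : pi1 R x) : pi1 R y := loop_class (push_loop (repr a)).

Lemma pi1_map_class p : pi1_map (loop_class p) = loop_class (push_loop p).
Proof. by apply/loop_classP/path_homotopic_push/loop_class_repr. Qed.

Let pi1_mapM : {morph pi1_map : a b / a * b >-> a * b}.
Proof.
elim/quotW=> p; elim/quotW=> q; rewrite -!/(loop_class _).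
rewrite -[loop_class p * _]/(pi1_mul _ _) loop_classM !pi1_map_class.
rewrite -[RHS]/(pi1_mul _ _) loop_classM; apply/loop_classP.
suff -> : push_loop (concat p q) = concat (push_loop p) (push_loop q).
  exact: path_homotopic_refl.
apply/path_eqP => t; rewrite /= /push_loop /concat /mk_path /= /concat_fun.
by case: ifP.
Qed.

HB.instance Definition _ := isMultiplicative.Build _ _ pi1_map pi1_mapM.

End InducedMap.
Arguments pi1_map R {T U f x y} fxy a.

HB.mixin Record isTopologicalGroup G & Group G & Topological G := {
  mulg_continuous : continuous (fun p : G * G => (p.1 * p.2)%g);
  invg_continuous : continuous (fun x : G => (x^-1)%g) }.

#[short(type="topologicalGroupType")]
HB.structure Definition TopologicalGroup :=
  {G of Group G & Topological G & isTopologicalGroup G}.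

Section Smooth.
Local Open Scope ring_scope.
Context {R : realType}.

(* On an open set, C^(k+1) means that all directional derivatives exist and  *)
(* are C^k. The functions are total: their values off [U] do not matter when *)
(* [U] is open.                                                              *)
Fixpoint Ck_on (k : nat) (n p : nat) (U : set 'rV[R]_n)
    (f : 'rV[R]_n -> 'rV[R]_p) : Prop :=
  (forall u, U u -> {for u, continuous f}) /\
  match k with
  | 0 => True
  | k'.+1 => (forall u v, U u -> derivable f u v) /\
             (forall v, Ck_on k' U (fun u => 'D_v f u))
  end.

Definition smooth_on (n p : nat) (U : set 'rV[R]_n)
  (f : 'rV[R]_n -> 'rV[R]_p) : Prop := open U /\ forall k, Ck_on k U f.

End Smooth.

Section Charts.
Local Open Scope ring_scope.
Variables (R : realType) (T : topologicalType).

(* Only the values of [chart_fun] on [chart_dom] and of [chart_inv] on       *)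
(* [chart_img] are meaningful.                                               *)
Record chart (n : nat) := Chart {
  chart_dom : set T;
  chart_fun : T -> 'rV[R]_n;
  chart_inv : 'rV[R]_n -> T;
  chart_dom_open : open chart_dom;
  chart_img_open : open (chart_fun @` chart_dom);
  chart_funK : forall x, chart_dom x -> chart_inv (chart_fun x) = x;
  chart_fun_continuous : forall x, chart_dom x -> {for x, continuous chart_fun};
  chart_inv_continuous : forall u, (chart_fun @` chart_dom) u ->
    {for u, continuous chart_inv} }.

Definition chart_img n (a : chart n) : set 'rV[R]_n :=
  chart_fun a @` chart_dom a.

Definition smooth_atlas n (A : set (chart n)) : Prop :=
  (forall x, exists2 a, A a & chart_dom a x) /\
  (forall a b, A a -> A b ->
    smooth_on (chart_fun a @` (chart_dom a `&` chart_dom b))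
      (chart_fun b \o chart_inv a)).

(* Smoothness of [f : T -> T] and of [g : T * T -> T] read in the charts of  *)
(* [A] and in the products of charts of [A].                                 *)
Definition smooth_map n (A : set (chart n)) (f : T -> T) : Prop :=
  forall a b, A a -> A b ->
    smooth_on (chart_fun a @` (chart_dom a `&` f @^-1` chart_dom b))
      (chart_fun b \o f \o chart_inv a).

Definition smooth_map2 n (A : set (chart n)) (g : T -> T -> T) : Prop :=
  forall a b c, A a -> A b -> A c ->
    smooth_on
      [set w : 'rV[R]_(n + n) | [/\ chart_img a (lsubmx w),
        chart_img b (rsubmx w)
        & chart_dom c (g (chart_inv a (lsubmx w)) (chart_inv b (rsubmx w)))]]
      (fun w => chart_fun c
        (g (chart_inv a (lsubmx w)) (chart_inv b (rsubmx w)))).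

End Charts.

(* The dimension may be 0, so that finite groups are included.               *)
Definition lie_group (R : realType) (G : topologicalGroupType) : Prop :=
  [/\ hausdorff_space G, @second_countable G &
    exists (n : nat) (A : set (chart R G n)),
      [/\ smooth_atlas A, smooth_map2 A (fun x y => x * y)%g
        & smooth_map A (fun x => x^-1)%g]].

Section CosetSpace.
Local Open Scope group_scope.
Variable G : topologicalGroupType.

Definition coset_space (K : subgroup G) := quotient_topology (lcosets K).
HB.instance Definition _ K := Topological.on (coset_space K).
HB.instance Definition _ K := Quotient.on (coset_space K).

Definition coset (K : subgroup G) (g : G) : coset_space K :=
  \pi_(coset_space K) g.

(* K/H as a subspace of G/H. Since G -> G/H is open, its subspace topology   *)
(* agrees with the quotient topology of K when H is contained in K.          *)
Definition coset_image (H K : subgroup G) : set (coset_space H) :=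
  coset H @` K.

Section OrbitProjection.
Variables (H K : subgroup G) (HK : H `<=` K).

(* gH |-> gK; the inclusion [HK] makes it independent of the representative. *)
Definition orbit_projection (p : coset_space H) : coset_space K :=
  let _ := HK in coset K (repr p).

Lemma orbit_projectionE g : orbit_projection (coset H g) = coset K g.
Proof.
apply/lcosetsP/HK/lcosetsP; exact: reprK.
Qed.

Let orbit_projection_cts : continuous orbit_projection.
Proof.
apply/quotient_continuous.
have -> : orbit_projection \o \pi_(coset_space H) = coset K.
  by apply/funext => g; exact: orbit_projectionE.
exact: pi_continuous.
Qed.

HB.instance Definition _ :=
  isContinuous.Build _ _ orbit_projection orbit_projection_cts.

End OrbitProjection.
End CosetSpace.
Arguments coset {G} K g.
Arguments coset_image {G} H K _.

(* Complete and measurable spaces are pointed in the library, so the space   *)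
(* comes with an arbitrary point, about which nothing is assumed.            *)
#[short(type="completeMetricType")]
HB.structure Definition CompleteMetric (R : numDomainType) :=
  {X of Metric R X & Complete X}.

Notation borel T := (g_sigma_algebraType (@open T)).

Section MetricMeasure.
Local Open Scope ring_scope.
Context {R : realType}.

Definition metric_measure_space (X : completeMetricType R)
    (m : {measure set (borel X) -> \bar R}) : Prop :=
  (exists2 D : set X, countable D & dense D) /\
  (forall (x : X) (r : R), m (ball x r) < +oo)%E.

Record geodesic (X : metricType R) := Geodesic {
  geodesic_fun :> unit_interval R -> X;
  geodesicP : forall s t, mdist (geodesic_fun s) (geodesic_fun t) =
    `|\val s - \val t| * mdist (geodesic_fun zero) (geodesic_fun one) }.

Definition geodesic_space (X : metricType R) : Prop :=
  forall x y : X, exists c : geodesic X, c zero = x /\ c one = y.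

End MetricMeasure.

Section GeodesicTopology.
Local Open Scope ring_scope.
Context {R : realType} (X : completeMetricType R).

HB.instance Definition _ := gen_eqMixin (geodesic X).
HB.instance Definition _ := gen_choiceMixin (geodesic X).

Definition geodesic_to_uniform (c : geodesic X) :
  {uniform unit_interval R -> X} := c.

(* Geo(X) carries the uniform distance, hence the Borel sets it induces.     *)
HB.instance Definition _ :=
  Topological.copy (geodesic X) (initial_topology geodesic_to_uniform).

Definition constant_geodesic (x : X) : geodesic X.
Proof. by exists (cst x) => s t; rewrite /cst mdistxx mulr0. Defined.

HB.instance Definition _ := isPointed.Build (geodesic X) (constant_geodesic point).

End GeodesicTopology.

Section OptimalTransport.
Local Open Scope ring_scope.
Local Open Scope ereal_scope.
Context {R : realType} (X : completeMetricType R).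

Definition finite_second_moment (mu : set (borel X) -> \bar R) : Prop :=
  exists x0 : X, \int[mu]_x ((mdist x0 x ^+ 2)%R)%:E < +oo.

(* The product of the Borel sigma-algebras is the Borel sigma-algebra of the *)
(* product since X is separable.                                             *)
Definition coupling (mu0 mu1 : set (borel X) -> \bar R)
    (pi : set (borel X * borel X) -> \bar R) : Prop :=
  forall A : set (borel X), measurable A ->
    pi (A `*` setT) = mu0 A /\ pi (setT `*` A) = mu1 A.

Definition transport_cost (pi : set (borel X * borel X) -> \bar R) : \bar R :=
  \int[pi]_p ((mdist p.1 p.2 ^+ 2)%R)%:E.

Definition optimal_coupling (mu0 mu1 : set (borel X) -> \bar R)
    (pi : set (borel X * borel X) -> \bar R) : Prop :=
  coupling mu0 mu1 pi /\
  forall pi' : probability (borel X * borel X)%type R,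
    coupling mu0 mu1 pi' -> transport_cost pi <= transport_cost pi'.

Definition geodesic_ends (c : borel (geodesic X)) : borel X * borel X :=
  ((c : geodesic X) zero, (c : geodesic X) one).

Definition nonbranching_set (Gam : set (geodesic X)) : Prop :=
  forall c c', Gam c -> Gam c' -> forall t : R, (0 < t < 1)%R ->
    (forall s : unit_interval R, (\val s <= t)%R -> c s = c' s) -> c = c'.

Definition essentially_nonbranching
    (m : {measure set (borel X) -> \bar R}) : Prop :=
  forall mu0 mu1 : probability (borel X) R,
    finite_second_moment mu0 -> finite_second_moment mu1 ->
    mu0 `<< m -> mu1 `<< m ->
  forall eta : probability (borel (geodesic X)) R,
    optimal_coupling mu0 mu1 (pushforward eta geodesic_ends) ->
  exists2 Gam : set (geodesic X),
    nonbranching_set Gam & eta.-negligible (~` Gam).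

End OptimalTransport.

Section Actions.
Local Open Scope ring_scope.
Context {R : realType} {X : completeMetricType R} {G : topologicalGroupType}.

(* As usual for topological groups, an action is jointly continuous.         *)
Record isometric_action := IsometricAction {
  act :> G -> X -> X;
  act1 : forall x, act 1%g x = x;
  actM : forall g h x, act (g * h)%g x = act g (act h x);
  act_isometry : forall g x y, mdist (act g x) (act g y) = mdist x y;
  act_continuous : continuous (fun p : G * X => act p.1 p.2) }.

Variable a : isometric_action.

Definition isotropy (x : X) : subgroup G.
Proof.
exists [set g | a g x = x] => /= [|g h gx hx|g gx].
- exact: act1.
- by rewrite actM hx gx.
- by rewrite -{1}gx -actM mulVg act1.
Defined.

Definition orbit (x : X) : set X := range (a ^~ x).

Definition orbit_rel (x y : X) : bool := `[< orbit x y >].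

Let orbit_rel_refl : reflexive orbit_rel.
Proof. by move=> x; apply/asboolP; exists 1%g => //; exact: act1. Qed.
Let orbit_rel_sym : symmetric orbit_rel.
Proof.
suff H x y : orbit_rel x y -> orbit_rel y x.
  by move=> x y; apply/idP/idP; exact: H.
move=> /asboolP[g _ <-]; apply/asboolP; exists g^-1%g => //.
by rewrite -actM mulVg act1.
Qed.
Let orbit_rel_trans : transitive orbit_rel.
Proof.
move=> y x z /asboolP[g _ <-] /asboolP[h _ <-]; apply/asboolP.
by exists (h * g)%g => //; rewrite actM.
Qed.

Canonical orbit_equiv :=
  EquivRel orbit_rel orbit_rel_refl orbit_rel_sym orbit_rel_trans.

Definition orbit_space := {eq_quot orbit_equiv}.
HB.instance Definition _ : EqQuotient _ orbit_equiv orbit_space :=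
  EqQuotient.on orbit_space.
HB.instance Definition _ := Choice.on orbit_space.

Definition orbit_class (x : X) : orbit_space := \pi_orbit_space x.

Definition set_dist (A B : set X) : R := inf [set mdist x y | x in A & y in B].

Definition orbit_dist (p q : orbit_space) : R :=
  set_dist (orbit (repr p)) (orbit (repr q)).

Definition isometry_onto_interval (f : orbit_space -> R) : Prop :=
  (forall p q, `|f p - f q| = orbit_dist p q) /\
  range f = `[-1, 1]%classic.

Definition orbit_over (f : orbit_space -> R) (t : R) : set X :=
  [set x | f (orbit_class x) = t].

(* A shortest geodesic from the orbit over -1 to the orbit over +1, together *)
(* with the common isotropy group of its interior points.                    *)
Record associated_tuple (f : orbit_space -> R) := AssociatedTuple {
  tuple_geodesic : geodesic X;
  tuple_start : orbit_over f (-1) (tuple_geodesic zero);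
  tuple_end : orbit_over f 1 (tuple_geodesic one);
  tuple_dist : mdist (tuple_geodesic zero) (tuple_geodesic one) =
    set_dist (orbit_over f (-1)) (orbit_over f 1);
  tuple_H : subgroup G;
  tuple_isotropy : forall t : unit_interval R, 0 < \val t < 1 ->
    isotropy (tuple_geodesic t) = tuple_H :> set G }.

Section Tuple.
Context {f : orbit_space -> R} (T : associated_tuple f).

Definition tuple_Kminus : subgroup G := isotropy (tuple_geodesic T zero).
Definition tuple_Kplus : subgroup G := isotropy (tuple_geodesic T one).

Let isotropy_limit (c : geodesic X) (H : set G) (e : unit_interval R) :
  (forall t : unit_interval R, 0 < \val t < 1 -> H `<=` isotropy (c t)) ->
  (forall r : R, 0 < r -> exists t : unit_interval R,
    0 < \val t < 1 /\ `|\val t - \val e| < r) ->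
  H `<=` isotropy (c e).
Proof.
move=> Hc eI g Hg; apply/esym; apply: (@mdist_positivity R X).
set d := mdist _ _; set D := mdist (c zero) (c one).
have D0 : 0 <= D by exact: mdist_ge0.
have d0 : 0 <= d by exact: mdist_ge0.
apply/eqP; rewrite eq_le d0 andbT leNgt; apply/negP => dgt.
have r0 : 0 < d / (2 * (D + 1)) by apply: divr_gt0 => //; lra.
have [t [t01 tr]] := eI _ r0.
have gt : a g (c t) = c t by exact: (Hc t t01 g Hg).
have : d <= mdist (c e) (c t) + mdist (c t) (a g (c e)).
  exact: metric_triangle.
rewrite -[X in mdist X (a g _)]gt act_isometry (metric_sym (c e)) geodesicP.
rewrite -/D; move: tr; set u := `|_| => tr.
have u0 : 0 <= u by exact: normr_ge0.
have : u * (2 * (D + 1)) < d by rewrite -ltr_pdivlMr //; lra.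
nra.
Qed.

Lemma tuple_H_Kminus : tuple_H T `<=` tuple_Kminus.
Proof.
apply: isotropy_limit => [t t01|r r0]; first by rewrite tuple_isotropy.
exists (to_unit (Num.min (r / 2) 2^-1)).
have [] : 0 < Num.min (r / 2) 2^-1 /\ Num.min (r / 2) 2^-1 <= 2^-1
    /\ Num.min (r / 2) 2^-1 < r.
  rewrite lt_min !gt_min ge_min lexx orbT; split; last split=> //.
    by apply/andP; split; lra.
  by apply/orP; left; lra.
move: (Num.min _ _) => u u0 [u1 ur].
rewrite to_unitK; last lra.
by split; [lra|rewrite val_unit0 subr0 gtr0_norm].
Qed.

Lemma tuple_H_Kplus : tuple_H T `<=` tuple_Kplus.
Proof.
apply: isotropy_limit => [t t01|r r0]; first by rewrite tuple_isotropy.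
exists (to_unit (1 - Num.min (r / 2) 2^-1)).
have [] : 0 < Num.min (r / 2) 2^-1 /\ Num.min (r / 2) 2^-1 <= 2^-1
    /\ Num.min (r / 2) 2^-1 < r.
  rewrite lt_min !gt_min ge_min lexx orbT; split; last split=> //.
    by apply/andP; split; lra.
  by apply/orP; left; lra.
move: (Num.min _ _) => u u0 [u1 ur].
rewrite to_unitK; last lra.
split; [lra|rewrite val_unit1 [X in `|X|](_ : _ = - u); last lra].
by rewrite normrN gtr0_norm.
Qed.

Definition rho_plus : coset_space (tuple_H T) -> coset_space tuple_Kplus :=
  orbit_projection tuple_H_Kplus.
Definition rho_minus : coset_space (tuple_H T) -> coset_space tuple_Kminus :=
  orbit_projection tuple_H_Kminus.
HB.instance Definition _ := Continuous.on rho_plus.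
HB.instance Definition _ := Continuous.on rho_minus.

Lemma rho_plus1 : rho_plus (coset _ 1%g) = coset _ 1%g.
Proof. exact: orbit_projectionE. Qed.
Lemma rho_minus1 : rho_minus (coset _ 1%g) = coset _ 1%g.
Proof. exact: orbit_projectionE. Qed.

Definition pi1_GH : groupType := pi1 R (coset (tuple_H T) 1%g).

Definition N_plus : normal_subgroup pi1_GH := kernel (pi1_map R rho_plus1).
Definition N_minus : normal_subgroup pi1_GH := kernel (pi1_map R rho_minus1).

Definition N_zero : normal_subgroup
    (free_product (quotient_group N_plus) (quotient_group N_minus)) :=
  normal_closure [set (free_inl (quotient_class N_plus w) *
    (free_inr (quotient_class N_minus w))^-1)%g | w in [set: pi1_GH]].

End Tuple.
End Actions.
Arguments isometric_action {R} X G.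

(* Main.v *)
Require Import Defs.
From HB Require Import structures.
From mathcomp Require Import all_boot all_order all_algebra generic_quotient.
From mathcomp Require Import all_classical all_reals all_analysis.
From mathcomp Require Import homotopy ring lra.

Set Implicit Arguments.
Unset Strict Implicit.
Unset Printing Implicit Defensive.

Import Order.TTheory GRing.Theory Num.Theory.
Import numFieldNormedType.Exports.
Local Open Scope classical_set_scope.
Local Open Scope ring_scope.

(** Moving a shortest geodesic between the two end orbits around by [G] covers
    [X]: its point at time [t] lies over [2 t - 1], and points over the same
    value lie in one orbit because orbits are compact. Hence [X] is the double
    mapping cylinder of the projections of [G/H] onto [G/K_-] and [G/K_+]
    ([cylinder], [cylinder_baseK], [end_orbitE]), and its fundamental group is
    the pushout of the fundamental groups of the two end orbits over that of
    [G/H]. Let [P] be the fundamental group of [G/H]. As the fibres [K_j/H] are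
    connected, [P] maps onto the fundamental groups of [G/K_+] and [G/K_-], with
    kernels [N_+] and [N_-], so the pushout is a quotient of [P]. The quotient
    of the free product by [N_0] is the same quotient of [P] ([to_amalgam]).
    Both groups are therefore images of [P], and it is enough to compare the
    kernels ([isomorphism_same_kernel]). Three facts about the map from [P]
    induced by the inclusion of the middle orbit are needed.

    It is onto ([middle_pi1_onto]): a short path of [X] avoids one of the end
    orbits, so it can be pushed into the other one, [G/K_j], and lifted from
    there to [G/H] with prescribed ends ([orbit_projection_lift]).

    It kills [N_+] and [N_-] ([middle_pi1_kernel]): a loop of the middle orbit
    can be slid to either end orbit. With the universal property of the
    amalgam ([to_amalgam_kernel]) this gives one inclusion of kernels.

    A loop that becomes contractible in [X] is trivial in the amalgam
    ([middle_pi1_injective]). This is the injective half of van Kampen's theorem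
    ([van_kampen_injective]): a path avoiding one end orbit has a value in the
    amalgam, a map of a square into [X] carries a potential whose increments
    are these values, since potentials on small squares can be glued, and a
    potential has no increment around the boundary of the square.

    Lifting paths requires local sections of the projection from [G] to [G/K],
    and joining points of the fibre [K/H] by paths requires [K] to be locally
    path connected. Both follow from the slice of [closed_subgroup_slice], a
    form of Cartan's closed subgroup theorem. In coordinates at the identity,
    the logarithm of [x y] is [log x + log y] up to a small multiple of
    [log y] ([lie_log_chart]). So the tangent directions of [K] form a linear
    subspace, and an element of [G] near the identity has a unique small
    translate by [K] whose coordinates project to zero on that subspace. *)

(** * Homotopy classes of paths as elements of a group *)

Section ConvexHomotopy.
Variables (R : realType) (T : topologicalType).
Local Notation I := (unit_interval R).

(** A straight-line homotopy in the parameter plane; all the reparametrization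
    and subdivision arguments below are instances of it. *)
Lemma convex_homotopic (x y : T) (p q : {path I from x to y})
    (w : R * R -> T) (phi psi : R -> R * R) :
  continuous w -> continuous phi -> continuous psi ->
  phi 0 = psi 0 -> phi 1 = psi 1 ->
  (forall s : I, p s = w (phi (\val s))) ->
  (forall s : I, q s = w (psi (\val s))) -> path_homotopic p q.
Proof.
move=> cw cphi cpsi e0 e1 pE qE.
pose lin (t a b : R) := (1 - t) * a + t * b.
pose H (st : R * R) := (lin st.2 (phi st.1).1 (psi st.1).1,
                        lin st.2 (phi st.1).2 (psi st.1).2).
have clin (a b : R -> R) : continuous a -> continuous b ->
    continuous (fun st : R * R => lin st.2 (a st.1) (b st.1)).
  move=> ca cb u; apply: cvgD; apply: cvgM.
  - by apply: cvgB; [exact: cvg_cst|exact: cvg_snd].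
  - exact: (cts_comp (@cts_fst _ _) ca).
  - exact: cvg_snd.
  - exact: (cts_comp (@cts_fst _ _) cb).
have cH : continuous H.
  apply: cts_pair.
  - exact: (clin _ _ (cts_comp cphi (@cts_fst _ _)) (cts_comp cpsi (@cts_fst _ _))).
  - exact: (clin _ _ (cts_comp cphi (@cts_snd _ _)) (cts_comp cpsi (@cts_snd _ _))).
have linxx t a : lin t a a = a by rewrite /lin -mulrDl subrK mul1r.
have HE s t : phi s = psi s -> H (s, t) = phi s.
  by move=> e; rewrite /H /= -e !linxx; case: (phi s).
have cval := @continuous_val_unit R.
exists (fun st : I * I => w (H (\val st.1, \val st.2))); split.
- apply: (cts_comp (cts_comp (cts_pair (cts_comp (@cts_fst _ _) cval)
    (cts_comp (@cts_snd _ _) cval)) cH) cw).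
- move=> s; rewrite pE val_unit0 /H /lin /=; congr w.
  by rewrite subr0 !mul1r !mul0r !addr0; case: (phi _).
- move=> s; rewrite qE val_unit1 /H /lin /=; congr w.
  by rewrite subrr !mul1r !mul0r !add0r; case: (psi _).
- move=> t; split.
  + by rewrite val_unit0 HE // -[in LHS]val_unit0 -pE path_zero.
  + by rewrite val_unit1 HE // -[in LHS]val_unit1 -pE path_one.
Qed.

End ConvexHomotopy.

Section CutOff.
Variable R : realType.

Definition cut (l m t : R) : R := Num.max l (Num.min t m).

Lemma continuous_cut l m : continuous (cut l m).
Proof.
move=> t; rewrite /cut.
apply: (@continuous_max R R (cst l) (fun t => Num.min t m)); first exact: cvg_cst.
by apply: (@continuous_min R R id (cst m)); [exact: cvg_id|exact: cvg_cst].
Qed.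

Lemma cut_id l m t : l <= t <= m -> cut l m t = t.
Proof. by move=> /andP[t0 t1]; rewrite /cut (min_idPl t1) (max_idPr t0). Qed.

Lemma cut_itv l m t : l <= m -> l <= cut l m t <= m.
Proof. by move=> lm; rewrite /cut le_max lexx /= ge_max lm /= ge_min lexx orbT. Qed.

(** Continuity on a closed interval, as continuity at each of its points, is
    turned into global continuity by freezing the path beyond the ends. *)
Lemma continuous_at_cut (T : topologicalType) (u : R -> T) l m : l <= m ->
  (forall s, l <= s <= m -> {for s, continuous u}) ->
  continuous (fun s => u (cut l m s)).
Proof.
move=> lm cu s; apply: (@continuous_comp _ _ _ (cut l m) u).
  exact: continuous_cut.
by apply: cu; exact: cut_itv.
Qed.

(** Otherwise the supremum of the good right ends could be passed. *)
Lemma interval_induction (a b : R) (Q : R -> R -> Prop) : a <= b ->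
  (forall t, a <= t <= b -> exists2 e, 0 < e & forall s s', a <= s -> s <= t ->
    t <= s' -> s' <= b -> t - e < s -> s' < t + e -> Q s s') ->
  (forall r s t, a <= r -> r <= s -> s <= t -> t <= b -> Q r s -> Q s t -> Q r t) ->
  Q a b.
Proof.
move=> ab loc tr.
pose S := [set t | a <= t <= b /\ Q a t].
have Sa : S a.
  split; first by rewrite lexx.
  by have [|e e0 h] := loc a; [rewrite lexx|apply: h => //; lra].
have Sub : has_ubound S by exists b => t [/andP[]].
have hs : has_sup S by split; [exists a|].
pose z := sup S.
have az : a <= z by exact: ub_le_sup.
have zb : z <= b by apply: ge_sup; [exists a|move=> t [/andP[]]].
have [|e e0 h] := loc z; first by rewrite az.
have [s [/andP[as_ sb] Qs] sz] := sup_adherent e0 hs.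
have sz' : s <= z by apply: ub_le_sup => //; split => //; rewrite as_.
have good t : z <= t -> t <= b -> t < z + e -> Q a t.
  move=> zt tb tz; apply: (tr a s t) => //; first exact: (le_trans sz').
  exact: h.
have [bz|bz] := ltP b (z + e); first exact: good.
have : Q a (z + e / 2) by apply: good; lra.
move=> Qe; have : z + e / 2 <= z by apply: ub_le_sup => //; split=> //; lra.
by lra.
Qed.

End CutOff.

Section PathClass.
Variables (R : realType) (T : topologicalType) (b : T).
Local Notation I := (unit_interval R).

Definition path_connected_type := forall x y : T,
  exists2 c : R -> T, continuous c & c 0 = x /\ c 1 = y.

Hypothesis Tconn : path_connected_type.

Lemma path_exists (x y : T) : exists p : {path I from x to y}, True.
Proof.
have [c cc [c0 c1]] := Tconn x y.
have cts : continuous (fun s : I => c (\val s)).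
  exact: (cts_comp (@continuous_val_unit R) cc).
have e0 : (fun s : I => c (\val s)) zero = x by rewrite val_unit0.
have e1 : (fun s : I => c (\val s)) one = y by rewrite val_unit1.
by exists (mk_path cts e0 e1).
Qed.

Let e_ (x : T) : {path I from b to x} := sval (cid (path_exists b x)).

(** A path from the base point to [x], normalised to be null-homotopic when
    [x] is the base point. *)
Definition base_path (x : T) : {path I from b to x} :=
  concat (reverse (e_ b)) (e_ x).

Lemma base_path1 : path_homotopic (base_path b) (constant_path R b).
Proof. exact: concatVp. Qed.

(** A path with arbitrary ends is completed to a loop by the base paths of its
    ends; this turns composition of paths into a product in one group. *)
Definition path_class (x y : T) (p : {path I from x to y}) : pi1 R b :=
  loop_class (concat (concat (base_path x) p) (reverse (base_path y))).

Lemma path_class_homotopic (x y : T) (p q : {path I from x to y}) :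
  path_homotopic p q -> path_class p = path_class q.
Proof.
move=> pq; apply/loop_classP/path_homotopic_concat/path_homotopic_refl.
by apply: path_homotopic_concat => //; exact: path_homotopic_refl.
Qed.

Lemma concatKV (x y z : T) (p : {path I from x to y}) (q : {path I from y to z}) :
  path_homotopic (concat (reverse p) (concat p q)) q.
Proof.
apply: path_homotopic_trans (concatA _ _ _) _.
apply: path_homotopic_trans (concat1p q).
apply: path_homotopic_concat; last exact: path_homotopic_refl.
exact: concatVp.
Qed.

Lemma concat_congr2 (x y z : T) (p : {path I from x to y})
    (q q' : {path I from y to z}) :
  path_homotopic q q' -> path_homotopic (concat p q) (concat p q').
Proof. by apply: path_homotopic_concat; exact: path_homotopic_refl. Qed.

Lemma concat_congr1 (x y z : T) (p p' : {path I from x to y})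
    (q : {path I from y to z}) :
  path_homotopic p p' -> path_homotopic (concat p q) (concat p' q).
Proof. by move=> h; apply: path_homotopic_concat h _; exact: path_homotopic_refl. Qed.

Let loop_mul (p q : {path I from b to b}) :
  (loop_class p * loop_class q)%g = loop_class (concat p q).
Proof. exact: loop_classM. Qed.

Lemma path_classM (x y z : T) (p : {path I from x to y}) (q : {path I from y to z}) :
  path_class (concat p q) = (path_class p * path_class q)%g.
Proof.
rewrite /path_class loop_mul; apply/loop_classP; apply: path_homotopic_sym.
set A := concat (base_path x) p; set B := base_path y; set D := reverse (base_path z).
apply: path_homotopic_trans (path_homotopic_sym (concatA A (reverse B) _)) _.
have h : path_homotopic (concat (reverse B) (concat (concat B q) D)) (concat q D).
  apply: path_homotopic_trans (concat_congr2 _ (path_homotopic_sym (concatA B q D))) _.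
  exact: concatKV.
apply: path_homotopic_trans (concat_congr2 A h) _.
apply: path_homotopic_trans (concatA A q D) _.
by apply: concat_congr1; apply: path_homotopic_sym; exact: concatA.
Qed.

Lemma path_class_cst (x : T) : path_class (constant_path R x) = 1%g.
Proof.
apply/loop_classP; apply: path_homotopic_trans (concatpV (base_path x)).
by apply: concat_congr1; exact: concatp1.
Qed.

Lemma path_class_loop (p : {path I from b to b}) : path_class p = loop_class p.
Proof.
apply/loop_classP.
apply: (@path_homotopic_trans _ _ _ _ _ (concat p (reverse (constant_path R b)))).
  apply: path_homotopic_concat.
    by apply: path_homotopic_trans (concat1p p); apply: concat_congr1; exact: base_path1.
  by apply: path_homotopic_reverse; exact: base_path1.
apply: path_homotopic_trans (concatp1 p); apply: concat_congr2.
have -> : reverse (constant_path R b) = constant_path R b :> {path I from b to b}.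
  exact/path_eqP.
exact: path_homotopic_refl.
Qed.

Lemma path_class_inj (x y : T) (p q : {path I from x to y}) :
  path_class p = path_class q -> path_homotopic p q.
Proof.
move=> /loop_classP h.
set B := base_path x; set D := base_path y.
have red (r : {path I from x to y}) :
    path_homotopic (concat (reverse B) (concat (concat (concat B r) (reverse D)) D)) r.
  apply: path_homotopic_trans (concat_congr2 _ (path_homotopic_sym (concatA _ _ _))) _.
  apply: path_homotopic_trans (concat_congr2 _ (concat_congr2 _ (concatVp D))) _.
  apply: path_homotopic_trans (concat_congr2 _ (concatp1 _)) _.
  exact: concatKV.
apply: path_homotopic_trans (path_homotopic_sym (red p)) _.
apply: path_homotopic_trans (red q).
exact: concat_congr2 (concat_congr1 _ h).
Qed.

(** Paths are given from here on as functions on the line with two times, and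
    their classes lie in one group whatever the end points. This lets paths be
    composed without transport along equalities of end points. *)
Definition seg_fun (u : R -> T) (l m : R) (s : R) : T := u (l + clamp s * (m - l)).

Lemma seg_fun0 u l m : seg_fun u l m (\val (zero : I)) = u l.
Proof. by rewrite val_unit0 /seg_fun clamp_le0 // mul0r addr0. Qed.

Lemma seg_fun1 u l m : seg_fun u l m (\val (one : I)) = u m.
Proof. by rewrite val_unit1 /seg_fun clamp_ge1 // mul1r addrCA subrr addr0. Qed.

Definition seg_path (u : R -> T) (l m : R) (cu : continuous (seg_fun u l m)) :
    {path I from u l to u m} :=
  mk_path (cts_comp (@continuous_val_unit R) cu) (seg_fun0 u l m) (seg_fun1 u l m).

Lemma seg_pathE u l m (cu : continuous (seg_fun u l m)) (s : I) :
  seg_path cu s = u (l + \val s * (m - l)).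
Proof.
have -> : seg_path cu s = seg_fun u l m (\val s) by [].
rewrite /seg_fun clamp_id //.
exact: unit_itvP.
Qed.

(** Trivial by convention when the restriction is not continuous. *)
Definition cls (u : R -> T) (l m : R) : pi1 R b :=
  if pselect (continuous (seg_fun u l m)) is left cu then path_class (seg_path cu)
  else 1%g.

Lemma clsE u l m (cu : continuous (seg_fun u l m)) :
  cls u l m = path_class (seg_path cu).
Proof.
rewrite /cls; case: pselect => // cu'; congr path_class.
by apply/path_eqP => s; rewrite !seg_pathE.
Qed.

Definition cts_on (u : R -> T) (l m : R) :=
  forall s, l <= s <= m -> {for s, continuous u}.

Lemma seg_between (l m x y t : R) : l <= x <= m -> l <= y <= m -> 0 <= t <= 1 ->
  l <= x + t * (y - x) <= m.
Proof.
move=> /andP[lx xm] /andP[ly ym] /andP[t0 t1].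
by apply/andP; split; nra.
Qed.

Lemma clamp_itvP (t : R) : 0 <= clamp t <= 1.
Proof. by have := clamp_itv t; rewrite inE /= in_itv. Qed.

Lemma cts_seg_fun u l m x y : l <= x <= m -> l <= y <= m -> cts_on u l m ->
  continuous (seg_fun u x y).
Proof.
move=> xi yi cu s; rewrite /seg_fun.
apply: (@continuous_comp _ _ _ (fun s => x + clamp s * (y - x)) u).
  apply: cvgD; first exact: cvg_cst.
  by apply: cvgM; [exact: continuous_clamp|exact: cvg_cst].
by apply: cu; apply: seg_between => //; exact: clamp_itvP.
Qed.

Lemma cls_ext u v l m x y : l <= x <= m -> l <= y <= m -> cts_on v l m ->
  (forall s, l <= s <= m -> u s = v s) -> cls u x y = cls v x y.
Proof.
move=> xi yi cv uv.
have e : seg_fun u x y = seg_fun v x y.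
  by apply/funext => s; apply: uv; apply: seg_between => //; exact: clamp_itvP.
have cvs : continuous (seg_fun v x y) by exact: (cts_seg_fun xi yi cv).
have cus : continuous (seg_fun u x y) by rewrite e.
have ex : v x = u x by rewrite uv.
have ey : v y = u y by rewrite uv.
rewrite !clsE /path_class.
move: (seg_path cus) (seg_path cvs) (seg_pathE cus) (seg_pathE cvs).
rewrite -> ex, ey => p q pE qE.
suff -> : p = q by [].
apply/path_eqP => s; rewrite pE qE; apply: uv; apply: seg_between => //.
exact: unit_itvP.
Qed.

Lemma cls_xx u x : cls u x x = 1%g.
Proof.
have cu : continuous (seg_fun u x x).
  have -> : seg_fun u x x = cst (u x).
    by apply/funext => s; rewrite /seg_fun subrr mulr0 addr0.
  by move=> s; exact: cvg_cst.
rewrite (clsE cu) -(path_class_cst (u x)); congr path_class.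
by apply/path_eqP => s; rewrite seg_pathE subrr mulr0 addr0.
Qed.

Lemma cls_cst c u x y : (forall s, u s = c) -> cls u x y = 1%g.
Proof.
move=> /funext ->; rewrite -[RHS](cls_xx (fun=> c) x).
have cu z : continuous (seg_fun (fun=> c) x z) by move=> s; exact: cvg_cst.
rewrite !clsE; congr path_class.
by apply/path_eqP => s; rewrite !seg_pathE.
Qed.

End PathClass.

Section PathClassLaws.
Variables (R : realType) (T : topologicalType) (b : T).
Local Notation I := (unit_interval R).
Hypothesis Tconn : path_connected_type R T.
Local Notation cls := (cls b Tconn).
Local Notation path_class := (path_class b Tconn).

Let pt (P Q : R * R) (t : R) : R * R :=
  (P.1 + t * (Q.1 - P.1), P.2 + t * (Q.2 - P.2)).

Let pt0 P Q : pt P Q 0 = P.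
Proof. by rewrite /pt !mul0r !addr0; case: P. Qed.

Let pt1 P Q : pt P Q 1 = Q.
Proof. by case: P Q => [? ?] [? ?]; rewrite /pt /=; congr pair; lra. Qed.

Let continuous_pt P Q (c : R -> R) : continuous c ->
  continuous (fun s => pt P Q (c s)).
Proof.
move=> cc; apply: cts_pair => s; apply: cvgD; (try exact: cvg_cst);
  by apply: cvgM; [exact: cc|exact: cvg_cst].
Qed.

Let cid : continuous (fun s : R => s).
Proof. by move=> s; exact: cvg_id. Qed.

Let cts_w (w : R * R -> T) P Q : continuous w -> continuous (fun t => w (pt P Q t)).
Proof. by move=> cw; apply: (cts_comp _ cw); apply: continuous_pt. Qed.

Let cts_seg_w (w : R * R -> T) P Q : continuous w ->
  continuous (seg_fun (fun t => w (pt P Q t)) 0 1).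
Proof.
move=> cw; apply: (@cts_seg_fun _ _ _ 0 1 0 1); rewrite ?lexx ?ler01 //.
by move=> s _; exact: cts_w.
Qed.

(** An instance of [convex_homotopic]: the plane is convex. *)
Let cls_triangle (w : R * R -> T) P Q S : continuous w ->
  (cls (fun t => w (pt P Q t)) 0 1 * cls (fun t => w (pt Q S t)) 0 1)%g
  = cls (fun t => w (pt P S t)) 0 1.
Proof.
move=> cw; have cPQ := @cts_seg_w w P Q cw; have cQS := @cts_seg_w w Q S cw.
have cPS := @cts_seg_w w P S cw.
rewrite (clsE _ _ cPQ) (clsE _ _ cQS) (clsE _ _ cPS).
have e1 : w (pt P Q 1) = w (pt Q S 0) by rewrite pt1 pt0.
have e0 : w (pt P S 0) = w (pt P Q 0) by rewrite !pt0.
have e2 : w (pt P S 1) = w (pt Q S 1) by rewrite !pt1.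
move: (seg_path cPQ) (seg_path cQS) (seg_path cPS) (seg_pathE cPQ)
  (seg_pathE cQS) (seg_pathE cPS).
rewrite -> e1, e0, e2 => p q r pE qE rE.
rewrite -path_classM; apply: path_class_homotopic.
have c2 (k : R) : continuous (fun s : R => clamp (2 * s - k)).
  apply: (@cts_comp _ _ _ (fun s : R => 2 * s - k) (@clamp R)); last exact: continuous_clamp.
  move=> s; apply: cvgB; last exact: cvg_cst.
  by apply: cvgM; [exact: cvg_cst|exact: cvg_id].
pose phi s := (P.1 + clamp (2 * s - 0) * (Q.1 - P.1) + clamp (2 * s - 1) * (S.1 - Q.1),
   P.2 + clamp (2 * s - 0) * (Q.2 - P.2) + clamp (2 * s - 1) * (S.2 - Q.2)).
apply: (@convex_homotopic _ _ _ _ _ _ w phi (pt P S)) => //.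
- by apply: cts_pair => s; apply: cvgD; [apply: cvgD; first exact: cvg_cst| |
    apply: cvgD; first exact: cvg_cst|]; (apply: cvgM; [exact: c2|exact: cvg_cst]).
- by apply: (@continuous_pt _ _ id).
- by rewrite pt0 /phi !clamp_le0 ?mul0r ?addr0; [case: (P)|lra..].
- rewrite pt1 /phi !clamp_ge1 ?mul1r; [|lra..].
  by case: (P) (Q) (S) => [x1 y1] [x2 y2] [x3 y3] /=; congr pair; lra.
- move=> s; have s01 := unit_itvP s; rewrite -path_extE concat_pathE //.
  rewrite /path_ext; case: ifPn => h.
    rewrite pE to_unitK; last lra.
    congr w; rewrite /phi /pt subr0 clamp_id; last lra.
    rewrite clamp_le0; last lra.
    by rewrite !mul0r !addr0 subr0 mulr1 add0r.
  rewrite qE to_unitK; last lra.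
  congr w; rewrite /phi /pt subr0 clamp_ge1; last lra.
  rewrite clamp_id; last lra.
  by case: (P) (Q) (S) => [x1 y1] [x2 y2] [x3 y3] /=; congr pair; lra.
- by move=> s; rewrite rE subr0 mulr1 add0r.
Qed.

Lemma cls_eq01 u x y v : continuous (seg_fun u x y) -> continuous (seg_fun v 0 1) ->
  (forall s, 0 <= s <= 1 -> u (x + s * (y - x)) = v s) -> cls u x y = cls v 0 1.
Proof.
move=> cu cv uv; rewrite (clsE _ _ cu) (clsE _ _ cv).
have e0 : v 0 = u x by rewrite -uv ?lexx ?ler01 // mul0r addr0.
have e1 : v 1 = u y by rewrite -uv ?lexx ?ler01 // mul1r addrC subrK.
move: (seg_path cu) (seg_path cv) (seg_pathE cu) (seg_pathE cv).
rewrite -> e0, e1 => p q pE qE; congr path_class; apply/path_eqP => s.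
by rewrite pE qE subr0 mulr1 add0r; apply: uv; exact: unit_itvP.
Qed.

Lemma cls_add u l m x y z : l <= x <= m -> l <= y <= m -> l <= z <= m ->
  cts_on u l m -> (cls u x y * cls u y z)%g = cls u x z.
Proof.
move=> xi yi zi cu; pose w (P : R * R) := u (cut l m P.1).
have lm : l <= m by case/andP: xi; exact: le_trans.
have cw : continuous w.
  exact: (cts_comp (@cts_fst _ _) (continuous_at_cut lm cu)).
have E x' y' : l <= x' <= m -> l <= y' <= m ->
    cls u x' y' = cls (fun t => w (pt (x', 0) (y', 0) t)) 0 1.
  move=> xi' yi'; apply: cls_eq01; [exact: (cts_seg_fun xi' yi' cu)|exact: cts_seg_w|].
  by move=> s s01; rewrite /w /= cut_id //; exact: seg_between.
by rewrite !E // cls_triangle.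
Qed.

(** Both sides are the class of the diagonal of the rectangle. *)
Lemma cls_square (h : R * R -> T) l m l' m' : l <= m -> l' <= m' ->
  (forall P, l <= P.1 <= m -> l' <= P.2 <= m' -> {for P, continuous h}) ->
  (cls (fun s => h (s, l')) l m * cls (fun t => h (m, t)) l' m')%g
  = (cls (fun t => h (l, t)) l' m' * cls (fun s => h (s, m')) l m)%g.
Proof.
move=> lm lm' ch; pose w (P : R * R) := h (cut l m P.1, cut l' m' P.2).
have cw : continuous w.
  move=> P; apply: (@continuous_comp _ _ _
    (fun P : R * R => (cut l m P.1, cut l' m' P.2)) h).
    apply: cts_pair.
      by apply: (cts_comp (@cts_fst _ _)); exact: continuous_cut.
    by apply: (cts_comp (@cts_snd _ _)); exact: continuous_cut.
  by apply: ch => /=; exact: cut_itv.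
have H y : l' <= y <= m' ->
    cls (fun s => h (s, y)) l m = cls (fun t => w (pt (l, y) (m, y) t)) 0 1.
  move=> yi; apply: cls_eq01; [|exact: cts_seg_w|].
    apply: (@cts_seg_fun _ _ _ l m); rewrite ?lexx ?lm //.
    move=> s sl; apply: (@continuous_comp _ _ _ (fun s => (s, y)) h).
      have c1 : continuous (fun s : R => (s, y)).
        by apply: cts_pair => ?; [exact: cvg_id|exact: cvg_cst].
      exact: c1.
    exact: ch.
  move=> s s01; rewrite /w /= subrr mulr0 addr0 !cut_id //.
  by apply: seg_between; rewrite ?lexx ?lm.
have V x : l <= x <= m ->
    cls (fun t => h (x, t)) l' m' = cls (fun t => w (pt (x, l') (x, m') t)) 0 1.
  move=> xi; apply: cls_eq01; [|exact: cts_seg_w|].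
    apply: (@cts_seg_fun _ _ _ l' m'); rewrite ?lexx ?lm' //.
    move=> s sl; apply: (@continuous_comp _ _ _ (fun s => (x, s)) h).
      have c1 : continuous (fun s : R => (x, s)).
        by apply: cts_pair => ?; [exact: cvg_cst|exact: cvg_id].
      exact: c1.
    exact: ch.
  move=> s s01; rewrite /w /= subrr mulr0 addr0 !cut_id //.
  by apply: seg_between; rewrite ?lexx ?lm'.
by rewrite !H ?V ?lexx ?lm ?lm' // !cls_triangle.
Qed.

(** The rectangle rule for the straight-line homotopy from the identity to
    [phi], whose vertical sides are constant. *)
Lemma cls_reparam u (phi : R -> R) : continuous u -> continuous phi ->
  phi 0 = 0 -> phi 1 = 1 -> cls (fun s => u (phi s)) 0 1 = cls u 0 1.
Proof.
move=> cu cphi p0 p1.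
pose h (P : R * R) := u ((1 - P.2) * P.1 + P.2 * phi P.1).
have ch : continuous h.
  apply: (@cts_comp _ _ _ (fun P : R * R => (1 - P.2) * P.1 + P.2 * phi P.1) u) => // P.
  apply: cvgD; apply: cvgM.
  - by apply: cvgB; [exact: cvg_cst|exact: cvg_snd].
  - exact: cvg_fst.
  - exact: cvg_snd.
  - exact: (cts_comp (@cts_fst _ _) cphi).
have := @cls_square h 0 1 0 1 ler01 ler01 (fun P _ _ => ch P).
have -> : (fun s => h (s, 0)) = u.
  by apply/funext => s; rewrite /h /= subr0 mul1r mul0r addr0.
have -> : (fun s => h (s, 1)) = (fun s => u (phi s)).
  by apply/funext => s; rewrite /h /= subrr mul1r mul0r add0r.
have -> : cls (fun t => h (0, t)) 0 1 = 1%g.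
  by apply: (@cls_cst _ _ _ _ (u 0)) => s; rewrite /h /= p0 !mulr0 addr0.
have -> : cls (fun t => h (1, t)) 0 1 = 1%g.
  by apply: (@cls_cst _ _ _ _ (u 1)) => s; rewrite /h /= p1 !mulr1 subrK.
by rewrite mulg1 mul1g.
Qed.

Lemma cls_loop (p : {path I from b to b}) :
  cls (path_ext p) 0 1 = loop_class p.
Proof.
have cu : continuous (seg_fun (path_ext p) 0 1).
  apply: (@cts_seg_fun _ _ _ 0 1); rewrite ?lexx ?ler01 // => s _.
  exact/continuous_path_ext/cts_fun.
rewrite (clsE _ _ cu) -(path_class_loop Tconn).
have e0 : path_ext p 0 = b by rewrite path_ext_le0.
have e1 : path_ext p 1 = b by rewrite path_ext_ge1.
move: (seg_path cu) (seg_pathE cu).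
rewrite -> e0, e1 => q qE; congr path_class; apply/path_eqP => s.
by rewrite qE subr0 mulr1 add0r path_extE.
Qed.

End PathClassLaws.

(** A continuous map acts on classes of arbitrary paths through the induced
    homomorphism, up to factors that compare the images of the chosen base
    paths with the base paths of the target. *)
Section PathClassMap.
Variables (R : realType) (S T : topologicalType) (f : continuousType S T).
Variables (x : S) (y : T) (fxy : f x = y).
Hypotheses (Sconn : path_connected_type R S) (Tconn : path_connected_type R T).
Local Notation I := (unit_interval R).

Let push (s s' : S) (p : {path I from s to s'}) : {path I from f s to f s'} :=
  f \o p.

Definition map_defect (s : S) : pi1 R y :=
  path_class y Tconn (push (base_path x Sconn s)).

Let path_class_reverse (s s' : T) (p : {path I from s to s'}) :
  path_class y Tconn (reverse p) = ((path_class y Tconn p)^-1)%g.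
Proof.
apply: (mulgI (path_class y Tconn p)).
rewrite mulgV -path_classM -(path_class_cst y Tconn s).
exact/path_class_homotopic/concatpV.
Qed.

Lemma pi1_map_path_class (s s' : S) (p : {path I from s to s'}) :
  pi1_map R fxy (path_class x Sconn p) =
  (map_defect s * path_class y Tconn (push p) * (map_defect s')^-1)%g.
Proof.
rewrite /map_defect -path_class_reverse -!path_classM {1}/path_class pi1_map_class.
case: _ / fxy => /=; rewrite -(path_class_loop Tconn); apply: path_class_homotopic.
match goal with |- path_homotopic ?l ?l' => suff -> : l = l' end.
  exact: path_homotopic_refl.
apply/path_eqP => t.
rewrite /= /push_loop /push /concat /mk_path /= /concat_fun.
case: ifP => _ //; rewrite /path_ext /= /concat /mk_path /= /concat_fun.
by case: ifP.
Qed.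

Lemma pi1_map_cls u l m : l <= m -> cts_on u l m ->
  pi1_map R fxy (cls x Sconn u l m) =
  (map_defect (u l) * cls y Tconn (fun s => f (u s)) l m
   * (map_defect (u m))^-1)%g.
Proof.
move=> lm cu.
have cs : continuous (seg_fun u l m) by apply: (cts_seg_fun _ _ cu); rewrite ?lexx ?lm.
have cs' : continuous (seg_fun (fun s => f (u s)) l m).
  exact: (cts_comp cs (@cts_fun _ _ f)).
rewrite (clsE _ _ cs) (clsE _ _ cs') pi1_map_path_class; congr (_ * _ * _)%g.
by congr path_class; apply/path_eqP => s; rewrite seg_pathE /= /push /= seg_pathE.
Qed.

Lemma map_defect_base : map_defect x = 1%g.
Proof.
rewrite /map_defect -(path_class_cst y Tconn (f x)).
apply: path_class_homotopic; have [h [ch h0 h1 hb]] := base_path1 x Sconn.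
exists (f \o h); split.
- exact: (cts_comp ch (@cts_fun _ _ f)).
- by move=> s; rewrite /= h0.
- by move=> s; rewrite /= h1.
- by move=> t; have [e0 e1] := hb t; rewrite /= e0 e1.
Qed.

End PathClassMap.

(** Unlike in [pi1_map_cls], the two base points need not correspond under
    [f]. *)
Lemma cls_push_trivial (R : realType) (S T : topologicalType)
    (f : continuousType S T) (x : S) (y : T) (Sconn : path_connected_type R S)
    (Tconn : path_connected_type R T) (u : R -> S) :
  continuous u -> u 0 = u 1 -> cls x Sconn u 0 1 = 1%g ->
  cls y Tconn (fun s => f (u s)) 0 1 = 1%g.
Proof.
move=> cu e.
have cs : continuous (seg_fun u 0 1).
  by apply: (@cts_seg_fun _ _ _ 0 1); rewrite ?lexx ?ler01 // => s _; exact: cu.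
have cs' : continuous (seg_fun (fun s => f (u s)) 0 1).
  exact: (cts_comp cs (@cts_fun _ _ f)).
rewrite (clsE _ _ cs) (clsE _ _ cs').
have e' : f (u 1) = f (u 0) by rewrite e.
move: (seg_path cs) (seg_path cs') (seg_pathE cs) (seg_pathE cs').
rewrite -> e', <- e => p q pE qE.
rewrite -(path_class_cst x Sconn (u 0)) => /path_class_inj [h [ch h0 h1 hb]].
rewrite -(path_class_cst y Tconn (f (u 0))); apply: path_class_homotopic.
exists (f \o h); split.
- exact: (cts_comp ch (@cts_fun _ _ f)).
- by move=> s; rewrite /= h0 pE qE.
- by move=> s; rewrite /= h1.
- by move=> t; have [e0 e1] := hb t; rewrite /= e0 e1.
Qed.

(** * An injectivity principle of van Kampen type *)

(** [X] is covered by open sets [A j], each with a map to [Y j]; these maps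
    come from one map [p] to [B], which is continuous on the overlap. *)
Section VanKampen.
Variables (R : realType) (X B : topologicalType) (Y : bool -> topologicalType).
Variables (A : bool -> set X) (p : X -> B).
Variables (rho : forall j, continuousType B (Y j)).
Variables (b0 : B) (y0 : forall j, Y j) (rho0 : forall j, rho j b0 = y0 j).
Variables (Q : groupType) (i_ : forall j, {multiplicative pi1 R (y0 j) -> Q}).
Hypotheses (Bconn : path_connected_type R B)
  (Yconn : forall j, path_connected_type R (Y j)).
Hypotheses (A_open : forall j, open (A j)) (A_cover : forall x, exists j, A j x).
Hypothesis rho_p_continuous : forall j x, A j x ->
  {for x, continuous (fun x => rho j (p x))}.
Hypothesis p_continuous : forall x, A true x -> A false x ->
  {for x, continuous p}.
Hypothesis i_compatible : forall w : pi1 R b0,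
  i_ true (pi1_map R (rho0 true) w) = i_ false (pi1_map R (rho0 false) w).

Local Notation clsY j := (cls (y0 j) (@Yconn j)).

Definition end_factor j (b : B) : Q := i_ j (map_defect (rho j) b0 (y0 j) Bconn (@Yconn j) b).

(** The value in [Q] of a path that stays in [A j]: its image in [Y j],
    measured in [Q], with corrections at the ends that depend on [p] only. *)
Definition path_val j (c : R -> X) (l m : R) : Q :=
  (end_factor j (p (c l)) * i_ j (clsY j (fun s => rho j (p (c s))) l m)
   * (end_factor j (p (c m)))^-1)%g.

Let i1 j : i_ j 1%g = 1%g.
Proof. by apply: (mulgI (i_ j 1%g)); rewrite -gmulfM !mulg1. Qed.

Let iV j x : i_ j x^-1%g = ((i_ j x)^-1)%g.
Proof. by apply: (mulgI (i_ j x)); rewrite -gmulfM !mulgV i1. Qed.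

Let cts_rho (c : R -> X) j (l m : R) : continuous c ->
  (forall s, l <= s <= m -> A j (c s)) ->
  cts_on (fun s => rho j (p (c s))) l m.
Proof.
move=> cc cA s sl.
apply: (@continuous_comp _ _ _ c (fun x => rho j (p x))); first exact: cc.
exact: rho_p_continuous (cA s sl).
Qed.

Let val_add (c : R -> X) j (l m x y z : R) : l <= x <= m -> l <= y <= m -> l <= z <= m ->
  continuous c -> (forall s, l <= s <= m -> A j (c s)) ->
  (path_val j c x y * path_val j c y z)%g = path_val j c x z.
Proof.
move=> xi yi zi cc cA; rewrite /path_val -(cls_add _ (@Yconn j) xi yi zi (cts_rho cc cA)) gmulfM.
by rewrite !mulgA mulgVK.
Qed.

Let val_pi1 (c : R -> X) j (l m : R) : l <= m -> cts_on (fun s => p (c s)) l m ->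
  path_val j c l m = i_ j (pi1_map R (rho0 j) (cls b0 Bconn (fun s => p (c s)) l m)).
Proof.
move=> lm cpc; rewrite (pi1_map_cls _ _ (@Yconn j) lm cpc).
by rewrite !gmulfM iV.
Qed.

(** On the overlap both values are images of the class of the path carried to
    [B]. *)
Let val_overlap (c : R -> X) j k (l m : R) : l <= m -> continuous c ->
  (forall s, l <= s <= m -> A j (c s)) -> (forall s, l <= s <= m -> A k (c s)) ->
  path_val j c l m = path_val k c l m.
Proof.
have H c' : l <= m -> continuous c' -> (forall s, l <= s <= m -> A true (c' s)) ->
    (forall s, l <= s <= m -> A false (c' s)) -> path_val true c' l m = path_val false c' l m.
  move=> lm cc cT cF.
  have cpc : cts_on (fun s => p (c' s)) l m.
    move=> s sl; apply: (@continuous_comp _ _ _ c' p); first exact: cc.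
    by apply: p_continuous; [exact: cT|exact: cF].
  by rewrite !val_pi1 // i_compatible.
move: j k => [] [] lm cc cj ck //; first exact: H.
by apply/esym; exact: H.
Qed.

Definition hline (h : R * R -> X) (t s : R) := h (s, t).
Definition vline (h : R * R -> X) (s t : R) := h (s, t).

Let cts_hline h t : continuous h -> continuous (hline h t).
Proof.
move=> ch; have c1 : continuous (fun s : R => (s, t)).
  by apply: cts_pair => ?; [exact: cvg_id|exact: cvg_cst].
exact: (cts_comp c1 ch).
Qed.

Let cts_vline h s : continuous h -> continuous (vline h s).
Proof.
move=> ch; have c1 : continuous (fun t : R => (s, t)).
  by apply: cts_pair => ?; [exact: cvg_cst|exact: cvg_id].
exact: (cts_comp c1 ch).
Qed.

Let val_square (h : R * R -> X) j (l m l' m' : R) : continuous h -> l <= m -> l' <= m' ->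
  (forall s t, l <= s <= m -> l' <= t <= m' -> A j (h (s, t))) ->
  (path_val j (hline h l') l m * path_val j (vline h m) l' m')%g =
  (path_val j (vline h l) l' m' * path_val j (hline h m') l m)%g.
Proof.
move=> ch lm lm' hA; rewrite /path_val /hline /vline !mulgA !mulgVK.
congr (_ * _)%g; rewrite -!mulgA; congr (_ * _)%g; rewrite -!gmulfM; congr (i_ j _).
apply: (@cls_square _ _ _ _ (fun P => rho j (p (h P)))) => // -[s t] /= si ti.
apply: (@continuous_comp _ _ _ h (fun x => rho j (p x))); first exact: ch.
exact: rho_p_continuous (hA _ _ si ti).
Qed.

(** A segment whose image stays in no [A j] has no value of its own; a potential
    assigns one to it all the same. Only segments parallel to the axes are
    considered, which makes gluing along edges immediate. *)
Definition hpotential (h : R * R -> X) l m l' m' (g : R * R -> Q) :=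
  forall j t s s', l' <= t <= m' -> l <= s -> s <= s' -> s' <= m ->
    (forall x, s <= x <= s' -> A j (h (x, t))) ->
    path_val j (hline h t) s s' = ((g (s, t))^-1 * g (s', t))%g.

Definition vpotential (h : R * R -> X) l m l' m' (g : R * R -> Q) :=
  forall j s t t', l <= s <= m -> l' <= t -> t <= t' -> t' <= m' ->
    (forall x, t <= x <= t' -> A j (h (s, x))) ->
    path_val j (vline h s) t t' = ((g (s, t))^-1 * g (s, t'))%g.

Definition potential (h : R * R -> X) l m l' m' g :=
  hpotential h l m l' m' g /\ vpotential h l m l' m' g.

Definition flip T (g : R * R -> T) (P : R * R) := g (P.2, P.1).

Let potential_flip (h : R * R -> X) (l m l' m' : R) (g : R * R -> Q) :
  potential (flip h) l' m' l m (flip g) -> potential h l m l' m' g.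
Proof. by move=> [hh hv]; split => j s t t' *; [exact: hv|exact: hh]. Qed.

Let potential_rect (G : groupType) (b r b' v v' t : G) :
  b' = (b * r)%g -> (r * v' = v * t)%g -> (t = (b * v)^-1 * (b' * v'))%g.
Proof. by move=> -> e; rewrite invgM -!mulgA mulKg e mulKg. Qed.

Let potential_side (G : groupType) (b v v' t : G) :
  (v * t = v')%g -> (t = (b * v)^-1 * (b * v'))%g.
Proof. by move=> <-; rewrite invgM -!mulgA mulKg mulKg. Qed.

(** On a rectangle sent into a single [A j], the value of the broken path from
    a corner is a potential by the rectangle rule. *)
Let potential_local (h : R * R -> X) j (l m l' m' : R) : continuous h -> l <= m -> l' <= m' ->
  (forall s t, l <= s <= m -> l' <= t <= m' -> A j (h (s, t))) ->
  exists g, potential h l m l' m' g.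
Proof.
move=> ch lm lm' hA.
exists (fun P => (path_val j (hline h l') l P.1 * path_val j (vline h P.1) l' P.2)%g).
split => k.
- move=> t s s' ti ls ss s'm hk /=.
  have si : l <= s <= m by lra.
  have s'i : l <= s' <= m by lra.
  have li : l <= l <= m by lra.
  have l'i : l' <= l' <= m' by lra.
  rewrite (@val_overlap _ k j) //; last first.
  + by move=> x xi; apply: hA => //; lra.
  + exact: cts_hline.
  have e : path_val j (hline h l') l s' = (path_val j (hline h l') l s * path_val j (hline h l') s s')%g.
    by apply/esym/(@val_add _ _ l m); [..|exact: cts_hline|move=> x xi; exact: hA].
  have sq : (path_val j (hline h l') s s' * path_val j (vline h s') l' t)%g =
      (path_val j (vline h s) l' t * path_val j (hline h t) s s')%g.
    apply: val_square => //; first by lra.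
    by move=> x y xi yi; apply: hA; lra.
  exact: potential_rect e sq.
- move=> s t t' si lt tt t'm hk /=.
  rewrite (@val_overlap _ k j) //; last first.
  + by move=> x xi; apply: hA => //; lra.
  + exact: cts_vline.
  have e : (path_val j (vline h s) l' t * path_val j (vline h s) t t')%g =
      path_val j (vline h s) l' t'.
    apply: (@val_add _ _ l' m'); [lra..|exact: cts_vline|].
    by move=> x xi; exact: hA.
  exact: potential_side e.
Qed.

(** Along a common edge two potentials differ by a constant left factor, so
    one of them can be corrected to extend the other. *)
Let potential_glue (h : R * R -> X) (l m n l' m' : R) g1 g2 : continuous h ->
  l <= m -> m <= n -> l' <= m' ->
  potential h l m l' m' g1 -> potential h m n l' m' g2 ->
  exists g, potential h l n l' m' g.
Proof.
move=> ch lm mn lm' [hh1 hv1] [hh2 hv2].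
pose k := (g1 (m, l') * (g2 (m, l'))^-1)%g.
have edge t : l' <= t <= m' -> g1 (m, t) = (k * g2 (m, t))%g.
  move=> ti.
  suff : ((g1 (m, l'))^-1 * g1 (m, t))%g = ((g2 (m, l'))^-1 * g2 (m, t))%g.
    by rewrite /k -mulgA => <-; rewrite mulVKg.
  apply: (@interval_induction _ l' t (fun s s' => ((g1 (m, s))^-1 * g1 (m, s'))%g =
    ((g2 (m, s))^-1 * g2 (m, s'))%g)); first by lra.
  - move=> s si; have [j Aj] := A_cover (h (m, s)).
    have : \forall x \near s, A j (vline h m x).
      exact: (cts_vline (s := m) ch (open_nbhs_nbhs (conj (A_open j) Aj))).
    move=> /nbhs_ballP[e e0 he]; exists e => // r r' h1 h2 h3 h4 h5 h6.
    have hA x : r <= x <= r' -> A j (h (m, x)).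
      by move=> xi; apply: he; rewrite /ball /= ltr_norml; lra.
    by rewrite -(hv1 j) ?(hv2 j) //; lra.
  - move=> r s s' _ _ _ _ e1 e2.
    have -> : ((g1 (m, r))^-1 * g1 (m, s'))%g =
      (((g1 (m, r))^-1 * g1 (m, s)) * ((g1 (m, s))^-1 * g1 (m, s')))%g.
      by rewrite -mulgA mulVKg.
    by rewrite e1 e2 -mulgA mulVKg.
pose g P := if P.1 <= m then g1 P else (k * g2 P)%g.
have gL s t : s <= m -> g (s, t) = g1 (s, t) by rewrite /g /= => ->.
have gR s t : m <= s -> l' <= t <= m' -> g (s, t) = (k * g2 (s, t))%g.
  move=> ms ti; rewrite /g /=; case: ifP => // sm.
  by have -> : s = m; [lra|exact: edge].
have cancel x y : ((k * x)^-1 * (k * y) = x^-1 * y)%g.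
  by rewrite invgM -mulgA mulKg.
exists g; split => j.
- move=> t s s' ti ls ss s'n hA.
  have [s'm|ms'] := leP s' m; first by rewrite !gL ?(hh1 j) //; lra.
  have [sm|ms] := leP s m; last by rewrite !gR ?cancel ?(hh2 j) //; lra.
  rewrite -(@val_add _ _ s s' s m s'); [|lra..|exact: cts_hline|exact: hA].
  rewrite (hh1 j) //; last by move=> x xi; apply: hA; lra.
  rewrite (hh2 j) //; [|lra..|by move=> x xi; apply: hA; lra].
  by rewrite gL // (gR s') ?edge //; [rewrite -!mulgA mulVKg|lra].
- move=> s t t' si lt tt t'm hA.
  have [sm|ms] := leP s m; first by rewrite !gL ?(hv1 j) //; lra.
  by rewrite !gR ?cancel ?(hv2 j) //; lra.
Qed.

Let potential_sub (h : R * R -> X) (l m l' m' n n' : R) g : n <= n' -> l' <= n -> n' <= m' ->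
  potential h l m l' m' g -> potential h l m n n' g.
Proof.
by move=> nn ln nm [hh hv]; split => j s t t' *; [apply: hh|apply: hv] => //; lra.
Qed.

(** Potentials on small squares are glued into strips, and strips into the
    whole unit square. *)
Let potential_exists h : continuous h -> exists g, potential h 0 1 0 1 g.
Proof.
move=> ch.
apply: (@interval_induction _ 0 1 (fun t t' => exists g, potential h 0 1 t t' g)) => //.
- move=> t ti.
  have : exists2 e, 0 < e & exists g, potential h 0 1 (t - e) (t + e) g.
    apply: (@interval_induction _ 0 1 (fun s s' =>
      exists2 e, 0 < e & exists g, potential h s s' (t - e) (t + e) g)) => //.
    + move=> s si; have [j Aj] := A_cover (h (s, t)).
      have : \forall P \near (s, t), A j (h P).
        exact: (ch _ _ (open_nbhs_nbhs (conj (A_open j) Aj))).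
      move=> /nbhs_ballP[e /= e0 he]; exists e => // r r' h1 h2 h3 h4 h5 h6.
      exists (e / 2); first by lra.
      apply: (@potential_local h j) => //; [lra..|].
      move=> x y xi yi; apply: he; split; rewrite /ball /= ltr_norml; lra.
    + move=> r s s' r0 rs ss s1 [e1 e10 [g1 p1]] [e2 e20 [g2 p2]].
      pose e := Num.min e1 e2.
      have e0 : 0 < e by rewrite lt_min e10.
      have ee1 : e <= e1 by rewrite ge_min lexx.
      have ee2 : e <= e2 by rewrite ge_min lexx orbT.
      exists e => //.
      apply: (@potential_glue h r s s' _ _ g1 g2) => //; first by lra.
      * by apply: (potential_sub _ _ _ p1); lra.
      * by apply: (potential_sub _ _ _ p2); lra.
  move=> [e e0 [g pg]]; exists e => // s s' h1 h2 h3 h4 h5 h6.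
  by exists g; apply: (potential_sub _ _ _ pg); lra.
- move=> r s t r0 rs st t1 [g1 p1] [g2 p2].
  have pf l' m' g : potential h 0 1 l' m' g -> potential (flip h) l' m' 0 1 (flip g).
    move=> pg; apply: potential_flip.
    have -> : flip (flip h) = h by apply/funext => -[].
    by have -> : flip (flip g) = g by apply/funext => -[].
  have cf : continuous (flip h).
    have c1 : continuous (fun P : R * R => (P.2, P.1)).
      by apply: cts_pair; [exact: cts_snd|exact: cts_fst].
    exact: (cts_comp c1 ch).
  have [g pg] := potential_glue cf rs st ler01 (pf _ _ _ p1) (pf _ _ _ p2).
  exists (flip g); apply: potential_flip.
  by have -> : flip (flip g) = g by apply/funext => -[].
Qed.

(** A contraction of the loop in [X] carries a potential. Its increments along
    the three sides that are sent to one point vanish, so the fourth side has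
    value one. *)
Lemma van_kampen_injective (sec : B -> X) (w : R -> B) (h : R * R -> X) (x1 : X) j :
  continuous sec -> (forall b, p (sec b) = b) -> (forall b, A j (sec b)) ->
  continuous w -> continuous h -> (forall s, 0 <= s <= 1 -> h (s, 0) = sec (w s)) ->
  (forall s, 0 <= s <= 1 -> h (s, 1) = x1) ->
  (forall t, 0 <= t <= 1 -> h (0, t) = x1 /\ h (1, t) = x1) ->
  i_ j (pi1_map R (rho0 j) (cls b0 Bconn w 0 1)) = 1%g.
Proof.
move=> csec psec Asec cw ch h0 h1 hb.
have [g [hh hv]] := potential_exists ch.
have [k Ak] := A_cover x1.
have flat u l m : continuous u -> l <= m -> (forall s, l <= s <= m -> u s = x1) ->
    path_val k u l m = 1%g.
  move=> cu lm ux.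
  rewrite /path_val !ux ?lexx ?lm //.
  rewrite (@cls_ext _ _ _ _ _ (fun=> rho k (p x1)) l m) ?lexx ?lm //; last first.
  - by move=> s si; rewrite ux.
  - by move=> s _; exact: cvg_cst.
  by rewrite (@cls_cst _ _ _ _ (rho k (p x1))) // i1 mulg1 mulgV.
have side s : s = 0 \/ s = 1 -> g (s, 0) = g (s, 1).
  move=> s01.
  have hx t : 0 <= t <= 1 -> h (s, t) = x1.
    by move=> /hb[e0 e1]; case: s01 => ->.
  have si : 0 <= s <= 1 by case: s01 => ->; rewrite lexx ler01.
  have hA t : 0 <= t <= 1 -> A k (h (s, t)) by move=> ti; rewrite hx.
  have := hv k s 0 1 si (lexx 0) ler01 (lexx 1) hA.
  rewrite (flat _ _ _ (cts_vline (s:=s) ch) ler01 hx) => e.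
  by apply: (mulgI (g (s, 0))^-1%g); rewrite mulVg.
have i0 : 0 <= (0 : R) <= 1 by rewrite lexx ler01.
have i1' : 0 <= (1 : R) <= 1 by rewrite lexx ler01.
have top : g (0, 1) = g (1, 1).
  have hA t : 0 <= t <= 1 -> A k (h (t, 1)) by move=> ti; rewrite h1.
  have := hh k 1 0 1 i1' (lexx 0) ler01 (lexx 1) hA.
  rewrite (flat _ _ _ (cts_hline (t:=1) ch) ler01 h1) => e.
  by apply: (mulgI ((g (0%R, 1%R))^-1)%g); rewrite mulVg.
have hA t : 0 <= t <= 1 -> A j (h (t, 0)) by move=> ti; rewrite h0.
have := hh j 0 0 1 i0 (lexx 0) ler01 (lexx 1) hA.
rewrite (side 0) ?(side 1); [|by right|by left].
rewrite top mulVg => <-.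
rewrite /path_val -(@cls_ext _ _ _ (@Yconn j) (fun s => rho j (w s)) _ 0 1) //; last first.
- by move=> s si; rewrite /hline h0 // psec.
- apply: cts_rho => //; exact: cts_hline.
rewrite (pi1_map_cls _ _ (@Yconn j) ler01 (fun s _ => cw s)) !gmulfM iV.
by rewrite /hline !h0 // !psec.
Qed.

End VanKampen.

(** * Multiplication near the identity of a Lie group *)

Section C1Estimate.
Variable R : realType.

(** The mean value theorem on a segment starting at 0 in either direction. *)
Lemma mvt_estimate (f df : R -> R) (eta c e : R) :
  (forall t : R, `|t| <= `|eta| -> is_derive t 1 f (df t)) ->
  (forall t : R, `|t| <= `|eta| -> `|df t - c| <= e) ->
  `|f eta - f 0 - c * eta| <= e * `|eta|.
Proof.
move=> fd dfc.
have cf (t : R) : `|t| <= `|eta| -> {for t, continuous f}.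
  move=> ti; have [dt _] := fd t ti.
  exact/differentiable_continuous/derivable1_diffP.
have main (t : R) : `|t| <= `|eta| -> f eta - f 0 = df t * eta ->
    `|f eta - f 0 - c * eta| <= e * `|eta|.
  move=> ti ->; rewrite -mulrBl normrM ler_wpM2r //; exact: dfc.
have [e0|e0] := leP 0 eta.
- have inb (t : R) : t \in `[0, eta] -> `|t| <= `|eta|.
    by rewrite in_itv /= => /andP[t0 te]; rewrite !ger0_norm.
  have [||t ti E] := @MVT_segment R f df 0 eta e0.
  + move=> t; rewrite in_itv /= => /andP[t0 te]; apply: fd; apply: inb.
    by rewrite in_itv /= !ltW.
  + apply: continuous_in_subspaceT => t; rewrite inE /= => ti; apply: cf.
    by apply: inb; rewrite in_itv.
  + by apply: (main t); [exact: inb|rewrite E subr0].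
- have inb (t : R) : t \in `[eta, 0] -> `|t| <= `|eta|.
    by rewrite in_itv /= => /andP[t0 te]; rewrite !ler0_norm; lra.
  have [||t ti E] := @MVT_segment R f df eta 0 (ltW e0).
  + move=> t; rewrite in_itv /= => /andP[t0 te]; apply: fd; apply: inb.
    by rewrite in_itv /= !ltW.
  + apply: continuous_in_subspaceT => t; rewrite inE /= => ti; apply: cf.
    by apply: inb; rewrite in_itv.
  + apply: (main t); first exact: inb.
    by rewrite -opprB E sub0r mulrN opprK.
Qed.

Lemma coord_le_norm n (v : 'rV[R]_n) i : `|v 0 i| <= `|v|.
Proof.
rewrite [leRHS]/Num.Def.normr /= mx_normrE.
exact: (le_bigmax _ (fun ij : 'I_1 * 'I_n => `|v ij.1 ij.2|) (0, i)).
Qed.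

Lemma norm_le_coord n (v : 'rV[R]_n) r : 0 <= r -> (forall i, `|v 0 i| <= r) ->
  `|v| <= r.
Proof.
move=> r0 vr; rewrite [leLHS]/Num.Def.normr /= mx_normrE.
apply/bigmax_leP; split => // -[i j] _ /=; by rewrite (ord1 i).
Qed.

(** The partial derivatives in the second variable are continuous, and at the
    centre they are those of the identity; so increments in that variable are
    those of the identity up to a small relative error. *)
Lemma c1_second_variable n (m : 'rV[R]_(n + n) -> 'rV[R]_n) (U : set 'rV[R]_(n + n))
    (a : 'rV[R]_n) (e : R) :
  open U -> U (row_mx a a) -> (forall u v, U u -> derivable m u v) ->
  (forall u v, U u -> {for u, continuous (fun u => 'D_v m u)}) ->
  (\forall y \near a, m (row_mx a y) = y) -> 0 < e ->
  exists2 d, 0 < d & forall x y, `|x - a| < d -> `|y - a| < d ->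
    `|m (row_mx x y) - m (row_mx x a) - (y - a)| <= e * `|y - a|.
Proof.
move=> Uo Ua md mc my e0.
pose dir (k : 'I_n) : 'rV[R]_(n + n) := row_mx 0 (delta_mx 0 k).
have Dk k : 'D_(dir k) m (row_mx a a) = delta_mx 0 k.
  apply: cvg_lim => //.
  have maa : m (row_mx a a) = a by exact: nbhs_singleton my.
  apply: (@cvg_trans _ ((cst (delta_mx 0 k : 'rV[R]_n)) h @[h --> 0^'])); last exact: cvg_cst.
  apply: near_eq_cvg.
  have c0 : (h *: delta_mx 0 k + a : 'rV[R]_n) @[h --> (0 : R)] --> a.
    have : (h *: delta_mx 0 k + a : 'rV[R]_n) @[h --> (0 : R)] --> 0 *: delta_mx 0 k + a.
      by apply: cvgD; [apply: cvgZr_tmp; exact: cvg_id|exact: cvg_cst].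
    by rewrite scale0r add0r.
  have /c0 H : nbhs a (fun y => m (row_mx a y) = y) := my.
  near=> h => /=.
  have h0 : h != 0 by near: h; exact: nbhs_dnbhs_neq.
  have -> : h *: dir k + row_mx a a = row_mx a (h *: delta_mx 0 k + a).
    by rewrite scale_row_mx scaler0 add_row_mx add0r.
  have -> : m (row_mx a (h *: delta_mx 0 k + a)) = h *: delta_mx 0 k + a.
    by near: h; apply: nbhs_dnbhs.
  by rewrite maa addrK scalerA mulVf // scale1r.
pose e' := e / n.+1%:R.
have e'0 : 0 < e' by rewrite divr_gt0 // ltr0n.
have : \forall u \near row_mx a a, U u /\
    forall k, `|'D_(dir k) m u - delta_mx 0 k| < e'.
  near=> u; split; first by near: u; apply: open_nbhs_nbhs.
  near: u; apply: filter_forall => k.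
  have : 'D_(dir k) m u @[u --> row_mx a a] --> (delta_mx 0 k : 'rV[R]_n).
    by rewrite -Dk; exact: mc.
  by move=> /cvgr_distC_lt /(_ _ e'0).
move=> /nbhs_ballP[d /= d0 dP].
have near_aa x y : `|x - a| < d / 2 -> `|y - a| < d / 2 ->
    U (row_mx x y) /\ forall k, `|'D_(dir k) m (row_mx x y) - delta_mx 0 k| < e'.
  move=> xa ya; apply: dP; rewrite -ball_normE /= opp_row_mx add_row_mx.
  apply: (@le_lt_trans _ _ (d / 2)); last by lra.
  apply: norm_le_coord => [|i]; first by lra.
  rewrite mxE; case: splitP => k _.
    by rewrite (le_trans (coord_le_norm _ _)) // distrC ltW.
  by rewrite (le_trans (coord_le_norm _ _)) // distrC ltW.
exists (d / 2) => [|x y xa ya]; first by lra.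
(* [y_ j] interpolates between [a] and [y] by changing one coordinate at a
   time, so that the mean value theorem applies to each step. *)
pose y_ j : 'rV[R]_n := \row_k if (k < j)%N then y 0 k else a 0 k.
pose eta k := y 0 k - a 0 k.
have eta_le k : `|eta k| <= `|y - a|.
  by have := coord_le_norm (y - a) k; rewrite !mxE.
have step (j : 'I_n) : `|m (row_mx x (y_ j.+1)) - m (row_mx x (y_ j))
    - eta j *: delta_mx 0 j| <= e' * `|y - a|.
  have lineE t : t *: dir j + row_mx x (y_ j) = row_mx x (t *: delta_mx 0 j + y_ j).
    by rewrite scale_row_mx scaler0 add_row_mx add0r.
  have yS : y_ j.+1 = eta j *: delta_mx 0 j + y_ j.
    apply/rowP => k; rewrite !mxE eqxx /= ltnS.
    case: (ltngtP k j) => [kj|jk|/val_inj ->].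
    - by rewrite (_ : (k == j) = false) ?mulr0 ?add0r //; apply/eqP => E; rewrite E ltnn in kj.
    - by rewrite (_ : (k == j) = false) ?mulr0 ?add0r //; apply/eqP => E; rewrite E ltnn in jk.
    - by rewrite eqxx mulr1 subrK.
  have close t : `|t| <= `|eta j| -> `|t *: delta_mx 0 j + y_ j - a| < d / 2.
    move=> te; apply: le_lt_trans ya; apply: norm_le_coord => // k.
    rewrite !mxE eqxx /=; case: (ltngtP k j) => [kj|jk|/val_inj ->].
    - rewrite (_ : (k == j) = false) ?mulr0 ?add0r; first exact: eta_le.
      by apply/eqP => E; rewrite E ltnn in kj.
    - rewrite (_ : (k == j) = false) ?mulr0 ?add0r ?subrr ?normr0 //.
      by apply/eqP => E; rewrite E ltnn in jk.
    - by rewrite eqxx mulr1 addrK (le_trans te).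
  have inU t : `|t| <= `|eta j| -> U (t *: dir j + row_mx x (y_ j)) /\
      forall k, `|'D_(dir k) m (t *: dir j + row_mx x (y_ j)) - delta_mx 0 k| < e'.
    by move=> te; rewrite lineE; apply: near_aa => //; exact: close.
  apply: norm_le_coord => [|c]; first by rewrite mulr_ge0 // ltW.
  have := @mvt_estimate (fun t => m (t *: dir j + row_mx x (y_ j)) 0 c)
    (fun t => 'D_(dir j) m (t *: dir j + row_mx x (y_ j)) 0 c) (eta j)
    ((delta_mx 0 j : 'rV[R]_n) 0 c) e'.
  rewrite /= scale0r add0r lineE -yS => est.
  rewrite !mxE [_ * (_ == _)%:R]mulrC; apply: le_trans (ler_wpM2l (ltW e'0) (eta_le j)).
  rewrite mxE in est; apply: est => t te.
    have [Ut _] := inU t te.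
    have quot : (fun h : R => h^-1 *: (m ((h *: 1 + t) *: dir j + row_mx x (y_ j)) 0 c
          - m (t *: dir j + row_mx x (y_ j)) 0 c)) =
        (fun h => h^-1 *: (m (h *: dir j + (t *: dir j + row_mx x (y_ j))) 0 c
          - m (t *: dir j + row_mx x (y_ j)) 0 c)).
      by apply/funext => h; rewrite addrA -scalerDl [h *: 1]mulr1.
    have dm := md _ (dir j) Ut; split.
      rewrite /derivable quot.
      exact: ((derivable_mxP _ _ _).1 dm 0 c).
    by rewrite derive_mx // mxE /derive quot.
  have [_ /(_ j)/ltW close_e] := inU t te.
  by have := le_trans (coord_le_norm _ c) close_e; rewrite !mxE.
have yn : y_ n = y by apply/rowP => k; rewrite mxE ltn_ord.
have y0 : y_ 0 = a by apply/rowP => k; rewrite mxE ltn0.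
have tele : \sum_(j < n) (m (row_mx x (y_ j.+1)) - m (row_mx x (y_ j))) =
    m (row_mx x y) - m (row_mx x a).
  by rewrite -(big_mkord xpredT (fun j => m (row_mx x (y_ j.+1)) - m (row_mx x (y_ j))))
    telescope_sumr // yn y0.
have -> : y - a = \sum_(j < n) eta j *: delta_mx 0 j.
  by rewrite [LHS]row_sum_delta; apply: eq_bigr => j _; rewrite !mxE.
rewrite -tele -sumrB; apply: le_trans (ler_norm_sum _ _ _) _.
apply: le_trans (ler_sum _ (fun j _ => step j)) _.
have -> : \sum_(j < n) eta j *: delta_mx 0 j = y - a.
  by rewrite [RHS]row_sum_delta; apply: eq_bigr => j _; rewrite !mxE.
rewrite sumr_const card_ord -mulr_natr mulrAC ler_wpM2r //.
rewrite /e' -mulrA ler_piMr ?(ltW e0) // mulrC ler_pdivrMr ?ltr0n // mul1r.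
by rewrite ler_nat.
Unshelve. all: by end_near. Qed.

End C1Estimate.

(** Coordinates at the identity in which multiplication is addition to first
    order, in the one-sided form that suffices for the closed subgroup
    theorem. *)
Record log_chart (R : realType) (G : topologicalGroupType) (n : nat) := LogChart {
  log_dom : set G;
  log : G -> 'rV[R]_n;
  log_inv : 'rV[R]_n -> G;
  log_radius : R;
  log_radius_gt0 : 0 < log_radius;
  log_dom_open : open log_dom;
  log_dom1 : log_dom 1%g;
  log1 : log 1%g = 0;
  log_continuous : forall g, log_dom g -> {for g, continuous log};
  logK : forall g, log_dom g -> log_inv (log g) = g;
  log_inv_dom : forall v, `|v| < log_radius -> log_dom (log_inv v);
  log_invK : forall v, `|v| < log_radius -> log (log_inv v) = v;
  log_inv_continuous : forall v, `|v| < log_radius -> {for v, continuous log_inv};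
  log_mul : forall e, 0 < e -> exists2 d, 0 < d & forall x y,
    log_dom x -> log_dom y -> `|log x| < d -> `|log y| < d ->
    log_dom (x * y)%g /\ `|log (x * y)%g - log x - log y| <= e * `|log y| }.

(** Any chart at the identity, centred there, will do: only the first
    derivatives of the multiplication matter. *)
Lemma lie_log_chart (R : realType) (G : topologicalGroupType) :
  lie_group R G -> exists n, exists _ : log_chart R G n, True.
Proof.
move=> [_ _ [n [A [[Acov _] Amul _]]]]; exists n.
have [a Aa a1] := Acov 1%g.
pose c0 := chart_fun a 1%g.
have img0 : chart_img a c0 by exists 1%g.
have imgP v : chart_img a v -> chart_dom a (chart_inv a v) /\ chart_fun a (chart_inv a v) = v.
  by move=> [g ga <-]; rewrite chart_funK.
have inv0 : chart_inv a c0 = 1%g by rewrite chart_funK.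
have [Oo OC] := Amul a a a Aa Aa Aa.
set O := (X in open X) in Oo.
pose m (w : 'rV[R]_(n + n)) :=
  chart_fun a (chart_inv a (lsubmx w) * chart_inv a (rsubmx w))%g.
have {}OC k : Ck_on k O m by exact: OC.
have [mc [md mdc]] := OC 1%N.
have O0 : O (row_mx c0 c0).
  by rewrite /O /= row_mxKl row_mxKr inv0 mulg1.
have mr y : chart_img a y -> m (row_mx c0 y) = y.
  by move=> /imgP[_ e]; rewrite /m row_mxKl row_mxKr inv0 mul1g.
have ml x : chart_img a x -> m (row_mx x c0) = x.
  by move=> /imgP[_ e]; rewrite /m row_mxKl row_mxKr inv0 mulg1.
have nimg : nbhs c0 (chart_img a).
  by apply: open_nbhs_nbhs; split => //; exact: chart_img_open.
have /nbhs_ballP[r /= r0 rP] := nimg.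
have imgr v : `|v| < r -> chart_img a (v + c0).
  by move=> vr; apply: rP; rewrite -ball_normE /= opprD addrCA subrr addr0 normrN.
refine (ex_intro _ (@LogChart R G n (chart_dom a) (fun g => chart_fun a g - c0)
  (fun v => chart_inv a (v + c0)) r r0 _ a1 _ _ _ _ _ _ _) I).
- exact: chart_dom_open.
- by rewrite subrr.
- move=> g ga; apply: cvgB; last exact: cvg_cst.
  exact: chart_fun_continuous.
- by move=> g ga; rewrite subrK chart_funK.
- by move=> v vr; have [] := imgP _ (imgr _ vr).
- by move=> v vr; have [_ ->] := imgP _ (imgr _ vr); rewrite addrK.
- move=> v vr; apply: (@continuous_comp 'rV[R]_n 'rV[R]_n G (fun v => v + c0) (chart_inv a)).
    have cs : continuous (fun v : 'rV[R]_n => v + c0).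
      move=> w; apply: (@continuousD R 'rV[R]_n 'rV[R]_n id (cst c0) w); 
        [exact: cvg_id|exact: cst_continuous].
    exact: cs.
  exact: chart_inv_continuous (imgr _ vr).
- move=> e e0.
  have [||d d0 dP] := @c1_second_variable R n m O c0 e Oo O0 md _ _ e0.
  + by move=> u v Ou; have [h _] := mdc v; exact: h.
  + apply: (@filterS _ (nbhs c0) _ (chart_img a)); [exact: mr|exact: nimg].
  have /nbhs_ballP[d' /= d'0 d'P] : nbhs (row_mx c0 c0) O by exact: open_nbhs_nbhs.
  exists (Num.min d (d' / 2)); first by rewrite lt_min d0 divr_gt0.
  move=> x y xa ya; rewrite !lt_min => /andP[xd xd'] /andP[yd yd'].
  have mE : m (row_mx (chart_fun a x) (chart_fun a y)) = chart_fun a (x * y)%g.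
    by rewrite /m row_mxKl row_mxKr !chart_funK.
  split.
    have : O (row_mx (chart_fun a x) (chart_fun a y)).
      apply: d'P; rewrite -ball_normE /= opp_row_mx add_row_mx.
      apply: (@le_lt_trans _ _ (d' / 2)); last by lra.
      apply: norm_le_coord => [|i]; first by lra.
      rewrite mxE; case: splitP => k _.
        by rewrite (le_trans (coord_le_norm _ _)) // distrC ltW.
      by rewrite (le_trans (coord_le_norm _ _)) // distrC ltW.
    by rewrite /O /= row_mxKl row_mxKr !chart_funK // => -[].
  have := dP _ _ xd yd; rewrite mE ml; last by exists x.
  by rewrite (opprB (chart_fun a x)) [_ - c0 + _]addrA subrK.
Qed.

Section LogChartTheory.
Variables (R : realType) (G : topologicalGroupType) (n : nat).
Variable L : log_chart R G n.
Local Notation dom := (log_dom L).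
Local Notation log := (log L).

Lemma log_inv0 : log_inv L 0 = 1%g.
Proof. by rewrite -(log1 L) logK //; exact: log_dom1. Qed.

Lemma log_small_nbhs d : 0 < d -> nbhs (1 : G)%g [set g | dom g /\ `|log g| < d].
Proof.
move=> d0.
have h1 : nbhs (1 : G)%g dom.
  by apply: open_nbhs_nbhs; split; [exact: log_dom_open|exact: log_dom1].
have h2 : nbhs (1 : G)%g [set g | `|log g| < d].
  have : log g @[g --> (1 : G)%g] --> (0 : 'rV[R]_n).
    by rewrite -(log1 L); exact: log_continuous (log_dom1 L).
  by move=> /cvgr0Pnorm_lt /(_ _ d0).
exact: filterI h1 h2.
Qed.

Lemma log_nbhs_small (V : set G) : nbhs 1%g V ->
  exists2 d, 0 < d & forall g, dom g -> `|log g| < d -> V g.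
Proof.
move=> V1; have c0 : {for 0, continuous (log_inv L)}.
  by apply: log_inv_continuous; rewrite normr0; exact: log_radius_gt0.
have : nbhs (0 : 'rV[R]_n) (log_inv L @^-1` V) by apply: c0; rewrite log_inv0.
move=> /nbhs_ballP[d /= d0 dP]; exists d => // g gd gs.
by rewrite -(logK gd); apply: dP; rewrite -ball_normE /= sub0r normrN.
Qed.

End LogChartTheory.

(** * Closed subgroups of Lie groups *)

Section NormLemmas.
Variables (R : realType) (n : nat).
Implicit Types u v w : 'rV[R]_n.

Lemma norm_split u v w : `|u| <= `|u - v - w| + `|v| + `|w|.
Proof.
have e : u = (u - v - w) + w + v by rewrite !subrK.
rewrite {1}e; apply: le_trans (ler_normD _ _) _.
by rewrite [leRHS]addrAC lerD2r ler_normD.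
Qed.

Lemma norm_split_r u v w : `|w| <= `|u - v - w| + `|u| + `|v|.
Proof.
have {1}-> : w = - (u - v - w) + u + - v.
  by rewrite !opprB addrA subrK addrK.
apply: le_trans (ler_normD _ _) _; rewrite normrN lerD2r.
by apply: le_trans (ler_normD _ _) _; rewrite normrN.
Qed.

Lemma norm_le_sub u v : `|u| <= `|u - v| + `|v|.
Proof. by rewrite -{1}(subrK v u) ler_normD. Qed.

(** The projection is onto the span of a family of vectors of [S] of maximal
    rank. *)
Lemma linear_projection (S : 'rV[R]_n -> Prop) : S 0 ->
  (forall u v, S u -> S v -> S (u + v)) -> (forall c v, S v -> S (c *: v)) ->
  exists P : 'M[R]_n, (forall v, S (v *m P)) /\ forall v, S v -> v *m P = v.
Proof.
move=> S0 SD SZ.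
have Ssub (A : 'M[R]_n) : (forall i, S (row i A)) -> forall v, (v <= A)%MS -> S v.
  move=> SA v /submxP[D ->]; rewrite mulmx_sum_row.
  by elim/big_ind: _ => // i _; exact/SZ/SA.
pose Q r := `[< exists A : 'M[R]_n, (forall i, S (row i A)) /\ \rank A = r >].
have exQ : exists r, Q r.
  exists 0%N; apply/asboolP; exists 0; split; last exact: mxrank0.
  by move=> i; rewrite row0.
have ubQ r : Q r -> (r <= n)%N by move=> /asboolP[A [_ <-]]; exact: rank_leq_row.
have [r /asboolP[A [SA rA]] rmax] := ex_maxnP exQ ubQ.
have full v : S v -> (v <= A)%MS.
  move=> Sv; have : Q (\rank (A + v)%MS).
    apply/asboolP; exists (A + v)%MS; split => // i.
    have : (row i (A + v)%MS <= A + v)%MS by exact: row_sub.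
    move=> /sub_addsmxP[[u1 u2] /= ->]; apply: SD.
      by apply: (Ssub A SA); exact: submxMl.
    by rewrite [u2]mx11_scalar mul_scalar_mx; exact: SZ.
  move=> /rmax; rewrite -rA => le; apply: submx_trans (addsmxSr A v) _.
  have := mxrank_leqif_sup (addsmxSl A v); case=> le' <-.
  by rewrite eqn_leq le le'.
exists (proj_mx A (A^C)%MS); split => v.
  by apply: (Ssub A SA); exact: proj_mx_sub.
by move=> Sv; apply: proj_mx_id (capmx_compl A) (full v Sv).
Qed.

Lemma mulmx_bounded (P : 'M[R]_n) : exists2 C, 1 <= C &
  forall v : 'rV[R]_n, `|v *m P| <= C * `|v|.
Proof.
pose C := 1 + \sum_i \sum_j `|P i j|.
have C0 : 0 <= \sum_i \sum_j `|P i j| by do 2! apply: sumr_ge0 => ? _.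
exists C => [|v]; first by rewrite lerDl.
apply: norm_le_coord => [|j]; first by rewrite mulr_ge0 // addr_ge0.
rewrite mxE; apply: le_trans (ler_norm_sum _ _ _) _.
apply: (@le_trans _ _ (\sum_i `|v| * `|P i j|)).
  apply: ler_sum => i _; rewrite normrM ler_wpM2r //; exact: coord_le_norm.
rewrite -mulr_sumr mulrC ler_wpM2r //.
apply: (@le_trans _ _ (\sum_i \sum_j `|P i j|)); last by rewrite lerDr.
apply: ler_sum => i _; rewrite (bigD1 j) //= lerDl.
by apply: sumr_ge0 => ? _.
Qed.

End NormLemmas.

Section ClosedSubgroup.
Variables (R : realType) (G : topologicalGroupType) (n : nat).
Variables (L : log_chart R G n) (K : subgroup G).
Local Notation dom := (log_dom L).
Local Notation log := (log L).
Local Notation D := [set g | subgroup_set K g /\ dom g].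

Lemma log_small_inv e : 0 < e -> exists2 d, 0 < d & forall x, dom x ->
  `|log x| < d -> dom (x^-1)%g /\ `|log (x^-1)%g + log x| <= e * `|log x|.
Proof.
move=> e0; pose e' := Num.min (e / 2) 2^-1.
have e'0 : 0 < e' by rewrite lt_min; apply/andP; split; lra.
have [e'1 e'2] : e' <= e / 2 /\ e' <= 2^-1 by rewrite !ge_min !lexx orbT.
have [d d0 dP] := log_mul L e'0.
have Vn : nbhs (1 : G)%g [set x : G | dom (x^-1)%g /\ `|log (x^-1)%g| < d].
  have c1 : ((x : G)^-1)%g @[x --> (1 : G)%g] --> (1 : G)%g.
    by rewrite -[X in _ --> X]invg1; exact: invg_continuous.
  exact: (c1 _ (log_small_nbhs L d0)).
have [d' d'0 d'P] := log_nbhs_small L Vn.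
exists (Num.min d d'); first by rewrite lt_min d0.
move=> x xd; rewrite lt_min => /andP[xs xs'].
have [xVd xVs] := d'P x xd xs'; split => //.
have [_] := dP _ _ xd xVd xs xVs; rewrite mulgV log1 sub0r -opprD normrN.
rewrite addrC => h.
have : `|log (x^-1)%g| <= `|log (x^-1)%g + log x| + `|log x|.
  by have := ler_normB (log (x^-1)%g + log x) (log x); rewrite addrK.
move: h; set A := `|_ + _|; set B := `|log _|; set B' := `|log x| => h h'.
have B0 : 0 <= B by exact: normr_ge0.
have B'0 : 0 <= B' by exact: normr_ge0.
have : e' * B <= 2^-1 * B by exact: ler_wpM2r.
have : e' * B <= e' * (2 * B') by rewrite ler_wpM2l ?(ltW e'0) //; nra.
have : e' * B' <= e / 2 * B' by exact: ler_wpM2r.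
by lra.
Qed.

(** Powers stay close to the multiples of the logarithm as long as these
    remain in the chart: the errors of the single steps add up. *)
Lemma log_small_pow e : 0 < e -> exists2 d, 0 < d & forall x (a : nat), dom x ->
  `|log x| < d -> a%:R * `|log x| < d ->
  dom (x ^+ a)%g /\ `|log (x ^+ a)%g - a%:R *: log x| <= e * (a%:R * `|log x|).
Proof.
move=> e0; have [d d0 dP] := log_mul L e0.
have d'0 : 0 < d / (2 + e) by rewrite divr_gt0 // addr_gt0.
exists (d / (2 + e)) => // x a xd xs.
have ds : d / (2 + e) <= d by rewrite ler_piMr ?(ltW d0) // invf_le1; lra.
elim: a => [_|a IHa axs].
  by rewrite expg0 log1 scale0r subrr normr0 mul0r mulr0; split => //; exact: log_dom1.
have axs' : a%:R * `|log x| < d / (2 + e).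
  by apply: le_lt_trans axs; rewrite ler_wpM2r // ler_nat.
have [ad ae] := IHa axs'.
have as_ : `|log (x ^+ a)%g| < d.
  apply: le_lt_trans (norm_le_sub _ (a%:R *: log x)) _.
  rewrite normrZ normr_nat; apply: le_lt_trans (lerD ae (lexx _)) _.
  move: axs'; rewrite ltr_pdivlMr ?addr_gt0 //.
  have : 0 <= a%:R * `|log x| by rewrite mulr_ge0.
  by move: (a%:R * _) => t t0; nra.
have [aSd aSe] := dP _ _ ad xd as_ (lt_le_trans xs ds).
rewrite expgSr; split => //.
have -> : log (x ^+ a * x)%g - a.+1%:R *: log x =
    (log (x ^+ a * x)%g - log (x ^+ a)%g - log x) + (log (x ^+ a)%g - a%:R *: log x).
  by rewrite -natr1; apply/rowP => i; rewrite !mxE; ring.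
apply: le_trans (ler_normD _ _) _; rewrite -natr1 mulrDl mul1r mulrDr addrC.
exact: lerD.
Qed.

(** The tangent space of [K] at the identity, described without any smooth
    structure on [K]. *)
Definition tangent (v : 'rV[R]_n) := forall e, 0 < e -> exists2 s0, 0 < s0 &
  forall s, 0 < s -> s < s0 -> exists2 k, D k & `|log k - s *: v| <= e * s.

Lemma tangent0 : tangent 0.
Proof.
move=> e e0; exists 1 => // s s0 _; exists 1%g.
  by split; [exact: subgroup1|exact: log_dom1].
by rewrite log1 scaler0 subrr normr0 mulr_ge0 // ltW.
Qed.

Lemma tangentZ_pos c v : 0 < c -> tangent v -> tangent (c *: v).
Proof.
move=> c0 tv e e0; have [|s0 s00 sP] := tv (e / c); first exact: divr_gt0.
exists (s0 / c) => [|s sp ss]; first exact: divr_gt0.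
have [||k Kk kv] := sP (s * c); first exact: mulr_gt0.
  by rewrite -ltr_pdivlMr.
exists k => //; rewrite scalerA; apply: le_trans kv _.
by rewrite [s * c]mulrC mulrA divfK // gt_eqF.
Qed.

Lemma tangentN v : tangent v -> tangent (- v).
Proof.
move=> tv e e0; pose M := `|v| + 1.
have M0 : 0 < M by rewrite ltr_wpDl.
pose e1 := Num.min 1 (e / 2).
have e10 : 0 < e1 by rewrite lt_min ltr01 divr_gt0.
have [e1a e1b] : e1 <= 1 /\ e1 <= e / 2 by rewrite !ge_min !lexx orbT.
have e20 : 0 < e / (2 * M) by rewrite divr_gt0 // mulr_gt0.
have [d d0 dP] := log_small_inv e20; have [s0 s00 sP] := tv _ e10.
exists (Num.min s0 (d / M)); first by rewrite lt_min s00 divr_gt0.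
move=> s sp; rewrite lt_min => /andP[ss ss'].
have [k [Kk kd] kv] := sP s sp ss.
have ks : `|log k| <= s * M.
  apply: le_trans (norm_le_sub _ (s *: v)) _; rewrite normrZ gtr0_norm // mulrDr mulr1.
  rewrite addrC lerD2l; apply: le_trans kv _; nra.
have [|kVd kVe] := dP k kd.
  by apply: le_lt_trans ks _; rewrite -ltr_pdivlMr.
exists (k^-1)%g; first by split => //; exact: subgroupV.
rewrite scalerN opprK.
have -> : log (k^-1)%g + s *: v = (log (k^-1)%g + log k) - (log k - s *: v).
  by apply/rowP => i; rewrite !mxE; ring.
apply: le_trans (ler_normB _ _) _.
apply: le_trans (lerD kVe kv) _.
have : e / (2 * M) * `|log k| <= e / (2 * M) * (s * M) by rewrite ler_wpM2l // ltW.
have -> : e / (2 * M) * (s * M) = e / 2 * s.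
  by field; rewrite gt_eqF.
nra.
Qed.

Lemma tangentZ c v : tangent v -> tangent (c *: v).
Proof.
move=> tv; have [c0|c0|->] := ltgtP c 0; last first.
- by rewrite scale0r; exact: tangent0.
- exact: tangentZ_pos.
- rewrite -[c]opprK scaleNr; apply/tangentN/tangentZ_pos => //.
  by rewrite oppr_gt0.
Qed.

Lemma tangentD u v : tangent u -> tangent v -> tangent (u + v).
Proof.
move=> tu tv e e0; pose M := Num.max `|u| `|v| + 1.
have M0 : 0 < M by rewrite ltr_wpDl // le_max normr_ge0.
pose e1 := Num.min 1 (e / 4).
have e10 : 0 < e1 by rewrite lt_min ltr01 divr_gt0.
have [e1a e1b] : e1 <= 1 /\ e1 <= e / 4 by rewrite !ge_min !lexx orbT.
have e20 : 0 < e / (2 * M) by rewrite divr_gt0 // mulr_gt0.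
have [d d0 dP] := log_mul L e20.
have [s0 s00 sP] := tu _ e10; have [s1 s10 sP1] := tv _ e10.
exists (Num.min (Num.min s0 s1) (d / M)); first by rewrite !lt_min s00 s10 divr_gt0.
move=> s sp; rewrite !lt_min => /andP[/andP[ss ss1] ss'].
have [k [Kk kd] ku] := sP s sp ss; have [k' [Kk' kd'] kv] := sP1 s sp ss1.
have size w g : `|w| <= M - 1 -> `|log g - s *: w| <= e1 * s -> `|log g| <= s * M.
  move=> wM gw; apply: le_trans (norm_le_sub _ (s *: w)) _.
  rewrite normrZ gtr0_norm //; nra.
have ks : `|log k| <= s * M by apply: size ku; rewrite addrK le_max lexx.
have ks' : `|log k'| <= s * M by apply: size kv; rewrite addrK le_max lexx orbT.
have sM : s * M < d by rewrite -ltr_pdivlMr.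
have [kkd kke] := dP _ _ kd kd' (le_lt_trans ks sM) (le_lt_trans ks' sM).
exists (k * k')%g; first by split => //; exact: subgroupM.
have -> : log (k * k')%g - s *: (u + v) = (log (k * k')%g - log k - log k')
    + (log k - s *: u) + (log k' - s *: v).
  by apply/rowP => i; rewrite !mxE; ring.
apply: le_trans (ler_normD _ _) _; apply: le_trans (lerD (ler_normD _ _) (lexx _)) _.
have : e / (2 * M) * `|log k'| <= e / (2 * M) * (s * M) by rewrite ler_wpM2l // ltW.
have -> : e / (2 * M) * (s * M) = e / 2 * s.
  by field; rewrite gt_eqF.
move: ku kv kke; move: `|_ - _ - _| `|log k - _| `|log k' - _| => x y z.
nra.
Qed.

(** The powers of small elements of [K] follow the limit of their directions. *)
Lemma tangent_limit u : `|u| = 1 ->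
  (forall eta d, 0 < eta -> 0 < d -> exists2 k, D k &
    [/\ 0 < `|log k|, `|log k| < d & `|log k - `|log k| *: u| <= eta * `|log k|]) ->
  tangent u.
Proof.
move=> u1 uP e e0.
have e30 : 0 < e / 3 by rewrite divr_gt0.
have [d d0 dP] := log_small_pow e30.
exists d => // s sp sd.
have [||k [Kk kd] [k0 ks ku]] := uP (e / 3) (Num.min d (s * (e / 3))) => //.
  by rewrite lt_min d0 mulr_gt0.
move: ks; rewrite lt_min => /andP[kd' ks].
(* The largest power of [k] that does not go beyond the length [s]. *)
pose a := Num.truncn (s / `|log k|).
have /andP[a1 a2] : a%:R <= s / `|log k| < a.+1%:R.
  by apply: truncn_itv; rewrite divr_ge0 // ltW.
have {}a1 : a%:R * `|log k| <= s by rewrite -ler_pdivlMr.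
have {}a2 : s < a%:R * `|log k| + `|log k|.
  by move: a2; rewrite ltr_pdivrMr // -natr1 mulrDl mul1r.
have [ad ae] := dP k a kd kd' (le_lt_trans a1 sd).
exists (k ^+ a)%g.
  split => //; elim: (a) => [|b IHb]; first by rewrite expg0; exact: subgroup1.
  by rewrite expgSr; exact: subgroupM.
have -> : log (k ^+ a)%g - s *: u = (log (k ^+ a)%g - a%:R *: log k)
    + a%:R *: (log k - `|log k| *: u) + (a%:R * `|log k| - s) *: u.
  by apply/rowP => i; rewrite !mxE; ring.
apply: le_trans (ler_normD _ _) _; apply: le_trans (lerD (ler_normD _ _) (lexx _)) _.
rewrite !normrZ u1 mulr1 normr_nat.
have : a%:R * `|log k - `|log k| *: u| <= e / 3 * (a%:R * `|log k|).
  by rewrite mulrCA; exact: ler_wpM2l.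
have : `|a%:R * `|log k| - s| <= s * (e / 3).
  by rewrite ler0_norm ?subr_le0 // opprB; lra.
have : e / 3 * (a%:R * `|log k|) <= e / 3 * s by rewrite ler_wpM2l // ltW.
by lra.
Qed.

End ClosedSubgroup.

Section TangentProjection.
Variables (R : realType) (G : topologicalGroupType) (n : nat).
Variables (L : log_chart R G n) (K : subgroup G).
Local Notation dom := (log_dom L).
Local Notation log := (log L).
Local Notation D := [set g | subgroup_set K g /\ dom g].

Lemma log_eq0 g : dom g -> log g = 0 -> g = 1%g.
Proof. by move=> gd g0; rewrite -(logK gd) g0 log_inv0. Qed.

(** Otherwise compactness of the unit sphere would give a limit direction that
    is tangent to [K] but not fixed by [P]. *)
Lemma nearly_tangent (P : 'M[R]_n) e : (forall v, tangent L K v -> v *m P = v) ->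
  0 < e -> exists2 d, 0 < d & forall k, D k -> `|log k| < d ->
  `|log k - log k *m P| <= e * `|log k|.
Proof.
move=> PK e0; apply: contrapT => no.
have bad d : 0 < d -> exists k, [/\ D k, 0 < `|log k|, `|log k| < d &
    e * `|log k| < `|log k - log k *m P|].
  move=> d0; apply: contrapT => nk; apply: no; exists d => // k Dk ks.
  rewrite leNgt; apply/negP => kb; apply: nk; exists k; split => //.
  rewrite normr_gt0; apply/eqP => k0.
  by move: kb; rewrite k0 mul0mx subrr normr0 mulr0 ltxx.
pose B d := [set u | exists k, [/\ D k, 0 < `|log k|, `|log k| < d &
    e * `|log k| < `|log k - log k *m P|] /\ u = `|log k|^-1 *: log k].
pose F := filter_from [set d : R | 0 < d] B.
have FF : ProperFilter F.
  apply: filter_from_proper; last first.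
    by move=> d /= /bad[k kP]; exists (`|log k|^-1 *: log k); exists k.
  apply: filter_from_filter; first by exists 1 => /=.
  move=> d d' /= d0 d'0; exists (Num.min d d'); first by rewrite /= lt_min d0.
  move=> u [k [[Dk k0]]]; rewrite lt_min => /andP[kd kd'] kb ku.
  by split; exists k.
have Scpt : compact [set u : 'rV[R]_n | `|u| = 1].
  apply: bounded_closed_compact.
    exists 1; split; first exact: num_real.
    by move=> M M1 u /= ->; exact: ltW.
  apply: (@preimage_closed _ _ (fun u : 'rV[R]_n => `|u|) [set x : R | x = 1]); last exact: closed_eq.
  by move=> u _; exact: norm_continuous.
have FS : F [set u : 'rV[R]_n | `|u| = 1].
  exists 1 => //= u [k [[_ k0 _ _] ->]] /=.
  by rewrite normrZ normfV normr_id mulVf // gt_eqF.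
have [u [u1 uF]] := Scpt _ FF FS.
have near_u eta d : 0 < eta -> 0 < d -> exists k, [/\ D k, 0 < `|log k|, `|log k| < d &
    e * `|log k| < `|log k - log k *m P|] /\ `|log k - `|log k| *: u| <= eta * `|log k|.
  move=> eta0 d0.
  have [|_ [[k [kP ->]] ub]] := uF (B d) (ball u eta) _ (nbhsx_ballx u eta eta0).
    by exists d.
  exists k; split => //; have [_ k0 _ _] := kP.
  have -> : log k - `|log k| *: u = - (`|log k| *: (u - `|log k|^-1 *: log k)).
    by rewrite scalerBr scalerA mulfV ?gt_eqF // scale1r opprB.
  rewrite normrN normrZ normr_id mulrC ler_wpM2r //.
  by apply: ltW; move: ub; rewrite -ball_normE.
have tu : tangent L K u.
  apply: tangent_limit => // eta d eta0 d0.
  by have [k [[Dk k0 ks _] kb]] := near_u _ _ eta0 d0; exists k.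
have [C C1 CP] := mulmx_bounded P.
have eta0 : 0 < e / (1 + C) by rewrite divr_gt0 //; lra.
have [k [[_ k0 _ kb] ku]] := near_u _ 1 eta0 ltr01.
have E : log k - log k *m P = (log k - `|log k| *: u) - (log k - `|log k| *: u) *m P.
  by rewrite mulmxBl -scalemxAl (PK u tu); apply/rowP => i; rewrite !mxE; ring.
move: kb; rewrite E; apply/negP; rewrite -leNgt.
apply: le_trans (ler_normB _ _) _.
apply: le_trans (lerD (lexx _) (CP _)) _.
rewrite -[X in X + _]mul1r -mulrDl.
apply: (@le_trans _ _ ((1 + C) * (e / (1 + C) * `|log k|))).
  by rewrite ler_wpM2l //; lra.
by rewrite mulrA [(1 + C) * _]mulrC divfK // gt_eqF //; lra.
Qed.

End TangentProjection.

(** A neighbourhood of the identity in [G] retracts onto [K] along the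
    complement of the tangent space: [g] is moved into a slice transverse to
    [K] by a unique small element of [K], found by descent and continuous in
    [g] by compactness. *)
Lemma closed_subgroup_slice (R : realType) (G : topologicalGroupType)
    (K : subgroup G) : lie_group R G -> closed (K : set G) ->
  exists (W : set G) (kap : G -> G), [/\ open W, W 1%g /\ kap 1%g = 1%g,
    forall g, W g -> subgroup_set K (kap g) /\ {for g, continuous kap},
    forall g h, W g -> W h -> subgroup_set K (g^-1 * h)%g ->
      (g * kap g)%g = (h * kap h)%g &
    forall g, W g -> exists2 c : R -> G, continuous c &
      [/\ c 0 = 1%g, c 1 = g & forall s, 0 <= s <= 1 -> W (c s)]].
Proof.
move=> Glie Kcl; have [n [L _]] := lie_log_chart Glie.
have [P [PK PT]] := linear_projection (@tangent0 _ _ _ L K)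
  (@tangentD _ _ _ L K) (@tangentZ _ _ _ L K).
have [C C1 CP] := mulmx_bounded P.
have C0 : 0 < C by lra.
(* With this relative error, the projection of [log (x * y)] differs from the
   sum of the projections by at most a quarter of the norm of [log y]. *)
pose e := (4 * C)^-1.
have Ce : C * e = 4^-1 by rewrite /e; field; rewrite gt_eqF.
have e0 : 0 < e by rewrite invr_gt0 mulr_gt0.
have e1 : e <= 4^-1 by rewrite -Ce ler_peMl // ltW.
have [d1 d10 mulP] := log_mul L e0.
have i40 : 0 < 4^-1 :> R by [].
have [d2 d20 tanP] := nearly_tangent PT i40.
pose dm := log_dom L; pose lg := log L.
have CPe (v : 'rV[R]_n) x : `|v| <= e * x -> `|v *m P| <= 4^-1 * x.
  by move=> vx; apply: le_trans (CP v) _; rewrite -Ce -mulrA ler_wpM2l // ltW.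
(* The projection sees a small factor from [K] almost entirely, so a slice
   meets each coset once. *)
have uniq g k : dm g -> `|lg g| < d1 -> subgroup_set K k -> dm k ->
    `|lg k| < d1 -> `|lg k| < d2 -> lg g *m P = lg (g * k)%g *m P -> k = 1%g.
  move=> gd gs Kk kd ks ks2 E; apply: (log_eq0 kd).
  have [_ gk] := mulP _ _ gd kd gs ks.
  have := CPe _ _ gk; rewrite !mulmxBl -/lg -E subrr sub0r normrN => h.
  have h2 := tanP k (conj Kk kd) ks2; have h3 := norm_le_sub (lg k) (lg k *m P).
  apply/eqP; rewrite -normr_le0.
  by move: h h2 h3; rewrite -/lg; move: `|_ - _| `|_ *m P| `|lg k| => x y z; lra.
have Rad := log_radius_gt0 L.
have Vn : nbhs ((1 : G)%g, (1 : G)%g) [set p : G * G | dm (p.1^-1 * p.2)%g /\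
    `|lg (p.1^-1 * p.2)%g| < Num.min d1 d2].
  have c1 : (p.1^-1 * p.2)%g @[p --> ((1 : G)%g, (1 : G)%g)] --> (1 : G)%g.
    have c2 : continuous (fun p : G * G => (p.1^-1 * p.2)%g).
      apply: (@cts_comp _ _ _ (fun p : G * G => (p.1^-1, p.2)%g) (fun p => (p.1 * p.2)%g)).
        apply: cts_pair; last exact: cts_snd.
        exact: (cts_comp (@cts_fst _ _) (@invg_continuous G)).
      exact: mulg_continuous.
    by have := c2 (1%g, 1%g); rewrite /continuous_at /= invg1 mulg1.
  have dd0 : 0 < Num.min d1 d2 by rewrite lt_min d10.
  exact: (c1 _ (log_small_nbhs L dd0)).
have [[V1 V2] /= [/(log_nbhs_small L)[v1 v10 V1P] /(log_nbhs_small L)[v2 v20 V2P]] VP] := Vn.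
(* [r] keeps products of an element of [W] and one of [Kr] inside the chart, and
   quotients of two such products within the range of [uniq]. *)
pose r := Num.min (Num.min (log_radius L / 2) (d1 / 4)) (Num.min (d2 / 4)
  (Num.min (v1 / 4) (v2 / 4))).
have r0 : 0 < r by rewrite !lt_min !divr_gt0.
have [rR [rd1 [rd2 [rv1 rv2]]]] : r <= log_radius L / 2 /\ r <= d1 / 4 /\
    r <= d2 / 4 /\ r <= v1 / 4 /\ r <= v2 / 4.
  by rewrite /r !ge_min !lexx !orbT.
pose Kr := [set k | [/\ subgroup_set K k, dm k & `|lg k| <= r]].
have Krcpt : compact Kr.
  have -> : Kr = (log_inv L @` [set v | `|v| <= r]) `&` (K : set G).
    apply/seteqP; split => k /=.
      by move=> [Kk kd ks]; split => //; exists (lg k) => //; exact: logK.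
    move=> [[v /= vr <-] Kk]; have vR : `|v| < log_radius L by lra.
    by split => //; [exact: log_inv_dom|rewrite /lg log_invK].
  apply: compact_closedI => //; apply: continuous_compact.
    apply: continuous_in_subspaceT => v; rewrite inE /= => vr.
    by apply: log_inv_continuous; lra.
  apply: bounded_closed_compact.
    exists r; split; first exact: num_real.
    by move=> M M1 u /= ur; exact: (le_trans ur (ltW M1)).
  apply: (@preimage_closed _ _ (fun u : 'rV[R]_n => `|u|) [set x | x <= r]); last exact: closed_le.
  by move=> u _; exact: norm_continuous.
(* Small enough for the minimiser found below to have norm under [r / 2]. *)
pose del := r / (9 * C).
have del0 : 0 < del by rewrite divr_gt0 // mulr_gt0.
have delr : C * del * 9 = r by rewrite /del; field; rewrite gt_eqF.
have delr' : del <= r by have : del <= C * del; [rewrite ler_peMl // ltW|lra].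
pose W := [set g | dm g /\ `|lg g| < del].
pose z g k := lg (g * k)%g *m P.
have cz g k : dm (g * k)%g -> {for (g, k), continuous (fun p : G * G => z p.1 p.2)}.
  move=> gkd.
  apply: (@continuous_comp _ _ _ (fun p : G * G => (p.1 * p.2)%g) (fun g => lg g *m P)).
    exact: mulg_continuous.
  apply: (@continuous_comp _ _ _ lg (fun v : 'rV[R]_n => v *m P)).
    exact: log_continuous.
  have cP : continuous (fun v : 'rV[R]_n => v *m P).
    move=> v; apply/(@cvgrPdist_lt _ _ _ (nbhs v) (nbhs_filter v)) => t t0.
    apply/nbhs_ballP.
    exists (t / C) => [|w]; first by rewrite /= divr_gt0.
    rewrite -ball_normE /= ltr_pdivlMr // mulrC => vw.
    by rewrite -mulmxBl; exact: le_lt_trans (CP _) vw.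
  exact: cP.
have prodd g k : W g -> Kr k -> dm (g * k)%g /\ `|lg (g * k)%g| < 3 * r.
  move=> [gd gs] [Kk kd ks].
  have [||gkd gke] := mulP g k gd kd; [by rewrite -/lg; lra..|split => //].
  have := norm_split (lg (g * k)%g) (lg g) (lg k).
  have : e * `|lg k| <= 4^-1 * `|lg k| by rewrite ler_wpM2r.
  by move: gke; rewrite -/lg; lra.
(* The projection of [log (g * k)] is minimised over the compact set [Kr]. *)
have ex g : W g -> exists k, Kr k /\ z g k = 0.
  move=> Wg; have [gd gs] := Wg.
  have Kr1 : Kr 1%g.
    split; [exact: subgroup1|exact: log_dom1|].
    by rewrite /lg log1 normr0 ltW.
  have [||k0 + kmin] := @compact_EVT_min G R (fun k => `|z g k|) Kr _ Krcpt.
    by exists 1%g.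
    apply: continuous_in_subspaceT => k; rewrite inE => /(prodd g k Wg)[gkd _].
    apply: (@continuous_comp _ _ _ (z g) (fun v : 'rV[R]_n => `|v|)); last exact: norm_continuous.
    apply: (@continuous_comp _ _ _ (fun k => (g, k)) (fun p : G * G => z p.1 p.2)).
      by apply: cvg_pair; [exact: cvg_cst|exact: cvg_id].
    exact: cz.
  rewrite inE => Krk0; exists k0; split => //.
  have [Kk0 k0d k0r] := Krk0.
  apply: contrapT => /eqP z0; set w := z g k0 in z0.
  have w0 : 0 < `|w| by rewrite normr_gt0.
  have z1 : `|w| <= C * del.
    have := kmin 1%g; rewrite inE => /(_ Kr1) h; apply: le_trans h _.
    by rewrite /z mulg1; apply: le_trans (CP _) _; rewrite ler_wpM2l // ltW.
  have [||gkd gke] := mulP g k0 gd k0d; [by rewrite -/lg; lra..|].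
  have k0s : `|lg k0| < r / 2.
    have h1 := CPe _ _ gke; rewrite !mulmxBl in h1.
    have h2 := norm_split_r (lg (g * k0)%g *m P) (lg g *m P) (lg k0 *m P).
    have h4 := norm_le_sub (lg k0) (lg k0 *m P).
    have h3 : `|lg k0 - lg k0 *m P| <= 4^-1 * `|lg k0|.
      by apply: tanP => //; rewrite -/lg; lra.
    have h5 : `|lg g *m P| <= C * del.
      by apply: le_trans (CP _) _; rewrite ler_wpM2l // ltW.
    by move: h1 h2 h3 h4 h5 z1; rewrite /w /z -/lg; lra.
  (* If the minimum [w] were not zero, a step from [k0] in the tangent direction
     [- w] would decrease it. *)
  have tw : tangent L K (- w) by apply: tangentN; exact: PK.
  have e2 : 0 < `|w| / (16 * C) by rewrite divr_gt0 // mulr_gt0.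
  have [s0 s00 sP] := tw _ e2.
  pose s := Num.min (s0 / 2) (Num.min 2^-1 (r / (8 * `|w|))).
  have r8 : 0 < r / (8 * `|w|) by rewrite divr_gt0 // mulr_gt0.
  have s_gt0 : 0 < s by rewrite !lt_min r8 andbT; apply/andP; split; lra.
  have [ss0 [ss1 ssr]] : s <= s0 / 2 /\ s <= 2^-1 /\ s <= r / (8 * `|w|).
    by rewrite /s !ge_min !lexx !orbT.
  have sw : s * `|w| * 8 <= r.
    by move: ssr; rewrite ler_pdivlMr ?mulr_gt0 //; lra.
  have [|k [Kk kd] kw] := sP s s_gt0; first lra.
  pose q := `|w| / (16 * C) * s.
  have Cq : C * q * 16 = `|w| * s by rewrite /q; field; rewrite gt_eqF.
  have q0 : 0 <= q by rewrite mulr_ge0 // ltW.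
  have qC : q <= C * q by rewrite ler_peMl.
  have ks : `|lg k| <= s * `|w| + q.
    apply: le_trans (norm_le_sub _ (s *: - w)) _.
    by rewrite normrZ normrN gtr0_norm // addrC lerD2l.
  have ks' : `|lg k| <= r / 4 by move: Cq; rewrite [`|w| * s]mulrC; lra.
  have [||k0kd k0ke] := mulP k0 k k0d kd; [by rewrite -/lg; lra..|].
  have [_ gk0s] := prodd _ _ Wg Krk0.
  have [||gkkd gkke] := mulP _ _ gkd kd; [by rewrite -/lg; lra..|].
  have Krkk : Kr (k0 * k)%g.
    split => //; first exact: subgroupM.
    have := norm_split (lg (k0 * k)%g) (lg k0) (lg k).
    have : e * `|lg k| <= 4^-1 * `|lg k| by rewrite ler_wpM2r.
    by move: k0ke; rewrite -/lg; lra.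
  have := kmin (k0 * k)%g; rewrite inE => /(_ Krkk).
  apply/negP; rewrite -ltNge /z mulgA.
  have -> : lg (g * k0 * k)%g *m P = (lg (g * k0 * k)%g - lg (g * k0)%g - lg k) *m P
      + (lg k - s *: - w) *m P + (1 - s) *: w.
    rewrite !mulmxBl -scalemxAl mulNmx (PT w (PK _)) -/(z g k0) -/w.
    by apply/rowP => i; rewrite !mxE; ring.
  have h1 := CPe _ _ gkke.
  have h2 : `|(lg k - s *: - w) *m P| <= C * q.
    by apply: le_trans (CP _) _; rewrite ler_wpM2l // ltW.
  have h3 : `|(1 - s) *: w| = `|w| - s * `|w|.
    by rewrite normrZ ger0_norm ?mulrBl ?mul1r //; lra.
  apply: le_lt_trans (ler_normD _ _) _; rewrite h3.
  have h4 := ler_normD ((lg (g * k0 * k)%g - lg (g * k0)%g - lg k) *m P)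
    ((lg k - s *: - w) *m P).
  have sw0 : 0 < s * `|w| by rewrite mulr_gt0.
  by move: h1 h2 h4 Cq; rewrite -/lg; rewrite [`|w| * s]mulrC; lra.
pose kap g := if pselect (W g) is left Wg then sval (cid (ex g Wg)) else 1%g.
have kapP g : W g -> Kr (kap g) /\ z g (kap g) = 0.
  by rewrite /kap => Wg; case: pselect => // Wg'; exact: (svalP (cid (ex g Wg'))).
have slice g h k k' : W g -> W h -> Kr k -> Kr k' -> z g k = 0 -> z h k' = 0 ->
    subgroup_set K (g^-1 * h)%g -> (g * k)%g = (h * k')%g.
  move=> Wg Wh Krk Krk' zg zh Kgh.
  have [gkd gks] := prodd _ _ Wg Krk; have [hkd hks] := prodd _ _ Wh Krk'.
  have [] : dm ((g * k)^-1 * (h * k'))%g /\ `|lg ((g * k)^-1 * (h * k'))%g| < Num.min d1 d2.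
    by apply: (VP (g * k, h * k')%g); split; [apply: V1P => //|apply: V2P => //];
      rewrite -/lg; lra.
  set kk := ((g * k)^-1 * (h * k'))%g; rewrite lt_min => kkd /andP[kks1 kks2].
  have E : (g * k * kk)%g = (h * k')%g by rewrite /kk mulgA mulgV mul1g.
  rewrite -E; suff -> : kk = 1%g by rewrite mulg1.
  apply: (uniq (g * k)%g) => //; first lra.
    rewrite /kk invgM mulgA -(mulgA k^-1%g); have [Kk _ _] := Krk; have [Kk' _ _] := Krk'.
    by apply: subgroupM => //; apply: subgroupM => //; exact: subgroupV.
  by rewrite E; move: zg zh; rewrite /z => -> ->.
have W1 : W 1%g by split; [exact: log_dom1|rewrite /lg log1 normr0].
have Wo : open W.
  rewrite openE => g [gd gs]; apply: filterI.
    by apply: open_nbhs_nbhs; split => //; exact: log_dom_open.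
  have : `|lg h| @[h --> g] --> `|lg g|.
    by apply: cvg_norm; exact: log_continuous.
  by move/cvgr_lt; apply.
exists W, kap; split => //.
- split => //; have [Kr1 z1] := kapP _ W1; rewrite -[LHS]mul1g -[RHS]mul1g.
  apply: slice => //; last by rewrite mulVg; exact: subgroup1.
    by split; [exact: subgroup1|exact: log_dom1|rewrite /lg log1 normr0 ltW].
  by rewrite /z mulg1 /lg log1 mul0mx.
- move=> g Wg; have [[Kk _ _] zk] := kapP g Wg; split => //.
  move=> V; rewrite nbhsE => -[V' [V'o V'k] V'V].
  have Acpt : compact (Kr `&` ~` V').
    by apply: compact_closedI => //; exact: open_closedC.
  have /compact_near_coveringP nc := Acpt.
  have : \forall h \near g, (Kr `&` ~` V') `<=` (fun k => z h k != 0).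
    apply: (nc _ (nbhs g) (fun h k => z h k != 0)) => k [Krk V'k'].
    have zk0 : z g k != 0.
      apply/eqP => zgk; apply: V'k'.
      have -> // : k = kap g.
      apply: (mulgI g); apply: slice => //; first by have [] := kapP g Wg.
      by rewrite mulVg; exact: subgroup1.
    have [gkd _] := prodd _ _ Wg Krk.
    have cc : {for (k, g), continuous (fun p : G * G => z p.2 p.1)}.
      apply: (@continuous_comp _ _ _ (fun p : G * G => (p.2, p.1)) (fun p => z p.1 p.2)).
        by apply: cvg_pair; [exact: cvg_snd|exact: cvg_fst].
      exact: cz.
    have nz : nbhs (z g k) [set v | v != 0].
      have z1 : 0 < `|z g k| by rewrite normr_gt0.
      apply/nbhs_ballP; exists `|z g k| => // v; rewrite -ball_normE /=.
      by apply: contraTN => /eqP ->; rewrite subr0 ltxx.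
    exact: (cc _ nz).
  move=> nz; change (\forall h \near g, V (kap h)).
  near=> h; apply: V'V; apply: contrapT => hV.
  have Wh : W h by near: h; apply: open_nbhs_nbhs.
  have [Krh zh] := kapP h Wh.
  have zn : (Kr `&` ~` V') `<=` (fun k => z h k != 0) by near: h.
  by have := zn _ (conj Krh hV); rewrite zh eqxx.
- move=> g h Wg Wh Kgh; have [? ?] := kapP _ Wg; have [? ?] := kapP _ Wh.
  exact: slice.
- move=> g [gd gs].
  have cs s : `|clamp s *: lg g| <= `|lg g|.
    have /andP[s0 s1] := clamp_itvP s.
    by rewrite normrZ ger0_norm // ler_piMl.
  exists (fun s => log_inv L (clamp s *: lg g)).
    move=> s; apply: (@continuous_comp _ _ _ (fun s => clamp s *: lg g) (log_inv L)).
      by apply: cvgZr_tmp; exact: continuous_clamp.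
    by apply: log_inv_continuous; have := cs s; lra.
  split.
  + by rewrite clamp_le0 // scale0r log_inv0.
  + by rewrite clamp_ge1 // scale1r logK.
  + move=> s _; have ss : `|clamp s *: lg g| < log_radius L by have := cs s; lra.
    split; first exact: log_inv_dom.
    by rewrite /lg log_invK //; apply: le_lt_trans (cs s) gs.
Unshelve. all: by end_near. Qed.

(** * Paths in coset spaces *)

Section Cosets.
Variables (R : realType) (G : topologicalGroupType).

Lemma coset_continuous (K : subgroup G) : continuous (coset K).
Proof. exact: pi_continuous. Qed.

Lemma cosetP (K : subgroup G) g h : coset K g = coset K h <-> subgroup_set K (g^-1 * h)%g.
Proof. exact: lcosetsP. Qed.

Lemma coset_repr (K : subgroup G) (q : coset_space K) : coset K (repr q) = q.
Proof. exact: reprK. Qed.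

Lemma mulgl_continuous (g : G) : continuous (fun x : G => (g * x)%g).
Proof.
apply: (@cts_comp _ _ _ (fun x : G => (g, x)) (fun p : G * G => (p.1 * p.2)%g)).
  by apply: cts_pair => x; [exact: cvg_cst|exact: cvg_id].
exact: mulg_continuous.
Qed.

Lemma mulgr_continuous (g : G) : continuous (fun x : G => (x * g)%g).
Proof.
apply: (@cts_comp _ _ _ (fun x : G => (x, g)) (fun p : G * G => (p.1 * p.2)%g)).
  by apply: cts_pair => x; [exact: cvg_id|exact: cvg_cst].
exact: mulg_continuous.
Qed.

Lemma nbhs_mulgl (g x : G) V : nbhs (g * x)%g V -> nbhs x [set y | V (g * y)%g].
Proof. exact: mulgl_continuous. Qed.

Lemma nbhs_mulgr (g x : G) V : nbhs (x * g)%g V -> nbhs x [set y | V (y * g)%g].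
Proof. exact: mulgr_continuous. Qed.

(** The saturation of an open set is a union of right translates, so the
    projection is open. *)
Lemma coset_nbhs (K : subgroup G) g (U : set G) :
  nbhs g U -> nbhs (coset K g) (coset K @` U).
Proof.
rewrite nbhsE => -[V [Vo Vg] VU].
apply: (@filterS _ _ _ (coset K @` V)) => [q [x Vx <-]|]; first by exists x => //; exact: VU.
apply: open_nbhs_nbhs; split; last by exists g.
change (open (coset K @^-1` (coset K @` V))).
rewrite openE => x [y Vy /cosetP Kyx].
have c : ((x * (x^-1 * y))%g : G) = y by rewrite mulgA mulgV mul1g.
have : nbhs (x * (x^-1 * y))%g V by rewrite c; exact: open_nbhs_nbhs.
move=> /nbhs_mulgr; apply: filterS => z Vz.
exists (z * (x^-1 * y))%g => //; apply/cosetP.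
by rewrite invgM mulgVK invgM invgK.
Qed.

Section PathLifting.
Variable K : subgroup G.
Variables (W : set G) (kap : G -> G).
Hypotheses (Wo : open W) (W1 : W 1%g).
Hypothesis kapP : forall g, W g -> subgroup_set K (kap g) /\ {for g, continuous kap}.
Hypothesis kap_inv : forall g h, W g -> W h -> subgroup_set K (g^-1 * h)%g ->
  (g * kap g)%g = (h * kap h)%g.

(** The slice gives local sections of the projection of [G] onto [G/K]. *)
Lemma local_section g : exists (sec : coset_space K -> G) (O : set (coset_space K)),
  nbhs (coset K g) O /\
  forall q, O q -> coset K (sec q) = q /\ {for q, continuous sec}.
Proof.
pose O := coset K @` [set (g * w)%g | w in W].
pose sel q := if pselect (exists2 w, W w & coset K (g * w)%g = q) is left h
  then sval (cid2 h) else 1%g.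
have selP w : W w -> W (sel (coset K (g * w)%g)) /\
    coset K (g * sel (coset K (g * w)%g))%g = coset K (g * w)%g.
  move=> Ww; rewrite /sel; case: pselect => [h|]; last by case; exists w.
  by have := s2valP (cid2 h); have := s2valP' (cid2 h).
pose sec q := (g * (sel q * kap (sel q)))%g.
have secE w : W w -> sec (coset K (g * w)%g) = (g * (w * kap w))%g.
  move=> Ww; have [Wv /cosetP Kv] := selP w Ww; rewrite /sec.
  congr (g * _)%g; apply: kap_inv => //.
  by move: Kv; rewrite invgM -mulgA mulKg.
exists sec, O; split.
  rewrite /O; apply: coset_nbhs.
  have : nbhs (g^-1 * g)%g W by rewrite mulVg; exact: open_nbhs_nbhs.
  move=> /nbhs_mulgl; apply: filterS => x Wx.
  by exists (g^-1 * x)%g => //; rewrite mulgA mulgV mul1g.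
move=> q [_ [w Ww <-] <-]; split.
  rewrite secE //; apply/cosetP; rewrite invgM -mulgA mulKg invgM mulgVK.
  by have [Kw _] := kapP Ww; exact: subgroupV.
move=> V; rewrite /= secE // => Vs.
pose t x := (g * (g^-1 * x * kap (g^-1 * x)))%g.
have ct : {for (g * w)%g, continuous t}.
  have e : (g^-1 * (g * w))%g = w by rewrite mulKg.
  have c1 : {for (g * w)%g, continuous (fun x => kap (g^-1 * x)%g)}.
    apply: (@continuous_comp _ _ _ (fun x => g^-1 * x)%g kap); first exact: mulgl_continuous.
    by rewrite e; have [] := kapP Ww.
  apply: (@continuous_comp _ _ _ (fun x => (g^-1 * x * kap (g^-1 * x))%g) (fun y => g * y)%g);
    last exact: mulgl_continuous.
  apply: (@continuous_comp _ _ _ (fun x => (g^-1 * x, kap (g^-1 * x))%g)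
    (fun p : G * G => (p.1 * p.2)%g)); last exact: mulg_continuous.
  have c0 : {for (g * w)%g, continuous (fun x => g^-1 * x)%g} by exact: mulgl_continuous.
  exact: (cvg_pair c0 c1).
have nV : nbhs (g * w)%g (t @^-1` V) by apply: ct; rewrite /t mulKg.
have nW : nbhs (g * w)%g [set x | W (g^-1 * x)%g].
  by apply: nbhs_mulgl; rewrite mulKg; exact: open_nbhs_nbhs.
apply: (@filterS _ _ _ (coset K @` [set x | V (t x) /\ W (g^-1 * x)%g])); last first.
  by apply: coset_nbhs; exact: filterI nV nW.
move=> _ [x [Vx Wx] <-] /=.
have -> : x = (g * (g^-1 * x))%g by rewrite mulgA mulgV mul1g.
by rewrite secE.
Qed.

Lemma path_lifting (u : R -> coset_space K) g : continuous u -> coset K g = u 0 ->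
  exists v : R -> G, [/\ continuous v, v 0 = g &
    forall s, 0 <= s <= 1 -> coset K (v s) = u s].
Proof.
move=> cu gu.
pose Q (s t : R) := forall g, coset K g = u s -> exists v : R -> G,
  [/\ continuous v, v s = g & forall r, s <= r <= t -> coset K (v r) = u r].
suff : Q 0 1 by move=> /(_ g gu).
apply: interval_induction => // [t ti|r s t r0 rs st t1 Q1 Q2 h hr].
- have [sec [U [nU secP]]] := local_section (repr (u t)).
  rewrite coset_repr in nU.
  have /nbhs_ballP[e /= e0 eU] := cu t _ nU.
  exists e => // s s' s0 st ts' s1 se se' h hs.
  pose k := ((sec (u s))^-1 * h)%g.
  have ss' : s <= s' by lra.
  have Uu r : s <= r <= s' -> U (u r).
    by move=> ri; apply: eU; rewrite /ball /= ltr_norml; lra.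
  have Us : U (u s) by apply: Uu; rewrite lexx.
  exists (fun r => sec (u (cut s s' r)) * k)%g; split.
  + have c1 : continuous (fun r => sec (u (cut s s' r))).
      apply: (@continuous_at_cut _ _ (fun r => sec (u r))) => // r ri.
      apply: (@continuous_comp _ _ _ u sec); first exact: cu.
      by have [] := secP _ (Uu r ri).
    exact: (cts_comp c1 (@mulgr_continuous k)).
  + by rewrite cut_id ?lexx // /k mulgA mulgV mul1g.
  + move=> r ri; rewrite cut_id //; have [e1 _] := secP _ (Uu r ri).
    rewrite -[RHS]e1; apply/cosetP; rewrite invgM mulgVK.
    apply: subgroupV; apply/cosetP.
    by have [-> _] := secP _ Us.
- have [v1 [cv1 v1r v1u]] := Q1 h hr.
  have [|v2 [cv2 v2s v2u]] := Q2 (v1 s); first by apply: v1u; rewrite rs lexx.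
  exists (fun x => if x <= s then v1 x else v2 x); split.
  + apply: (@continuous_glue _ _ _ id) => // [x|x ->]; first exact: cvg_id.
    by rewrite v2s.
  + by rewrite rs.
  + move=> x xi; case: leP => xs; [apply: v1u|apply: v2u]; lra.
Qed.

End PathLifting.

Section Translation.
Local Open Scope quotient_scope.
Variable H : subgroup G.

Definition translate (g : G) (q : coset_space H) : coset_space H :=
  coset H (g * repr q)%g.

Lemma translateE g x : translate g (coset H x) = coset H (g * x)%g.
Proof.
apply/cosetP; rewrite invgM -mulgA mulKg; apply/cosetP; exact: coset_repr.
Qed.

Lemma translate_continuous g : continuous (translate g).
Proof.
apply/quotient_continuous.
have -> : translate g \o \pi_(coset_space H) = fun x => coset H (g * x)%g.
  by apply/funext => x; exact: translateE.
exact: (cts_comp (@mulgl_continuous g) (@coset_continuous H)).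
Qed.

End Translation.

End Cosets.

Lemma le1_half (R : realType) : (1 <= 2^-1 :> R) = false.
Proof. by apply/negP => ?; lra. Qed.

Lemma le0_half (R : realType) : 0 <= 2^-1 :> R.
Proof. by lra. Qed.

Lemma double_pred1 (R : realType) : 2 * 1 - 1 = 1 :> R.
Proof. by ring. Qed.

Lemma ge1_double (R : realType) (s : R) : 2^-1 < s -> 1 <= 2 * s - 0.
Proof. by move=> ?; lra. Qed.

Section Joined.
Variables (R : realType) (T : topologicalType).

Definition joined_in (S : set T) (x y : T) := exists c : R -> T,
  [/\ continuous c, c 0 = x, c 1 = y & forall s, S (c s)].

Lemma joined_in_refl (S : set T) x : S x -> joined_in S x x.
Proof. by move=> Sx; exists (cst x); split => // s; exact: cvg_cst. Qed.

Lemma joined_in_sym (S : set T) x y : joined_in S x y -> joined_in S y x.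
Proof.
move=> [c [cc c0 c1 cS]]; exists (fun s => c (1 - s)); split => //.
- apply: (@cts_comp _ _ _ (fun s : R => 1 - s) c) => // s.
  by apply: cvgB; [exact: cvg_cst|exact: cvg_id].
- by rewrite subr0.
- by rewrite subrr.
Qed.

Lemma joined_in_trans (S : set T) x y z :
  joined_in S x y -> joined_in S y z -> joined_in S x z.
Proof.
move=> [c [cc c0 c1 cS]] [d [cd d0 d1 dS]].
have c2 (k : R) : continuous (fun s : R => 2 * s - k).
  move=> s; apply: cvgB; last exact: cvg_cst.
  by apply: cvgM; [exact: cvg_cst|exact: cvg_id].
exists (fun s => if s <= 2^-1 then c (2 * s - 0) else d (2 * s - 1)); split.
- apply: (@continuous_glue _ _ _ id) => [s||| s ->]; first exact: cvg_id.
  + exact: (cts_comp (c2 0) cc).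
  + exact: (cts_comp (c2 1) cd).
  + by rewrite subr0 mulfV // subrr c1 d0.
- by rewrite le0_half mulr0 subr0.
- by rewrite le1_half double_pred1.
- by move=> s; case: ifP.
Qed.

End Joined.

Section OrbitProjectionLift.
Variables (R : realType) (G : topologicalGroupType) (H K : subgroup G).
Variable HK : H `<=` K.
Hypotheses (Glie : lie_group R G) (Kcl : closed (K : set G)).
Hypothesis KH_connected : connected (coset_image H K).

(** [K/H] is connected and locally path connected, hence path connected; small
    elements of [K] are joined to the identity by retracting a path of [G]
    onto [K]. *)
Lemma coset_image_joined k : subgroup_set K k ->
  joined_in R (coset_image H K) (coset H 1%g) (coset H k).
Proof.
have [W [kap [Wo [W1 kap1] kapP kap_inv Wpath]]] := closed_subgroup_slice Glie Kcl.
have near k0 w : subgroup_set K k0 -> W w -> subgroup_set K w ->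
    joined_in R (coset_image H K) (coset H k0) (coset H (k0 * w)%g).
  move=> Kk0 Ww Kw; have [c cc [c0 c1 cW]] := Wpath w Ww.
  have kw : (kap w)^-1%g = w.
    have : (1 * kap 1 = w * kap w)%g.
      by apply: kap_inv => //; rewrite invg1 mul1g.
    by rewrite kap1 mul1g => e; apply: (mulIg (kap w)); rewrite mulVg.
  exists (fun s => coset H (k0 * (kap (c (cut 0 1 s)))^-1)%g); split.
  - apply: (@cts_comp _ _ _ (fun s => k0 * (kap (c (cut 0 1 s)))^-1)%g); last exact: coset_continuous.
    apply: (@cts_comp _ _ _ (fun s => (kap (c (cut 0 1 s)))^-1)%g); last exact: mulgl_continuous.
    apply: (@cts_comp _ _ _ (fun s => kap (c (cut 0 1 s)))); last exact: invg_continuous.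
    apply: (@continuous_at_cut _ _ (fun s => kap (c s))) => // s si.
    apply: (@continuous_comp _ _ _ c kap); first exact: cc.
    by have [] := kapP _ (cW s si).
  - by rewrite cut_id ?lexx ?ler01 // c0 kap1 invg1 mulg1.
  - by rewrite cut_id ?lexx ?ler01 // c1 kw.
  - move=> s; exists (k0 * (kap (c (cut 0 1 s)))^-1)%g => //.
    apply: subgroupM => //; apply: subgroupV.
    by have [] := kapP _ (cW _ (cut_itv s ler01)).
pose reach q := joined_in R (coset_image H K) (coset H 1%g) q.
(* The cosets near [Q]; being open, they show that the set of reachable cosets
   and its complement are both open in [K/H]. *)
pose sat (Q : set (coset_space H)) := [set q | exists k0 w,
  [/\ subgroup_set K k0, Q (coset H k0), W w & q = coset H (k0 * w)%g]].
have sat_open Q : open (sat Q).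
  rewrite openE => q [k0 [w [Kk0 Qk0 Ww ->]]].
  apply: (@filterS _ _ _ (coset H @` [set x | W (k0^-1 * x)%g])).
    move=> _ [x Wx <-]; exists k0, (k0^-1 * x)%g; split => //.
    by rewrite mulgA mulgV mul1g.
  apply: coset_nbhs; apply: nbhs_mulgl; rewrite mulKg.
  exact: open_nbhs_nbhs.
have satP (Q : set (coset_space H)) :
    (forall k0 w, subgroup_set K k0 -> W w -> subgroup_set K w ->
      Q (coset H k0) -> Q (coset H (k0 * w)%g)) ->
    coset_image H K `&` Q = coset_image H K `&` sat Q.
  move=> QW; apply/seteqP; split => q [[k1 Kk1 <-] qQ]; split; try by exists k1.
    by exists k1, 1%g; rewrite mulg1.
  move: qQ => [k0 [w [Kk0 Qk0 Ww e]]]; rewrite e; apply: QW => //.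
  move/cosetP : e => /HK Ke.
  have -> : w = (k0^-1 * k1 * (k1^-1 * (k0 * w)))%g by rewrite -mulgA mulVKg mulKg.
  by apply: subgroupM => //; apply: subgroupM => //; exact: subgroupV.
move=> Kk; have : coset_image H K `&` reach = coset_image H K.
  apply: KH_connected.
  - exists (coset H 1%g); split; first by exists 1%g => //; exact: subgroup1.
    by apply: joined_in_refl; exists 1%g => //; exact: subgroup1.
  - exists (sat reach); first exact: sat_open.
    apply: satP => k0 w Kk0 Ww Kw r0; apply: joined_in_trans r0 _; exact: near.
  - exists (~` sat (~` reach)); first exact/open_closedC/sat_open.
    have : coset_image H K `&` ~` reach = coset_image H K `&` sat (~` reach).
      apply: satP => k0 w Kk0 Ww Kw r0 r1; apply: r0; apply: joined_in_trans r1 _.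
      by apply: joined_in_sym; exact: near.
    move=> /seteqP[s1 s2]; apply/seteqP; split => q [iq rq]; split => //.
      by move=> sq; have [] := s2 q (conj iq sq).
    by apply: contrapT => nr; apply: rq; have [] := s1 q (conj iq nr).
by move=> /seteqP[_ /(_ (coset H k))] [|_]//; exists k.
Qed.

(** Since the fibre [K/H] is path connected, a path of [G/K] lifts to [G/H]
    with both ends prescribed, up to reparametrization. *)
Lemma orbit_projection_lift (u : R -> coset_space K) (b b' : coset_space H) :
  continuous u -> orbit_projection HK b = u 0 -> orbit_projection HK b' = u 1 ->
  exists (v : R -> coset_space H) (phi : R -> R),
    [/\ continuous v, continuous phi, v 0 = b /\ v 1 = b', phi 0 = 0 /\ phi 1 = 1
      & forall s, orbit_projection HK (v s) = u (phi s)].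
Proof.
move=> cu b0 b1.
have [W [kap [Wo [W1 _] kapP kap_inv _]]] := closed_subgroup_slice Glie Kcl.
have e0 : coset K (repr b) = u 0 by rewrite -b0 -{2}(coset_repr b) orbit_projectionE.
have [v [cv v0 vu]] := path_lifting Wo W1 kapP kap_inv cu e0.
have v1 : coset K (v 1) = u 1 by apply: vu; rewrite lexx ler01.
have : coset K (v 1) = coset K (repr b').
  by rewrite v1 -b1 -{1}(coset_repr b') orbit_projectionE.
move=> /cosetP /coset_image_joined [c [cc c0 c1 cK]].
have c2 (k : R) : continuous (fun s : R => 2 * s - k).
  move=> s; apply: cvgB; last exact: cvg_cst.
  by apply: cvgM; [exact: cvg_cst|exact: cvg_id].
have cphi : continuous (fun s : R => clamp (2 * s - 0)).
  exact: (cts_comp (c2 0) (@continuous_clamp R)).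
(* First the lift of [u], then a path in the fibre over [u 1]. *)
exists (fun s => if s <= 2^-1 then coset H (v (clamp (2 * s - 0)))
  else translate (v 1) (c (2 * s - 1))), (fun s => clamp (2 * s - 0)); split => //.
- apply: (@continuous_glue _ _ _ id) => [s||| s ->]; first exact: cvg_id.
  + exact: (cts_comp (cts_comp cphi cv) (@coset_continuous _ H)).
  + exact: (cts_comp (cts_comp (c2 1) cc) (@translate_continuous _ H (v 1))).
  + by rewrite subr0 mulfV // subrr clamp_ge1 // c0 translateE mulg1.
- split.
    by rewrite le0_half mulr0 subr0 clamp_le0 // v0 coset_repr.
  by rewrite le1_half double_pred1 c1 translateE mulgA mulgV mul1g coset_repr.
- by rewrite mulr0 subr0 clamp_le0 // clamp_ge1 // mulr1 subr0 ler1n.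
- move=> s; case: leP => s2.
    by rewrite orbit_projectionE vu //; exact: clamp_itvP.
  have [k Kk <-] := cK (2 * s - 1).
  have c1' : clamp (2 * s - 0) = 1 by rewrite clamp_ge1 // ge1_double.
  rewrite translateE orbit_projectionE c1'.
  rewrite -v1; apply/cosetP; rewrite invgM mulgVK; exact: subgroupV.
Qed.

End OrbitProjectionLift.

(** * The space as a double mapping cylinder *)

(** Out of a compact space, a map onto a Hausdorff space is closed, so
    continuity at a point can be tested on its fibre. *)
Lemma continuous_closed_map (Z X Y : topologicalType) (Phi : Z -> X) (C : set Z)
    (psi : X -> Y) (x : X) : hausdorff_space X -> compact C -> continuous Phi ->
  (forall y, exists2 z, C z & Phi z = y) ->
  (forall z, C z -> Phi z = x -> {for z, continuous (psi \o Phi)}) ->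
  {for x, continuous psi}.
Proof.
move=> hX cC cPhi onto cpsi V Vx.
pose U := (psi \o Phi) @^-1` V.
have cA : compact (C `&` ~` interior U).
  by apply: compact_closedI => //; apply: open_closedC; exact: open_interior.
have clA : closed (Phi @` (C `&` ~` interior U)).
  apply: compact_closed => //; apply: continuous_compact => //.
  exact: continuous_subspaceT.
have : nbhs x (~` (Phi @` (C `&` ~` interior U))).
  apply: open_nbhs_nbhs; split; first exact: closed_openC.
  move=> [z [Cz nU] zx]; apply: nU; apply: (cpsi z Cz zx).
  by rewrite /= zx.
apply: filterS => y ny; have [z Cz zy] := onto y.
rewrite /= -zy; suff : interior U z by exact: interior_subset.
by apply: contrapT => nz; apply: ny; exists z.
Qed.

Section OrbitGeometry.
Variables (R : realType) (X : completeMetricType R) (G : topologicalGroupType).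
Hypothesis G_compact : compact [set: G].
Variables (a : isometric_action X G) (f : orbit_space a -> R).
Hypothesis f_isometry : isometry_onto_interval f.
Variable T : associated_tuple f.

Let F (x : X) : R := f (orbit_class a x).
Let gam (t : R) : X := tuple_geodesic T (to_unit t).

Lemma act_continuous_l x : continuous (fun g : G => a g x).
Proof.
apply: (@cts_comp _ _ _ (fun g : G => (g, x)) (fun p : G * X => a p.1 p.2)).
  by apply: cts_pair => g; [exact: cvg_id|exact: cvg_cst].
exact: act_continuous.
Qed.

Lemma orbit_repr x : Defs.orbit a (repr (orbit_class a x)) = Defs.orbit a x.
Proof.
have : orbit_rel a (repr (orbit_class a x)) x by apply/eqmodP; rewrite reprK.
move: (repr _) => r /asboolP[g _ <-].
apply/seteqP; split => y [h _ <-].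
  by exists (h * g^-1)%g => //; rewrite actM -(actM a g^-1%g) mulVg act1.
by exists (h * g)%g => //; rewrite actM.
Qed.

Lemma dist_orbits x y : `|F x - F y| = set_dist (Defs.orbit a x) (Defs.orbit a y).
Proof. by rewrite /F f_isometry.1 /orbit_dist !orbit_repr. Qed.

Lemma dist_orbits_le x y : `|F x - F y| <= mdist x y.
Proof.
rewrite dist_orbits; apply: ge_inf.
  by exists 0 => _ [u _ [v _ <-]]; exact: mdist_ge0.
by exists x; [exists 1%g => //; rewrite act1|exists y => //; exists 1%g; rewrite ?act1].
Qed.

(** Orbits are compact, so distinct orbits have positive distance. *)
Lemma same_orbit x y : F x = F y -> exists g, a g x = y.
Proof.
move=> Fxy; have := dist_orbits x y; rewrite Fxy subrr normr0 => /esym d0.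
have [||g _ gmin] := @compact_EVT_min G R (fun g => mdist (a g x) y) setT _ G_compact.
- by exists 1%g.
- apply: continuous_subspaceT => g; apply/cvgrPdist_lt => e e0.
  have : nbhs g [set h | ball (a g x) e (a h x)].
    exact: (@act_continuous_l x g _ (nbhsx_ballx (a g x) e e0)).
  apply: filterS => h; rewrite ballEmdist /= => gh.
  apply: le_lt_trans gh; rewrite ler_norml; apply/andP; split.
    have := metric_triangle (a h x) (a g x) y.
    by rewrite (metric_sym (a h x) (a g x)); lra.
  by have := metric_triangle (a g x) (a h x) y; lra.
exists g; apply: (@mdist_positivity R X); apply/eqP; rewrite eq_le mdist_ge0 andbT.
rewrite -d0; apply: lb_le_inf.
  by exists (mdist x y), x; [exists 1%g => //; rewrite act1|exists y => //; exists 1%g; rewrite ?act1].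
move=> _ [_ [h _ <-] [_ [k _ <-] <-]].
rewrite -[leRHS](act_isometry a k^-1%g) -!actM mulVg act1.
by apply: gmin; rewrite inE.
Qed.

Lemma F_itv x : -1 <= F x <= 1.
Proof.
have : range f (F x) by exists (orbit_class a x).
by rewrite f_isometry.2 /= in_itv.
Qed.

Let tau (x : X) : R := (F x + 1) / 2.

Lemma tau_itv x : 0 <= tau x <= 1.
Proof. by have := F_itv x; rewrite /tau; lra. Qed.

(** The points over an end of the interval form a single orbit, so the
    geodesic realizes the distance of two points of the orbit space. *)
Lemma geodesic_length : mdist (tuple_geodesic T zero) (tuple_geodesic T one) = 2.
Proof.
have F0 : F (tuple_geodesic T zero) = -1 := tuple_start T.
have F1 : F (tuple_geodesic T one) = 1 := tuple_end T.
have E r y : F y = r -> orbit_over f r = Defs.orbit a y.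
  move=> Fy; apply/seteqP; split => x.
    move=> xr; have [|g <-] := @same_orbit y x; first by rewrite Fy.
    by exists g.
  move=> [g _ <-]; rewrite -Fy /orbit_over /= /F; congr f.
  apply/eqmodP/asboolP; exists g^-1%g => //.
  by rewrite -actM mulVg act1.
rewrite (tuple_dist T) (E _ _ F0) (E _ _ F1) -dist_orbits F0 F1.
by rewrite distrC opprK ger0_norm //; lra.
Qed.

Lemma gam_dist s t : mdist (gam s) (gam t) = 2 * `|clamp s - clamp t|.
Proof. by rewrite /gam geodesicP geodesic_length mulrC. Qed.

Lemma clamp_lipschitz (s t : R) : `|clamp s - clamp t| <= `|s - t|.
Proof.
have cP (x : R) : [\/ x <= 0 /\ clamp x = 0, 0 <= x <= 1 /\ clamp x = x
    | 1 <= x /\ clamp x = 1].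
  have [x0|x0] := leP x 0; first by constructor 1; rewrite clamp_le0.
  have [x1|x1] := leP x 1; last by constructor 3; rewrite clamp_ge1 // ltW.
  by constructor 2; rewrite clamp_id ltW.
rewrite ler_norml.
have [st|st] := leP s t.
  have -> : `|s - t| = t - s by rewrite ler0_norm; lra.
  by case: (cP s) (cP t) => [[? ->]|[? ->]|[? ->]] [[? ->]|[? ->]|[? ->]]; lra.
have -> : `|s - t| = s - t by rewrite ger0_norm; lra.
by case: (cP s) (cP t) => [[? ->]|[? ->]|[? ->]] [[? ->]|[? ->]|[? ->]]; lra.
Qed.

(** [F] does not increase distances and separates the ends of the geodesic as
    much as possible, so it is affine along the geodesic. *)
Lemma F_gam t : 0 <= t <= 1 -> F (gam t) = 2 * t - 1.
Proof.
move=> t01.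
have F0 : F (gam 0) = -1 := tuple_start T.
have F1 : F (gam 1) = 1 := tuple_end T.
have := dist_orbits_le (gam t) (gam 0); have := dist_orbits_le (gam 1) (gam t).
rewrite !gam_dist F0 F1 (clamp_id t01) (clamp_le0 (lexx 0)) (clamp_ge1 (lexx 1)).
by rewrite !ler_norml subr0 !ger0_norm; lra.
Qed.

Lemma F_act g x : F (a g x) = F x.
Proof.
rewrite /F; congr f; apply/eqmodP/asboolP; exists g^-1%g => //.
by rewrite -actM mulVg act1.
Qed.

Lemma tau_act_gam g t : tau (a g (gam t)) = clamp t.
Proof.
have -> : gam t = gam (clamp t) by rewrite /gam; congr (tuple_geodesic T _);
  apply: val_inj; rewrite /= (clamp_id (clamp_itvP t)).
by rewrite /tau F_act F_gam ?clamp_itvP //; lra.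
Qed.

Lemma slice_onto x : exists g, a g (gam (tau x)) = x.
Proof.
apply: same_orbit; rewrite F_gam; last exact: tau_itv.
by rewrite /tau; lra.
Qed.

Definition slice_rep (x : X) : G := sval (cid (slice_onto x)).

Lemma slice_repE x : a (slice_rep x) (gam (tau x)) = x.
Proof. exact: (svalP (cid (slice_onto x))). Qed.

Let H := tuple_H T.
Definition end_isotropy (j : bool) : subgroup G :=
  if j then tuple_Kplus T else tuple_Kminus T.
Let K := end_isotropy.
Let en (j : bool) : R := j%:R.

(** A transparent term, so that [rho_end] computes to the projections
    [rho_plus] and [rho_minus]. *)
Definition tuple_H_end j : (H : set G) `<=` K j :=
  match j with true => @tuple_H_Kplus _ _ _ _ _ T
             | false => @tuple_H_Kminus _ _ _ _ _ T end.

Definition rho_end (j : bool) : coset_space H -> coset_space (K j) :=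
  orbit_projection (@tuple_H_end j).
HB.instance Definition _ j := Continuous.on (rho_end j).

Lemma isotropy_inner t g : 0 < t < 1 -> (a g (gam t) = gam t <-> subgroup_set H g).
Proof.
move=> t01; have := @tuple_isotropy _ _ _ _ _ T (to_unit t).
rewrite to_unitK; last lra.
by move=> /(_ t01) /seteqP[h1 h2]; split; [exact: h1|exact: h2].
Qed.

Lemma isotropy_end j g : a g (gam (en j)) = gam (en j) <-> subgroup_set (K j) g.
Proof. by case: j. Qed.

Lemma isotropy_all t g : subgroup_set H g -> a g (gam t) = gam t.
Proof.
move=> Hg; have [t0|t0] := leP t 0.
  have -> : gam t = gam (en false).
    by rewrite /gam; congr (tuple_geodesic T _); apply: val_inj => /=; rewrite !clamp_le0.
  by apply/isotropy_end; exact: tuple_H_end.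
have [t1|t1] := ltP t 1; first by apply/isotropy_inner => //; rewrite t0.
have -> : gam t = gam (en true).
  by rewrite /gam; congr (tuple_geodesic T _); apply: val_inj => /=; rewrite !clamp_ge1.
by apply/isotropy_end; exact: tuple_H_end.
Qed.

(** The point at time [t] on the translate of the geodesic by a representative
    of [b]; as [H] fixes the whole geodesic, the representative is immaterial. *)
Definition cylinder (b : coset_space H) (t : R) : X := a (repr b) (gam t).

Lemma cylinder_coset g t : cylinder (coset H g) t = a g (gam t).
Proof.
rewrite /cylinder; set r := repr _.
have /cosetP Hr : coset H r = coset H g by exact: coset_repr.
by rewrite -{1}(isotropy_all t Hr) -actM mulVKg.
Qed.

Lemma cylinder_lipschitz b s t : mdist (cylinder b s) (cylinder b t) <= 2 * `|s - t|.
Proof.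
rewrite /cylinder act_isometry gam_dist ler_wpM2l //; exact: clamp_lipschitz.
Qed.

Lemma cylinder_continuous : continuous (fun P : coset_space H * R => cylinder P.1 P.2).
Proof.
move=> [b0 t0].
have cb : continuous (fun b => cylinder b t0).
  apply/quotient_continuous.
  have -> : (fun b => cylinder b t0) \o \pi_(coset_space H)%qT = fun g => a g (gam t0).
    by apply/funext => g; exact: cylinder_coset.
  exact: act_continuous_l.
move=> V /nbhs_ballP[e /= e0 eV].
have e20 : 0 < e / 2 by lra.
have e40 : 0 < e / 4 by lra.
exists ((fun b => cylinder b t0) @^-1` ball (cylinder b0 t0) (e / 2), ball t0 (e / 4)).
  by split; [apply: cb; exact: nbhsx_ballx|exact: nbhsx_ballx].
move=> [b t] [/= bb bt]; apply: eV; rewrite ballEmdist /=.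
apply: le_lt_trans (metric_triangle _ (cylinder b t0) _) _.
move: bb bt; rewrite ballEmdist /= /ball /= => bb bt.
by have := cylinder_lipschitz b t0 t; lra.
Qed.

(** Over the ends of the interval this is an arbitrary point of the fibre. *)
Definition cylinder_base (x : X) : coset_space H := coset H (slice_rep x).

Lemma cylinder_baseK x : cylinder (cylinder_base x) (tau x) = x.
Proof. by rewrite cylinder_coset slice_repE. Qed.

Lemma cylinder_base_act g t : 0 < t < 1 -> cylinder_base (a g (gam t)) = coset H g.
Proof.
move=> t01; apply/cosetP; apply/(isotropy_inner _ t01).
rewrite actM; set x := a g (gam t).
have := slice_repE x; rewrite tau_act_gam clamp_id; last lra.
by move=> {2}<-; rewrite -actM mulVg act1.
Qed.

Lemma rho_base_act j g t : clamp t != en (~~ j) ->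
  rho_end j (cylinder_base (a g (gam t))) = coset (K j) g.
Proof.
have tE : gam t = gam (clamp t) by rewrite /gam; congr (tuple_geodesic T _);
  apply: val_inj; rewrite /= (clamp_id (clamp_itvP t)).
have [tj _|tj tj'] := eqVneq (clamp t) (en j).
  rewrite /rho_end orbit_projectionE; apply/cosetP; apply/isotropy_end.
  rewrite actM; set x := a g (gam t).
  have := slice_repE x; rewrite tau_act_gam tj => e.
  rewrite -[X in a g (gam X)]tj -tE -/x.
  by apply: (etrans (congr1 (a (slice_rep x)^-1%g) (esym e))); rewrite -actM mulVg act1.
have t01 : 0 < clamp t < 1.
  have /andP[c0 c1] := clamp_itvP t; rewrite !lt_neqAle c0 c1 !andbT eq_sym.
  by move: tj tj'; rewrite /en; case: (j); rewrite /= ?mulr1n ?mulr0n => -> ->.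
by rewrite tE cylinder_base_act // /rho_end orbit_projectionE.
Qed.

Definition end_orbit j (q : coset_space (K j)) : X := a (repr q) (gam (en j)).

Lemma end_orbitE j b : end_orbit (rho_end j b) = cylinder b (en j).
Proof.
rewrite -(coset_repr b) cylinder_coset /rho_end orbit_projectionE /end_orbit.
set r := repr _; set g := repr b.
have /cosetP Kr : coset (K j) r = coset (K j) g by exact: coset_repr.
by move/isotropy_end : Kr => Kr; rewrite -{1}Kr -actM mulVKg.
Qed.

Lemma end_orbit_continuous j : continuous (@end_orbit j).
Proof.
apply/quotient_continuous.
have -> : @end_orbit j \o \pi_(coset_space (K j))%qT = fun g => a g (gam (en j)).
  apply/funext => g; have := end_orbitE j (coset H g).
  by rewrite cylinder_coset /rho_end orbit_projectionE.
exact: act_continuous_l.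
Qed.

HB.instance Definition _ j :=
  isContinuous.Build _ _ (@end_orbit j) (@end_orbit_continuous j).

Lemma tau_continuous : continuous tau.
Proof.
move=> x; apply/cvgrPdist_lt => e e0.
apply: filterS (nbhsx_ballx x e e0) => y; rewrite ballEmdist /= => xy.
apply: le_lt_trans xy; apply: le_trans (dist_orbits_le x y).
have -> : tau x - tau y = (F x - F y) / 2 by rewrite /tau; ring.
by rewrite normrM [X in _ * X]ger0_norm //; have := normr_ge0 (F x - F y); lra.
Qed.

Let Phi (P : G * R) : X := a P.1 (gam P.2).

Let Phi_continuous : continuous Phi.
Proof.
have -> : Phi = fun P => cylinder (coset H P.1) P.2.
  by apply/funext => P; rewrite cylinder_coset.
apply: (@cts_comp _ _ _ (fun P : G * R => (coset H P.1, P.2)) (fun P => cylinder P.1 P.2)).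
  apply: cts_pair; last exact: cts_snd.
  exact: (cts_comp (@cts_fst _ _) (@coset_continuous _ H)).
exact: cylinder_continuous.
Qed.

(** The continuity test on fibres for the map from [G] times the interval. *)
Let Phi_test (Y : topologicalType) (psi : X -> Y) (x : X) (h : G * R -> Y) (S : set R) :
  open S -> S (tau x) -> continuous h ->
  (forall g t, S (clamp t) -> psi (Phi (g, t)) = h (g, t)) -> {for x, continuous psi}.
Proof.
move=> So Sx ch hE.
apply: (@continuous_closed_map _ _ _ Phi ([set: G] `*` `[0, 1]%classic)).
- exact: metric_hausdorff.
- by apply: compact_setX => //; exact: segment_compact.
- exact: Phi_continuous.
- move=> y; exists (slice_rep y, tau y); last exact: slice_repE.
  by split => //=; rewrite in_itv /= tau_itv.
- move=> [g t] [_ /=]; rewrite in_itv /= => t01 e V.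
  have tE : clamp t = tau x by rewrite -e /Phi tau_act_gam.
  have nS : nbhs (g, t) [set P : G * R | S (clamp P.2)].
    have c2 : continuous (fun P : G * R => clamp P.2).
      exact: (cts_comp (@cts_snd _ _) (@continuous_clamp R)).
    have nt : nbhs (clamp t) S by apply: open_nbhs_nbhs; split => //; rewrite tE.
    exact: (c2 (g, t) S nt).
  rewrite /= hE ?tE // => Vh.
  apply: (@filterS _ _ _ (fun P => S (clamp P.2) /\ V (h P))); last exact: (filterI nS (ch _ _ Vh)).
  by move=> [g' t'] [/= St Vt]; rewrite /= hE.
Qed.

Lemma rho_base_continuous j x : tau x != en (~~ j) ->
  {for x, continuous (fun x => rho_end j (cylinder_base x))}.
Proof.
move=> xj; apply: (@Phi_test _ _ x (fun P => coset (K j) P.1) [set t | t != en (~~ j)]) => //.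
- exact: (cts_comp (@cts_fst _ _) (@coset_continuous _ (K j))).
- by move=> g t tj; exact: rho_base_act.
Qed.

Lemma base_continuous x : tau x != 0 -> tau x != 1 ->
  {for x, continuous cylinder_base}.
Proof.
move=> x0 x1; apply: (@Phi_test _ _ x (fun P => coset H P.1) `]0, 1[%classic) => //.
- by rewrite /= in_itv /= !lt_neqAle eq_sym x0 x1; have := tau_itv x.
- exact: (cts_comp (@cts_fst _ _) (@coset_continuous _ H)).
- move=> g t; rewrite /= in_itv /= => t01.
  rewrite /Phi /= -(cylinder_base_act g t01).
  by rewrite /gam; congr (cylinder_base (a g (tuple_geodesic T _)));
    apply: val_inj; rewrite /= (clamp_id (clamp_itvP t)).
Qed.

End OrbitGeometry.

(** * The fundamental group of a double mapping cylinder *)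

(** [E] is the cylinder line through a point of [B]; [tau] and [p] are the
    coordinates of a point of [X], the second one being arbitrary in its fibre
    over the ends; [phi j] maps [Y j] onto the end orbit. *)
Section MappingCylinder.
Variables (R : realType) (X : metricType R) (B : topologicalType).
Variables (Y : bool -> topologicalType) (rho : forall j, continuousType B (Y j)).
Variables (E : B -> R -> X) (tau : X -> R) (p : X -> B).
Variable phi : forall j, continuousType (Y j) X.
Local Notation en j := ((j : bool)%:R : R).
Local Notation I := (unit_interval R).
Hypothesis E_continuous : continuous (fun P : B * R => E P.1 P.2).
Hypothesis E_lipschitz : forall b s t, mdist (E b s) (E b t) <= 2 * `|s - t|.
Hypothesis tau_continuous : continuous tau.
Hypothesis tauE : forall b t, 0 <= t <= 1 -> tau (E b t) = t.
Hypothesis pE : forall b t, 0 < t < 1 -> p (E b t) = b.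
Hypothesis EK : forall x, E (p x) (tau x) = x.
Hypothesis rho_p_continuous : forall j x, tau x != en (~~ j) ->
  {for x, continuous (fun x => rho j (p x))}.
Hypothesis p_continuous : forall x, tau x != 0 -> tau x != 1 ->
  {for x, continuous p}.
Hypothesis phi_rho : forall j b, phi j (rho j b) = E b (en j).
Hypothesis rho_onto : forall j y, exists b, rho j b = y.
Hypothesis rho_lift : forall j (u : R -> Y j) b b', continuous u ->
  rho j b = u 0 -> rho j b' = u 1 -> exists (v : R -> B) (h : R -> R),
  [/\ continuous v, continuous h, v 0 = b /\ v 1 = b', h 0 = 0 /\ h 1 = 1
    & forall s, rho j (v s) = u (h s)].
Hypothesis Xconn : path_connected_type R X.

Let A j : set X := [set x | tau x != en (~~ j)].

Let A_open j : open (A j).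
Proof.
by apply: (@open_comp _ _ tau [set t | t != en (~~ j)]) => // x _;
  exact: tau_continuous.
Qed.

Let A_cover x : exists j, A j x.
Proof.
have [e|e] := eqVneq (tau x) 0; last by exists true.
by exists false; rewrite /A /= e eq_sym oner_eq0.
Qed.

Let E_ct b : continuous (E b).
Proof.
apply: (@cts_comp _ _ _ (fun t : R => (b, t)) (fun P : B * R => E P.1 P.2)) => //.
by apply: cts_pair => t; [exact: cvg_cst|exact: cvg_id].
Qed.

Let E_cb t : continuous (fun b => E b t).
Proof.
apply: (@cts_comp _ _ _ (fun b : B => (b, t)) (fun P : B * R => E P.1 P.2)) => //.
by apply: cts_pair => b; [exact: cvg_id|exact: cvg_cst].
Qed.

Let near_in_A (c : R -> X) t : continuous c -> exists j, exists2 e, 0 < e &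
  forall x, t - e < x < t + e -> A j (c x).
Proof.
move=> cc; have [j Aj] := A_cover (c t); exists j.
have : \forall x \near t, A j (c x).
  exact: (cc t _ (open_nbhs_nbhs (conj (A_open j) Aj))).
move=> /nbhs_ballP[e /= e0 he]; exists e => // x xe; apply: he.
by rewrite /ball /= ltr_norml; lra.
Qed.

Let cts_rho_p (c : R -> X) j s t : continuous c ->
  (forall x, s <= x <= t -> A j (c x)) -> cts_on (fun x => rho j (p (c x))) s t.
Proof.
move=> cc cA x xi.
apply: (@continuous_comp _ _ _ c (fun x => rho j (p x))); first exact: cc.
exact: rho_p_continuous (cA x xi).
Qed.

(** A path of [X] that avoids one end is pushed to the other end orbit and
    lifted from there to [B]. *)
Let lift_piece (c : R -> X) j s t : s <= t -> continuous c ->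
  (forall x, s <= x <= t -> A j (c x)) -> exists (v : R -> B) (h : R -> R),
  [/\ continuous v, continuous h, v 0 = p (c s) /\ v 1 = p (c t), h 0 = 0 /\ h 1 = 1
    & forall x, rho j (v x) = seg_fun (fun x => rho j (p (c x))) s t (h x)].
Proof.
move=> st cc cA; apply: rho_lift.
- by apply: (cts_seg_fun _ _ (cts_rho_p cc cA)); rewrite ?lexx ?st.
- by rewrite /seg_fun clamp_le0 // mul0r addr0.
- by rewrite /seg_fun clamp_ge1 // mul1r addrC subrK.
Qed.

(** A path of [X] between two points of the middle orbit is lifted piece by
    piece. *)
Lemma cylinder_base_connected : path_connected_type R B.
Proof.
move=> b b'; have [c cc [c0 c1]] := Xconn (E b 2^-1) (E b' 2^-1).
have half : 0 < (2^-1 : R) < 1 by lra.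
suff : joined_in R setT (p (c 0)) (p (c 1)).
  by rewrite c0 c1 !pE // => -[v [cv v0 v1 _]]; exists v.
apply: (@interval_induction _ 0 1 (fun s t => joined_in R setT (p (c s)) (p (c t)))) => //.
- move=> t ti; have [j [e e0 eA]] := @near_in_A c t cc.
  exists e => // s s' h1 h2 h3 h4 h5 h6.
  have [||v [h [cv _ [v0 v1] _ _]]] := @lift_piece c j s s' _ cc.
  + by lra.
  + by move=> x xi; apply: eA; lra.
  + by exists v.
- by move=> r s t _ _ _ _; exact: joined_in_trans.
Qed.

Lemma cylinder_end_connected j : path_connected_type R (Y j).
Proof.
move=> y y'; have [b <-] := @rho_onto j y; have [b' <-] := @rho_onto j y'.
have [c cc [c0 c1]] := cylinder_base_connected b b'.
exists (fun s => rho j (c s)); last by rewrite c0 c1.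
exact: (cts_comp cc (@cts_fun _ _ (rho j))).
Qed.

Definition middle (b : B) : X := E b 2^-1.
HB.instance Definition _ := isContinuous.Build B X middle (@E_cb 2^-1).
Definition middle_map : continuousType B X := middle.

Variables (b0 : B).
Let x1 := middle b0.
Local Notation middle0 := (erefl (middle b0)).
Let Bconn := cylinder_base_connected.
Local Notation clsX := (cls x1 Xconn).
Local Notation clsB := (cls b0 Bconn).
Let th (b : B) := map_defect middle b0 x1 Bconn Xconn b.

(** The class of the cylinder line through [b] from the middle to the end [j]. *)
Let arm j b : pi1 R x1 := ((clsX (E b) 0 2^-1)^-1 * clsX (E b) 0 (en j))%g.

Let en_itv j : 0 <= en j <= 1.
Proof. by case: j; rewrite ?lexx ?ler01. Qed.

Let half_itv : 0 <= (2^-1 : R) <= 1.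
Proof. by lra. Qed.

Let half_neq_end j : (2^-1 : R) != en j.
Proof. by apply/eqP; case: j => /= e; lra. Qed.

Let cls_line b (s t : R) : 0 <= s <= 1 -> 0 <= t <= 1 ->
  clsX (fun r => E b ((1 - r) * s + r * t)) 0 1 = clsX (E b) s t.
Proof.
move=> si ti; have cE : cts_on (E b) 0 1 by move=> r _; exact: E_ct.
apply/esym/cls_eq01.
- exact: (cts_seg_fun si ti cE).
- apply: (@cts_seg_fun _ _ _ 0 1); rewrite ?lexx ?ler01 // => r _.
  have cl : continuous (fun r : R => (1 - r) * s + r * t).
    move=> x; apply: cvgD; apply: cvgM; (try exact: cvg_cst); (try exact: cvg_id).
    by apply: cvgB; [exact: cvg_cst|exact: cvg_id].
  exact: (cts_comp cl (@E_ct b)).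
- by move=> r _; congr (E b); ring.
Qed.

(** The rectangle rule on the part of the cylinder between the middle and an
    end, restricted to [v]. *)
Let slide j (v : R -> B) : continuous v ->
  clsX (fun s => middle (v s)) 0 1 =
  (arm j (v 0%R) * clsX (fun s => phi j (rho j (v s))) 0 1 * (arm j (v 1%R))^-1)%g.
Proof.
move=> cv.
pose h (P : R * R) := E (v P.1) ((1 - P.2) * 2^-1 + P.2 * en j).
have ch : continuous h.
  apply: (@cts_comp _ _ _ (fun P : R * R => (v P.1, (1 - P.2) * 2^-1 + P.2 * en j))
    (fun P : B * R => E P.1 P.2)) => //.
  apply: cts_pair; first exact: (cts_comp (@cts_fst _ _) cv).
  move=> P; apply: cvgD; apply: cvgM; (try exact: cvg_cst); (try exact: cvg_snd).
  by apply: cvgB; [exact: cvg_cst|exact: cvg_snd].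
have := @cls_square _ _ x1 Xconn h 0 1 0 1 ler01 ler01 (fun P _ _ => ch P).
rewrite /h /=.
have armE b : clsX (fun r => E b ((1 - r) * 2^-1 + r * en j)) 0 1 = arm j b.
  rewrite cls_line //; apply: (mulgI (clsX (E b) 0 2^-1)).
  rewrite (@cls_add _ _ _ _ (E b) 0 1) ?lexx ?ler01 //; last by move=> r _; exact: E_ct.
  by rewrite /arm mulVKg.
rewrite !armE => e; apply: (mulIg (arm j (v 1))); rewrite mulgVK.
have -> : (fun s => middle (v s)) = (fun s => E (v s) ((1 - 0) * 2^-1 + 0 * en j)).
  by apply/funext => s; rewrite /middle subr0 mul1r mul0r addr0.
rewrite e; congr (_ * cls _ _ _ _ _)%g.
by apply/funext => s; rewrite phi_rho subrr mul0r add0r mul1r.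
Qed.

(** The class of the cylinder line through [x] from the middle to [x]. *)
Let offset x : pi1 R x1 := ((clsX (E (p x)) 0 2^-1)^-1 * clsX (E (p x)) 0 (tau x))%g.

Hypothesis tau_itv : forall x, 0 <= tau x <= 1.

(** Pushing [x] along its cylinder line to the end [j]. *)
Let flow j (P : X * R) := E (p P.1) ((1 - P.2) * tau P.1 + P.2 * en j).

Let flow_continuous j x s : A j x -> {for (x, s), continuous (flow j)}.
Proof.
move=> Ax.
pose tm (P : X * R) := (1 - P.2) * tau P.1 + P.2 * en j.
have ctm : continuous tm.
  move=> P; apply: cvgD; apply: cvgM; (try exact: cvg_cst); (try exact: cvg_snd).
    by apply: cvgB; [exact: cvg_cst|exact: cvg_snd].
  exact: (cts_comp (@cts_fst _ _) tau_continuous).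
have [xj|xj] := eqVneq (tau x) (en j); last first.
  have cp : {for x, continuous p}.
    apply: p_continuous; move: Ax xj; rewrite /A /=; case: (j) => //=.
  apply: (@continuous_comp _ _ _ (fun P => (p P.1, tm P)) (fun P : B * R => E P.1 P.2)).
    have c1 : {for (x, s), continuous (fun P : X * R => p P.1)}.
      apply: (@continuous_comp _ _ _ fst p) => //; exact: cvg_fst.
    exact: (cvg_pair c1 (ctm (x, s))).
  exact: E_continuous.
(* On the end orbit [p] need not be continuous, but nearby points flow through
   points that are close to their final positions. *)
pose g (P : X * R) := phi j (rho j (p P.1)).
have cg : {for (x, s), continuous g}.
  apply: (@continuous_comp _ _ _ (fun P : X * R => rho j (p P.1)) (phi j)).
    apply: (@continuous_comp _ _ _ fst (fun x => rho j (p x))); first exact: cvg_fst.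
    exact: rho_p_continuous.
  exact: cts_fun.
have tmx : tm (x, s) = en j by rewrite /tm /= xj; ring.
have gx : g (x, s) = flow j (x, s) by rewrite /g /flow phi_rho -/(tm (x, s)) tmx.
move=> V /nbhs_ballP[e /= e0 eV].
have e20 : 0 < e / 2 by lra.
have e40 : 0 < e / 4 by lra.
have n1 : nbhs (x, s) (g @^-1` ball (g (x, s)) (e / 2)).
  exact: (cg _ (nbhsx_ballx _ _ e20)).
have n2 : nbhs (x, s) (tm @^-1` ball (tm (x, s)) (e / 4)).
  exact: (ctm (x, s) _ (nbhsx_ballx _ _ e40)).
apply: (@filterS _ _ _ (fun P => ball (g (x, s)) (e / 2) (g P) /\
  ball (tm (x, s)) (e / 4) (tm P))); last exact: (filterI n1 n2).
move=> P [Pg Pt]; rewrite /=; apply: eV.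
have {}Pt : `|en j - tm P| < e / 4 by move: Pt; rewrite tmx.
move: Pg; rewrite -gx !ballEmdist /= => Pg.
apply: le_lt_trans (metric_triangle _ (g P) _) _.
have : mdist (g P) (flow j P) <= 2 * `|en j - tm P|.
  by rewrite /g phi_rho; exact: E_lipschitz.
lra.
Qed.

Let conj_square (G : groupType) (o c l l' o' m : G) :
  (c * l' = l * m -> o * c * o'^-1 = (o * l) * m * (o' * l')^-1)%g.
Proof. by move=> e; rewrite -(mulgA o l m) -e invgM !mulgA mulgK. Qed.

(** Every path of [X] becomes, after the correction at its ends by the chosen
    paths from the middle orbit, the image of a loop of [B]; this holds for
    short paths, and the property is additive. *)
Let corrected (c : R -> X) (s t : R) : pi1 R x1 :=
  (th (p (c s)) * (offset (c s) * clsX c s t * (offset (c t))^-1)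
   * (th (p (c t)))^-1)%g.

Let corrected_piece (c : R -> X) j s t : s <= t -> continuous c ->
  (forall x, s <= x <= t -> A j (c x)) ->
  exists w, pi1_map R middle0 w = corrected c s t.
Proof.
move=> st cc cA; have [v [h [cv ch [v0 v1] [h0 h1] vu]]] := lift_piece st cc cA.
exists (clsB v 0 1).
rewrite (pi1_map_cls _ _ Xconn ler01 (fun s _ => cv s)) (slide j cv) v0 v1.
rewrite /corrected /th; congr (_ * _ * _)%g.
pose u := seg_fun (fun x => rho j (p (c x))) s t.
have si : s <= s <= t by rewrite lexx st.
have ti : s <= t <= t by rewrite lexx st.
have cpc := cts_rho_p cc cA.
have cu : continuous u by exact: (cts_seg_fun si ti cpc).
have cphi : continuous (phi j) by exact: cts_fun.
have -> : clsX (fun s => phi j (rho j (v s))) 0 1 =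
    clsX (fun x => phi j (rho j (p (c x)))) s t.
  have -> : (fun s => phi j (rho j (v s))) = (fun s => phi j (u (h s))).
    by apply/funext => x; rewrite vu.
  rewrite (@cls_reparam _ _ x1 Xconn (fun s => phi j (u s)) h (cts_comp cu cphi) ch h0 h1).
  apply/esym/cls_eq01.
  - exact: (cts_comp cu cphi).
  - apply: (@cts_seg_fun _ _ _ 0 1); rewrite ?lexx ?ler01 // => x _.
    exact: (cts_comp cu cphi).
  - by move=> x xi; rewrite /u /seg_fun clamp_id.
have armE x : arm j (p x) = (offset x * clsX (E (p x)) (tau x) (en j))%g.
  rewrite /arm /offset -mulgA; congr (_ * _)%g.
  rewrite (@cls_add _ _ _ _ (E (p x)) 0 1) ?lexx ?ler01 //.
  by move=> r _; exact: E_ct.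
rewrite !armE; apply/esym/conj_square.
rewrite -!cls_line //.
have := @cls_square _ _ x1 Xconn (fun P => flow j (c P.1, P.2)) s t 0 1 st ler01.
rewrite /flow /= => sq.
have e0 : (fun x => E (p (c x)) ((1 - 0) * tau (c x) + 0 * en j)) = c.
  by apply/funext => x; rewrite subr0 mul1r mul0r addr0 EK.
rewrite e0 in sq; rewrite sq.
- congr (_ * cls _ _ _ _ _)%g; apply/funext => x.
  by rewrite phi_rho subrr mul0r add0r mul1r.
- move=> [x r] /= xi ri.
  apply: (@continuous_comp _ _ _ (fun P : R * R => (c P.1, P.2)) (flow j)).
    have cf : continuous (fun P : R * R => (c P.1, P.2)).
      by apply: cts_pair; [exact: (cts_comp (@cts_fst _ _) cc)|exact: cts_snd].
    exact: cf.
  exact/flow_continuous/cA.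
Qed.

Let corrected_glue (G : groupType) (h a c b h' c' a' h'' c'' : G) :
  (c * c' = c'' -> (h * (a * c * b^-1) * h'^-1) * (h' * (b * c' * a'^-1) * h''^-1)
   = h * (a * c'' * a'^-1) * h''^-1)%g.
Proof. by move=> <-; rewrite !mulgA !mulgVK. Qed.

Lemma middle_pi1_onto (q : pi1 R x1) : exists w, pi1_map R middle0 w = q.
Proof.
have [l lq] : exists l, loop_class l = q by exists (repr q); exact: reprK.
pose c := path_ext l.
have cc : continuous c by exact/continuous_path_ext/cts_fun.
have : exists w, pi1_map R middle0 w = corrected c 0 1.
  apply: (@interval_induction _ 0 1 (fun s t => exists w, pi1_map R middle0 w = corrected c s t)) => //.
  - move=> t ti; have [j [e e0 eA]] := @near_in_A c t cc.
    exists e => // s s' h1 h2 h3 h4 h5 h6.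
    apply: (@corrected_piece c j s s' _ cc); first by lra.
    by move=> x xi; apply: eA; lra.
  - move=> r s t r0 rs st t1 [w wE] [w' w'E]; exists (w * w')%g.
    have -> : pi1_map R middle0 (w * w')%g =
        (pi1_map R middle0 w * pi1_map R middle0 w')%g by exact: gmulfM.
    rewrite wE w'E; apply: corrected_glue.
    by apply: (@cls_add _ _ _ _ c 0 1) => //; [lra..|move=> x _; exact: cc].
move=> [w wE]; exists w; rewrite wE /corrected.
have px1 : p x1 = b0 by apply: pE; lra.
have c0 : c 0 = x1 by rewrite /c path_ext_le0.
have c1 : c 1 = x1 by rewrite /c path_ext_ge1.
have o1 : offset x1 = 1%g by rewrite /offset px1 tauE // mulVg.
by rewrite c0 c1 o1 px1 /th map_defect_base !invg1 !mulg1 !mul1g cls_loop.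
Qed.

Variable y0 : forall j, Y j.
Hypothesis rho0 : forall j, rho j b0 = y0 j.
Local Notation Yconn j := (@cylinder_end_connected j).

Let map_defect0 j : map_defect (rho j) b0 (y0 j) Bconn (Yconn j) b0 = 1%g.
Proof. by case: _ / (rho0 j); exact: map_defect_base. Qed.

Let pi1_rho_cls j (v : R -> B) : continuous v -> v 0 = b0 -> v 1 = b0 ->
  pi1_map R (rho0 j) (clsB v 0 1) =
  cls (y0 j) (Yconn j) (fun s => rho j (v s)) 0 1.
Proof.
move=> cv v0 v1.
rewrite (pi1_map_cls _ _ (Yconn j) ler01 (fun s _ => cv s)) v0 v1 map_defect0.
by rewrite invg1 mulg1 mul1g.
Qed.

Let loopP (w : pi1 R b0) : exists v : R -> B, [/\ continuous v, v 0 = b0, v 1 = b0,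
  w = clsB v 0 1 & exists2 l, w = loop_class l & v = path_ext l].
Proof.
have [l lw] : exists l, loop_class l = w by exists (repr w); exact: reprK.
exists (path_ext l); split.
- exact/continuous_path_ext/cts_fun.
- by rewrite path_ext_le0.
- by rewrite path_ext_ge1.
- by rewrite cls_loop.
- by exists l.
Qed.

(** The loop is slid to the end orbit, where it is contractible. *)
Lemma middle_pi1_kernel j (w : pi1 R b0) :
  pi1_map R (rho0 j) w = 1%g -> pi1_map R middle0 w = 1%g.
Proof.
have [v [cv v0 v1 -> _]] := loopP w; rewrite pi1_rho_cls // => e.
rewrite (pi1_map_cls _ _ Xconn ler01 (fun s _ => cv s)) (slide j cv) v0 v1.
rewrite (@cls_push_trivial _ _ _ (phi j) (y0 j) x1 (Yconn j) Xconn
  (fun s => rho j (v s)) _ _ e).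
- by rewrite map_defect_base invg1 mulg1 mul1g mulg1 mulgV.
- exact: (cts_comp cv (@cts_fun _ _ (rho j))).
- by rewrite v0 v1.
Qed.

(** A loop of an end orbit lifts with both ends at the base point. *)
Lemma rho_pi1_onto j (z : pi1 R (y0 j)) : exists w, pi1_map R (rho0 j) w = z.
Proof.
have [l lz] : exists l, loop_class l = z by exists (repr z); exact: reprK.
pose u := path_ext l.
have cu : continuous u by exact/continuous_path_ext/cts_fun.
have [||v [h [cv ch [v0 v1] [h0 h1] vu]]] := @rho_lift j u b0 b0 cu.
- by rewrite rho0 /u path_ext_le0.
- by rewrite rho0 /u path_ext_ge1.
exists (clsB v 0 1); rewrite pi1_rho_cls //.
have -> : (fun s => rho j (v s)) = (fun s => u (h s)) by apply/funext => s; rewrite vu.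
by rewrite cls_reparam // cls_loop.
Qed.

Section Injective.
Variables (Q : groupType) (iota : {multiplicative pi1 R b0 -> Q}).
Hypothesis iota_ker : forall j w, pi1_map R (rho0 j) w = 1%g -> iota w = 1%g.

Let end_hom j (z : pi1 R (y0 j)) : Q := iota (sval (cid (rho_pi1_onto z))).

Let iota_eq j (w w' : pi1 R b0) :
  pi1_map R (rho0 j) w = pi1_map R (rho0 j) w' -> iota w = iota w'.
Proof.
move=> e.
have mM x y : pi1_map R (rho0 j) (x * y)%g =
    (pi1_map R (rho0 j) x * pi1_map R (rho0 j) y)%g by exact: gmulfM.
have m1 : pi1_map R (rho0 j) 1%g = 1%g.
  by apply: (mulgI (pi1_map R (rho0 j) 1%g)); rewrite -mM !mulg1.
have : iota (w * w'^-1)%g = 1%g.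
  by apply: (iota_ker (j := j)); rewrite mM e -mM mulgV.
rewrite gmulfM => e1; apply: (mulIg (iota w'^-1)%g); rewrite e1 -gmulfM mulgV.
by apply: (mulgI (iota 1%g)); rewrite -gmulfM !mulg1.
Qed.

Let end_homE j w : end_hom (pi1_map R (rho0 j) w) = iota w.
Proof. by apply: (@iota_eq j); exact: (svalP (cid (rho_pi1_onto _))). Qed.

Let end_homM j : {morph @end_hom j : x y / (x * y)%g}.
Proof.
move=> z z'; have [w <-] := rho_pi1_onto z; have [w' <-] := rho_pi1_onto z'.
have -> : (pi1_map R (rho0 j) w * pi1_map R (rho0 j) w')%g = pi1_map R (rho0 j) (w * w')%g.
  by rewrite -gmulfM.
by rewrite !end_homE gmulfM.
Qed.

HB.instance Definition _ j := isMultiplicative.Build _ _ (@end_hom j) (@end_homM j).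

(** As the fundamental group of [B] maps onto those of the end orbits, [iota]
    factors through them, which is what the van Kampen principle asks for. *)
Lemma middle_pi1_injective (w : pi1 R b0) :
  pi1_map R middle0 w = 1%g -> iota w = 1%g.
Proof.
have [v [cv v0 v1 wv [l wl vl]]] := loopP w.
rewrite {1}wl pi1_map_class => /loop_classP [h [ch h0 h1 hb]].
rewrite -(@end_homE true).
have mid_A j b : A j (middle b).
  by rewrite /A /middle /= tauE // half_neq_end.
have := @van_kampen_injective R X B Y A p rho b0 y0 rho0 Q (fun j => @end_hom j)
  Bconn cylinder_end_connected A_open A_cover rho_p_continuous _ _
  middle v (fun P => h (to_unit P.1, to_unit P.2)) x1 true (@E_cb _) _ (mid_A true) cv.
rewrite -wv; apply.
- move=> x; rewrite /A /= mulr1n mulr0n => x0 x1'; exact: p_continuous.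
- move=> w'; exact: (etrans (@end_homE true w') (esym (@end_homE false w'))).
- by move=> b; apply: pE; lra.
- apply: (@cts_comp _ _ _ (fun P : R * R => (to_unit P.1, to_unit P.2)) h) => //.
  by apply: cts_pair; [exact: (cts_comp (@cts_fst _ _) (@continuous_to_unit R))
    |exact: (cts_comp (@cts_snd _ _) (@continuous_to_unit R))].
- by move=> s _; rewrite vl; exact: (h0 (to_unit s)).
- by move=> s _; exact: (h1 (to_unit s)).
- by move=> t _; exact: (hb (to_unit t)).
Qed.

End Injective.


End MappingCylinder.

(** * The amalgamated quotient of the free product *)

Section Multiplicative.
Variables (G H : groupType) (f : {multiplicative G -> H}).

Lemma multiplicative1 : f 1%g = 1%g.
Proof. by apply: (mulgI (f 1%g)); rewrite -gmulfM !mulg1. Qed.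

Lemma multiplicativeV x : f x^-1%g = ((f x)^-1)%g.
Proof. by apply: (mulgI (f x)); rewrite -gmulfM !mulgV multiplicative1. Qed.

Lemma multiplicative_eq x y : f x = f y <-> f (x * y^-1)%g = 1%g.
Proof.
rewrite gmulfM multiplicativeV; split => [->|e]; first exact: mulgV.
by apply: (mulIg (f y)^-1%g); rewrite e mulgV.
Qed.

End Multiplicative.

Lemma isomorphism_same_kernel (P G H : groupType) (g : {multiplicative P -> G})
    (h : {multiplicative P -> H}) :
  (forall y, exists w, g w = y) -> (forall z, exists w, h w = z) ->
  (forall w, g w = 1%g <-> h w = 1%g) -> group_isomorphic G H.
Proof.
move=> gonto honto ker.
have gh w w' : g w = g w' <-> h w = h w'.
  by rewrite !multiplicative_eq; exact: ker.
pose k y := h (sval (cid (gonto y))).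
have kE w : k (g w) = h w by apply/gh; exact: (svalP (cid (gonto (g w)))).
have kM : {morph k : x y / (x * y)%g >-> (x * y)%g}.
  move=> x y; have [w <-] := gonto x; have [w' <-] := gonto y.
  by rewrite -gmulfM !kE gmulfM.
pose K : {multiplicative G -> H} := HB.pack k (isMultiplicative.Build _ _ k kM).
exists K; apply: (@Bijective _ _ _ (fun z => g (sval (cid (honto z))))) => [y|z].
  have [w <-] := gonto y; rewrite [K _]kE.
  by apply/gh; exact: (svalP (cid (honto _))).
rewrite [LHS]kE; exact: (svalP (cid (honto _))).
Qed.

Lemma group_isomorphic_trans (G H K : groupType) :
  group_isomorphic G H -> group_isomorphic H K -> group_isomorphic G K.
Proof.
move=> [g gb] [h hb].
have hgM : {morph h \o g : x y / (x * y)%g >-> (x * y)%g}.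
  by move=> x y /=; rewrite !gmulfM.
pose hg : {multiplicative G -> K} := HB.pack (h \o g) (isMultiplicative.Build _ _ (h \o g) hgM).
by exists hg; exact: (bij_comp hb gb).
Qed.

Section Amalgam.
Variables (P : groupType) (N M : normal_subgroup P).
Local Notation FP := (free_product (quotient_group N) (quotient_group M)).
Let inlc w : FP := free_inl (quotient_class N w).
Let inrc w : FP := free_inr (quotient_class M w).

Definition amalgam_relations : normal_subgroup FP :=
  normal_closure [set (inlc w * (inrc w)^-1)%g | w in [set: P]].

Definition to_amalgam (w : P) : quotient_group amalgam_relations :=
  quotient_class amalgam_relations (inlc w).

Let classM (Q : groupType) (S : normal_subgroup Q) (x y : Q) :
  (quotient_class S x * quotient_class S y)%g = quotient_class S (x * y)%g.
Proof. exact: quotient_classM. Qed.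

Let freeM (A B : groupType) (u v : seq (A + B)) :
  (free_class u * free_class v)%g = free_class (u ++ v).
Proof. exact: free_classM. Qed.

Let inlcM w w' : (inlc w * inlc w')%g = inlc (w * w')%g.
Proof.
rewrite /inlc /free_inl freeM -classM; apply/free_classP; exact: FreeInlM.
Qed.

Lemma to_amalgamM : {morph to_amalgam : x y / (x * y)%g >-> (x * y)%g}.
Proof. by move=> x y; rewrite /to_amalgam classM inlcM. Qed.

HB.instance Definition _ := isMultiplicative.Build _ _ to_amalgam to_amalgamM.

Lemma to_amalgam_inr w : to_amalgam w = quotient_class amalgam_relations (inrc w).
Proof.
apply/esym/quotient_classP.
have -> : ((inrc w)^-1 * inlc w = (inlc w * (inrc w)^-1) ^ inrc w)%g.
  by rewrite /conjg mulgVK.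
by apply: normal_subgroupJ => S SS; apply: SS; exists w.
Qed.

Lemma to_amalgam_ker_l w : subgroup_set N w -> to_amalgam w = 1%g.
Proof.
move=> Nw; rewrite -(multiplicative1 to_amalgam) /to_amalgam /inlc.
have -> // : quotient_class N w = quotient_class N 1%g.
by apply/esym/quotient_classP; rewrite invg1 mul1g.
Qed.

Lemma to_amalgam_ker_r w : subgroup_set M w -> to_amalgam w = 1%g.
Proof.
move=> Mw; rewrite -(multiplicative1 to_amalgam) to_amalgam_inr /inrc.
have -> : quotient_class M w = quotient_class M 1%g.
  by apply/esym/quotient_classP; rewrite invg1 mul1g.
exact/esym/to_amalgam_inr.
Qed.

(** The relations identify both letters of a word with classes of elements of
    [P], so that every word collapses to one letter. *)
Lemma to_amalgam_onto z : exists w, to_amalgam w = z.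
Proof.
elim/quotW: z; elim/quotW => u; rewrite -/(quotient_class _ _) -/(free_class _).
elim: u => [|l u [w wE]]; first by exists 1%g; rewrite multiplicative1.
have -> : free_class (l :: u) = (free_class [:: l] * free_class u)%g by rewrite freeM.
rewrite -classM -wE; case: l => q; rewrite -(reprK q).
  by exists (repr q * w)%g; rewrite to_amalgamM.
by exists (repr q * w)%g; rewrite to_amalgamM to_amalgam_inr.
Qed.

(** Evaluating words by [g] respects the relations, so [g] factors through the
    quotient of the free product. *)
Lemma to_amalgam_kernel (G : groupType) (g : {multiplicative P -> G}) :
  (forall w, subgroup_set N w -> g w = 1%g) ->
  (forall w, subgroup_set M w -> g w = 1%g) ->
  forall w, to_amalgam w = 1%g -> g w = 1%g.
Proof.
move=> gN gM.
have gE (S : normal_subgroup P) (w : P) : (forall w, subgroup_set S w -> g w = 1%g) ->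
    g (repr (quotient_class S w)) = g w.
  move=> gS; apply/esym/multiplicative_eq.
  have /quotient_classP Sw : quotient_class S (repr (quotient_class S w)) = quotient_class S w.
    exact: reprK.
  have /gS : subgroup_set S (((repr (quotient_class S w))^-1 * w) ^ (repr (quotient_class S w))^-1)%g.
    exact: normal_subgroupJ.
  by rewrite /conjg invgK !mulgA mulgV mul1g.
pose ev (l : quotient_group N + quotient_group M) :=
  match l with inl q => g (repr q) | inr q => g (repr q) end.
pose evw (u : seq (quotient_group N + quotient_group M)) :=
  foldr (fun l x => (ev l * x)%g) 1%g u.
have evw_cat u v : evw (u ++ v) = (evw u * evw v)%g.
  by elim: u => [|l u IHu] /=; rewrite ?mul1g // IHu mulgA.
have gM' (S : normal_subgroup P) (x y : quotient_group S) :
    (forall w, subgroup_set S w -> g w = 1%g) ->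
    g (repr (x * y)%g) = (g (repr x) * g (repr y))%g.
  move=> gS; rewrite -gmulfM -(gE S (repr x * repr y)%g gS); congr (g (repr _)).
have evw_rel u v : free_word_rel u v -> evw u = evw v.
  elim=> {u v} //=.
  - by move=> u v w _ -> _ ->.
  - by move=> u u' v v' _ e _ e'; rewrite !evw_cat e e'.
  - by rewrite mulg1 [X in repr X](_ : _ = quotient_class N 1%g) // gE // multiplicative1.
  - by rewrite mulg1 [X in repr X](_ : _ = quotient_class M 1%g) // gE // multiplicative1.
  - by move=> x y; rewrite !mulg1 gM'.
  - by move=> x y; rewrite !mulg1 gM'.
pose e (x : FP) := evw (repr x).
have eE u : e (free_class u) = evw u.
  by apply: evw_rel; apply/free_classP; exact: reprK.
have eM : {morph e : x y / (x * y)%g >-> (x * y)%g}.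
  elim/quotW => u; elim/quotW => v; rewrite -!/(free_class _) freeM !eE; exact: evw_cat.
pose ehom : {multiplicative FP -> G} := HB.pack e (isMultiplicative.Build _ _ e eM).
have einl w : e (inlc w) = g w by rewrite eE /= mulg1 gE.
have einr w : e (inrc w) = g w by rewrite eE /= mulg1 gE.
move=> w /esym /quotient_classP; rewrite invg1 mul1g => /(_ (Defs.kernel ehom)).
rewrite /= einl; apply=> _ [w' _ <-] /=.
apply: (etrans (eM _ _)).
have -> : e (inrc w')^-1%g = ((e (inrc w'))^-1)%g by exact: (multiplicativeV ehom).
by rewrite einl einr mulgV.
Qed.

End Amalgam.

(** * Change of base point and conclusion *)

Section BasePoint.
Variables (R : realType) (T : topologicalType) (x y : T).
Hypothesis Tconn : path_connected_type R T.

Definition move_base (q : pi1 R x) : pi1 R y := path_class y Tconn (repr q).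

Lemma move_baseE (l : {path (unit_interval R) from x to x}) :
  move_base (loop_class l) = path_class y Tconn l.
Proof. by apply: path_class_homotopic; exact: loop_class_repr. Qed.

Lemma move_baseM : {morph move_base : p q / (p * q)%g >-> (p * q)%g}.
Proof.
elim/quotW => l; elim/quotW => l'; rewrite -!/(loop_class _).
have -> : (loop_class l * loop_class l')%g = loop_class (concat l l').
  exact: loop_classM.
by rewrite !move_baseE path_classM.
Qed.

HB.instance Definition _ := isMultiplicative.Build _ _ move_base move_baseM.

Lemma move_base_bijective : bijective move_base.
Proof.
have inj : injective move_base.
  elim/quotW => l; elim/quotW => l'; rewrite -!/(loop_class _) !move_baseE.
  by move=> /path_class_inj h; apply/loop_classP.
have [bp bp1] : exists bp : {path (unit_interval R) from y to x},
    path_class y Tconn bp = 1%g.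
  exists (base_path y Tconn x); apply/loop_classP.
  apply: path_homotopic_trans (concatpV (base_path y Tconn x)).
  apply: concat_congr1; apply: path_homotopic_trans (concat1p _).
  by apply: concat_congr1; exact: base_path1.
have bpV : path_class y Tconn (reverse bp) = 1%g.
  apply: (mulgI (path_class y Tconn bp)); rewrite -path_classM {1}bp1 mulg1.
  by rewrite -(path_class_cst y Tconn y); apply/path_class_homotopic/concatpV.
have onto q : exists w, move_base w = q.
  elim/quotW: q => m; rewrite -/(loop_class _).
  exists (loop_class (concat (concat (reverse bp) m) bp)).
  by rewrite move_baseE !path_classM path_class_loop bp1 bpV mul1g mulg1.
exists (fun q => sval (cid (onto q))) => [w|q]; last exact: (svalP (cid (onto q))).
by apply: inj; exact: (svalP (cid (onto _))).
Qed.

End BasePoint.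

Section Assembly.
Variables (R : realType) (X : completeMetricType R).

Lemma geodesic_path_connected : geodesic_space X -> path_connected_type R X.
Proof.
move=> Xgeo x y; have [c [c0 c1]] := Xgeo x y.
exists (fun t => c (to_unit t)) => //.
move=> t V /nbhs_ballP[e /= e0 eV].
pose d := mdist (c zero) (c one).
have d0 : 0 <= d by exact: mdist_ge0.
have d1 : 0 < e / (d + 1) by apply: divr_gt0 => //; lra.
apply: (@filterS _ _ _ (fun s => ball (clamp t) (e / (d + 1)) (clamp s))); last first.
  exact: (@continuous_clamp R t _ (nbhsx_ballx (clamp t) _ d1)).
move=> s st; apply: eV.
rewrite ballEmdist /= geodesicP -/d.
have {}st : `|clamp t - clamp s| < e / (d + 1) by exact: st.
move: st; rewrite ltr_pdivlMr; last lra.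
by have := normr_ge0 (clamp t - clamp s); lra.
Qed.

Variables (G : topologicalGroupType) (a : isometric_action X G).

Lemma isotropy_closed x : closed (isotropy a x : set G).
Proof.
have -> : (isotropy a x : set G) = (fun g => a g x) @^-1` [set x] by [].
apply: preimage_closed => [g _|]; first exact: act_continuous_l.
exact/accessible_closed_set1/hausdorff_accessible/metric_hausdorff.
Qed.

End Assembly.

Theorem theorem4p14 (R : realType) (X : completeMetricType R)
  (m : {measure set (borel X) -> \bar R})
  (X_mms : metric_measure_space m)
  (X_geodesic : geodesic_space X)
  (X_enb : essentially_nonbranching m)
  (G : topologicalGroupType)
  (G_lie : lie_group R G)
  (G_compact : compact [set: G])
  (a : isometric_action X G)
  (f : orbit_space a -> R)
  (f_isometry : isometry_onto_interval f)
  (T : associated_tuple f)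
  (Kplus_H_connected : connected (coset_image (tuple_H T) (tuple_Kplus T)))
  (Kminus_H_connected : connected (coset_image (tuple_H T) (tuple_Kminus T)))
  (x0 : X) :
  group_isomorphic (pi1 R x0) (quotient_group (N_zero T)).
Proof.
pose b0 : coset_space (tuple_H T) := coset (tuple_H T) 1%g.
pose y0 j : coset_space (end_isotropy T j) := coset (end_isotropy T j) 1%g.
pose rho j : continuousType (coset_space (tuple_H T)) (coset_space (end_isotropy T j)) :=
  @rho_end _ _ _ _ _ T j.
pose rho0 j : rho j b0 = y0 j :=
  match j with true => rho_plus1 T | false => rho_minus1 T end.
pose phi j : continuousType (coset_space (end_isotropy T j)) X :=
  @end_orbit _ _ _ _ _ T j.
pose p := cylinder_base G_compact f_isometry T.
pose E := @cylinder _ _ _ _ _ T.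
pose tau (x : X) : R := (f (orbit_class a x) + 1) / 2.
have Xconn := geodesic_path_connected X_geodesic.
have tauE b t : 0 <= t <= 1 -> tau (E b t) = t.
  by move=> t01; rewrite /tau (tau_act_gam G_compact f_isometry) clamp_id.
have pE b t : 0 < t < 1 -> p (E b t) = b.
  by move=> t01; rewrite -[RHS]coset_repr; exact: cylinder_base_act.
have EK x : E (p x) (tau x) = x by exact: cylinder_baseK.
have tau01 x : 0 <= tau x <= 1 by exact: tau_itv.
have ctau : continuous tau by exact: tau_continuous.
have cE : continuous (fun P : coset_space (tuple_H T) * R => E P.1 P.2).
  exact: (cylinder_continuous G_compact f_isometry).
have lipE b s t : mdist (E b s) (E b t) <= 2 * `|s - t|.
  exact: (cylinder_lipschitz G_compact f_isometry).
have crho j x : tau x != (~~ j)%:R -> {for x, continuous (fun x => rho j (p x))}.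
  exact: rho_base_continuous.
have cp x : tau x != 0 -> tau x != 1 -> {for x, continuous p}.
  exact: base_continuous.
have phi_rho j b : phi j (rho j b) = E b j%:R by exact: end_orbitE.
have rho_onto j y : exists b, rho j b = y.
  by exists (coset (tuple_H T) (repr y)); rewrite /= /rho_end orbit_projectionE coset_repr.
have rho_lift j := @orbit_projection_lift R G (tuple_H T) (end_isotropy T j)
  (@tuple_H_end _ _ _ _ _ T j) G_lie.
have Kcl j : closed (end_isotropy T j : set G) by case: j; exact: isotropy_closed.
have KHconn j : connected (coset_image (tuple_H T) (end_isotropy T j)) by case: j.
have {}rho_lift j := rho_lift j (Kcl j) (KHconn j).
have onto := middle_pi1_onto cE lipE ctau tauE pE EK crho cp phi_rho rho_lift Xconn tau01 (b0 := b0).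
have ker := middle_pi1_kernel cE ctau pE crho phi_rho rho_onto rho_lift Xconn (rho0 := rho0).
have inj := @middle_pi1_injective R X _ _ rho E tau p cE ctau tauE pE crho cp rho_onto rho_lift Xconn b0 y0 rho0.
pose g : {multiplicative pi1 R b0 -> pi1 R (middle E b0)} :=
  @pi1_map R _ _ (middle_map cE) b0 (middle E b0) erefl.
have NE : N_zero T = amalgam_relations (N_plus T) (N_minus T) by [].
rewrite NE.
pose am : {multiplicative pi1_GH T -> quotient_group (amalgam_relations (N_plus T) (N_minus T))} :=
  @to_amalgam (pi1_GH T) (N_plus T) (N_minus T).
have amP j w : pi1_map R (rho0 j) w = 1%g -> am w = 1%g.
  case: j => e.
    have h := (@to_amalgam_ker_l (pi1_GH T) (N_plus T) (N_minus T) w e). exact: h.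
  exact: (@to_amalgam_ker_r (pi1_GH T) (N_plus T) (N_minus T) w e).
apply: (@group_isomorphic_trans _ (pi1 R (middle E b0))).
  exists (@move_base R X x0 (middle E b0) Xconn); exact: move_base_bijective.
apply: (@isomorphism_same_kernel _ _ _ g am onto).
  exact: (@to_amalgam_onto (pi1_GH T)).
move=> w; split; first exact: (inj _ am amP).
apply: (@to_amalgam_kernel (pi1_GH T) (N_plus T) (N_minus T) _ g).
- by move=> w' Nw'; exact: (ker true w' Nw').
- by move=> w' Nw'; exact: (ker false w' Nw').
Qed.
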